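(* There exists a family of non-c-connected flat clustered graphs $C(G,T)$ with planar underlying graph $G$ on $n$ vertices, for arbitrarily large $n$, such that each $C(G,T)$ in the family admits an $\langle\alpha,0,0\rangle$-drawing, a $\langle 0,\beta,0\rangle$-drawing, and a $\langle 0,0,\gamma\rangle$-drawing, and such that $\alpha+\beta+\gamma\in\Omega(n^2)$ for every $\langle\alpha,\beta,\gamma\rangle$-drawing of $C(G,T)$.
   Context: A clustered graph $C(G,T)$ consists of a graph $G$ and a rooted tree $T$ whose leaves are exactly the vertices of $G$; each internal node $\mu$ of $T$ is a cluster, identified with the set of leaves of its subtree. $C(G,T)$ is c-connected if for every cluster the subgraph of $G$ induced by its vertices is connected; it is flat if no cluster other than the root contains another cluster. A drawing of $C(G,T)$ maps vertices to distinct points, edges to open curves between their endpoints, and each cluster $\mu$ to a simple closed region $R(\mu)$ containing all and only the vertices of $\mu$, with $R(\nu)\supseteq R(\mu)$ whenever $\mu$ is a descendant of $\nu$. Intersections among curves are isolated points, no three curves meet at a point, and two curves alternate around each intersection point. Edge-edge crossings are crossings between two edges; an edge crossing the boundary of $R(\mu)$ exactly $k$ times contributes $\lfloor k/2\rfloor$ edge-region crossings; for clusters $\mu,\nu$ neither an ancestor of the other, the number of region-region crossings is the number of connected components of $R(\mu)\setminus R(\nu)$ minus one. An $\langle\alpha,\beta,\gamma\rangle$-drawing has exactly $\alpha$ edge-edge, $\beta$ edge-region and $\gamma$ region-region crossings. *)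

(* Defs.v *)
From HB Require Import structures.
From mathcomp Require Import all_boot all_order all_algebra.
From mathcomp Require Import boolp classical_sets functions cardinality.
From mathcomp Require Import set_interval reals topology normedtype.

Set Implicit Arguments.
Unset Strict Implicit.
Unset Printing Implicit Defensive.

Import Order.TTheory GRing.Theory Num.Theory.
Import numFieldNormedType.Exports.

Local Open Scope classical_set_scope.
Local Open Scope card_scope.
Local Open Scope ring_scope.

Record sgraph := SGraph {
  vertex :> finType;
  adj : rel vertex;
  adj_sym : symmetric adj;
  adj_irr : irreflexive adj
}.

Definition edges (G : sgraph) : {set {set G}} :=
  [set e : {set G} | [exists u, exists v, adj u v && (e == [set u; v]%SET)]]%SET.

Definition induced_adj (G : sgraph) (A : {set G}) : rel G :=
  [rel u v | [&& u \in A, v \in A & adj u v]].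

Definition induced_connected (G : sgraph) (A : {set G}) : Prop :=
  {in A &, forall u v, connect (induced_adj A) u v}.

(* The rooted tree has node set [ugraph + cnode]: its leaves are the vertices
   of the graph, its internal nodes are the clusters.  [leaf_parent] and
   [parent] give the parent of a leaf and of an internal node, with the
   convention that the root is its own parent; [parent_wf] makes this a tree
   rooted at [croot], and [has_child] says that no element of [cnode] is a
   leaf.  Internal nodes with a single child are allowed. *)
Record clustered_graph := ClusteredGraph {
  ugraph : sgraph;
  cnode : finType;
  croot : cnode;
  leaf_parent : ugraph -> cnode;
  parent : cnode -> cnode;
  parent_croot : parent croot = croot;
  parent_wf : forall mu, exists k, iter k parent mu = croot;
  has_child : forall mu, (exists v, leaf_parent v = mu) \/
                         (exists2 nu, nu != croot & parent nu = mu)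
}.

Section Clusters.
Variable C : clustered_graph.

(* Reflexive: every cluster is a descendant of itself. *)
Definition descendant (mu nu : cnode C) : bool :=
  fconnect (@parent C) mu nu.

Definition cluster_vertices (mu : cnode C) : {set ugraph C} :=
  [set v | descendant (leaf_parent v) mu]%SET.

Definition incomparable (mu nu : cnode C) : bool :=
  ~~ descendant mu nu && ~~ descendant nu mu.

Definition c_connected : Prop :=
  forall mu : cnode C, induced_connected (cluster_vertices mu).

Definition flat : Prop :=
  forall mu nu : cnode C, mu != croot C -> nu != mu -> ~~ descendant nu mu.

End Clusters.

Section Plane.
Variable R : realType.
Notation plane := (R * R)%type.

Definition open_arc (A : set plane) (p q : plane) : Prop :=
  exists f : R -> plane,
    [/\ {within `[0, 1], continuous f},
        {in `[0, 1] &, injective f},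
        f 0 = p, f 1 = q & A = f @` `]0, 1[].

Definition simple_closed_curve (J : set plane) : Prop :=
  exists f : R -> plane,
    [/\ {within `[0, 1], continuous f},
        {in `[0, 1[ &, injective f},
        f 0 = f 1 & J = f @` `[0, 1]].

Definition frontier (A : set plane) : set plane := closure A `\` A°.

(* The closed regions bounded by a simple closed curve; compactness selects the
   bounded side of the curve, and the nonempty interior excludes the curve
   alone. *)
Definition simple_closed_region (A : set plane) : Prop :=
  [/\ compact A, A° !=set0, connected A° & simple_closed_curve (frontier A)].

(* A and B alternate around p: some homeomorphism h between open neighbourhoods
   of p and of the origin sends p to the origin, A to the horizontal axis and B
   to the vertical axis, so that the two branches of A at p separate the two
   branches of B.  In particular p is an isolated point of the intersection of
   A and B. *)
Definition alternate_at (A B : set plane) (p : plane) : Prop :=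
  exists (U V : set plane) (h g : plane -> plane),
    [/\ [/\ open U, open V, U p & h p = (0, 0)],
        h @` U = V,
        forall x, U x -> g (h x) = x,
        {within U, continuous h} /\ {within V, continuous g}
      & forall x, U x -> (A x <-> (h x).2 = 0) /\ (B x <-> (h x).1 = 0)].

Definition components (A : set plane) : set (set plane) :=
  connected_component A @` A.

Section GraphDrawings.
Variable G : sgraph.

(* [ecurve e] is the open curve representing e, without its endpoints. *)
Definition graph_drawing (pos : G -> plane) (ecurve : {set G} -> set plane) : Prop :=
  [/\ injective pos,
      forall u v, adj u v -> open_arc (ecurve [set u; v]%SET) (pos u) (pos v)
    & forall e v, e \in edges G -> ~ ecurve e (pos v)].

Definition planar : Prop :=
  exists pos ecurve, graph_drawing pos ecurve /\
    forall e f, e \in edges G -> f \in edges G -> e != f ->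
      ecurve e `&` ecurve f = set0.

End GraphDrawings.

Section ClusteredDrawings.
Variable C : clustered_graph.
Local Notation G := (ugraph C).

Record predrawing := Predrawing {
  pos : G -> plane;
  ecurve : {set G} -> set plane;
  region : cnode C -> set plane
}.

Variable D : predrawing.

(* The curves of a drawing are the open curves of the edges and the boundaries
   of the regions. *)
Definition is_curve (i : {set G} + cnode C) : bool :=
  if i is inl e then e \in edges G else true.

Definition curve (i : {set G} + cnode C) : set plane :=
  match i with
  | inl e => ecurve D e
  | inr mu => frontier (region D mu)
  end.

Definition general_position : Prop :=
  (forall i j p, is_curve i -> is_curve j -> i != j ->
     curve i p -> curve j p -> alternate_at (curve i) (curve j) p) /\
  (forall i j k, is_curve i -> is_curve j -> is_curve k ->
     i != j -> j != k -> i != k -> curve i `&` curve j `&` curve k = set0).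

Definition clustered_drawing : Prop :=
  [/\ graph_drawing (pos D) (ecurve D),
      forall mu, simple_closed_region (region D mu),
      forall mu v, (region D mu (pos D v) <-> v \in cluster_vertices mu) /\
                   ~ frontier (region D mu) (pos D v),
      forall mu nu, descendant mu nu -> region D mu `<=` region D nu
    & general_position].

(* As no three curves share a point, a point lies on at most one pair of edges,
   so counting points counts crossings. *)
Definition edge_edge_crossings (a : nat) : Prop :=
  [set p | exists e f, [/\ e \in edges G, f \in edges G, e != f,
                           ecurve D e p & ecurve D f p]] #= `I_a.

Definition edge_region_crossings (b : nat) : Prop :=
  exists2 k : {set G} -> cnode C -> nat,
    forall e mu, e \in edges G ->
      (ecurve D e `&` frontier (region D mu)) #= `I_(k e mu)
    & b = (\sum_(e in edges G) \sum_(mu : cnode C) (k e mu)./2)%N.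

(* One term for each unordered pair of incomparable clusters.  For two closed
   discs with alternating boundaries, neither containing the other, both
   differences have the same number of components, so the orientation chosen
   by [enum_rank] is immaterial; the difference contains the vertices of mu, so
   the number of components is positive. *)
Definition region_region_crossings (c : nat) : Prop :=
  exists2 k : cnode C -> cnode C -> nat,
    forall mu nu, incomparable mu nu ->
      components (region D mu `\` region D nu) #= `I_(k mu nu)
    & c = (\sum_(mu : cnode C)
            \sum_(nu : cnode C |
                  incomparable mu nu && (enum_rank mu < enum_rank nu))
              (k mu nu).-1)%N.

Definition abc_drawing (a b c : nat) : Prop :=
  [/\ clustered_drawing, edge_edge_crossings a, edge_region_crossings b
    & region_region_crossings c].

End ClusteredDrawings.

Definition admits_drawing (C : clustered_graph) (a b c : nat) : Prop :=
  exists D : predrawing C, abc_drawing D a b c.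

End Plane.

(* Main.v *)
Require Import Defs.
From mathcomp Require Import all_boot all_order all_algebra.
From mathcomp Require Import boolp classical_sets functions cardinality.
From mathcomp Require Import set_interval reals topology normedtype.
From mathcomp Require Import zify ring lra.
From Stdlib Require Import Btauto.

(** The graph consists of three disjoint stars with n leaves each, and the i-th
    cluster takes the i-th leaf of every star, so contracting the clusters gives
    K_{3,n}.  Lower bound: three clusters without mutual crossings would yield a
    drawing of K_{3,3} in which disjoint edges do not meet; hence every triple of
    clusters contains a crossing pair, and distinct pairs have distinct crossings.

    That K_{3,3} has no such drawing is proved modulo 2 and without approximating
    curves by polygons: a path is sampled by a finite chain of points, and the
    parity of the number of times x - y turns across the negative half-axis, as
    (x, y) runs around the boundary of the product of two chains, plays the role of
    the intersection number of the two paths.  It vanishes for disjoint compact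
    connected sets sampled finely enough, and its sum over the independent pairs of
    edges of K_{3,3} is odd.  Regions that overlap without a region-region crossing
    are treated by changing the paths inside them, which uses that the complement of
    a region is connected (the relevant part of the Jordan curve theorem).

    Upper bounds: straight edges, and thin parallelograms as regions: parallel
    horizontal strips when only edges take part in crossings, and strips around
    tangents of a parabola when only regions do. *)

Set Implicit Arguments.
Unset Strict Implicit.
Unset Printing Implicit Defensive.
Import Order.TTheory GRing.Theory Num.Theory.
Import numFieldNormedType.Exports.
Local Open Scope classical_set_scope.
Local Open Scope card_scope.
Local Open Scope ring_scope.

(** * Intersection parity of chains *)

(** The intersection parity is not an invariant of two sets: it is attached to two chains at a given
    mesh, and [cut] adds up correctly only for vectors in a common open half-plane. So each argument
    selects a mesh at which all local configurations fit into such half-planes; finitely many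
    requirements share one mesh, and no limit is taken.

    The obstacle in the lower bound is that two regions may overlap without being counted, as long
    as one difference stays connected; paths inside them can then meet. What saves the argument is
    that two closed curves have parity zero: each path may be traded for another one with the same
    ends, and it is enough that the new paths avoid each other and the old ones.

    The half of Jordan's theorem that is needed comes from a pigeonhole. The winding parity of the
    boundary curve takes only two values, whereas an interior point, a far point and a point of a
    supposed bounded component of the complement would be pairwise separated by the curve, and two
    points of equal parity never are. *)

Lemma addb_xorb (p q : bool) : p (+) q = xorb p q.
Proof. by case: p; case: q. Qed.

Ltac addb_tauto := rewrite ?addb_xorb; btauto.

Section Cut.
Variable R : realFieldType.
Notation plane := (R * R)%type.
Implicit Types u v w z : plane.

(* Half-open, so that exactly one of v and - v is lower when v != 0; then [cut v w]
   tells whether the turn from v to w, if shorter than a half-turn, crosses the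
   negative half-axis. *)
Definition lower v := (v.2 < 0) || ((v.2 == 0) && (v.1 < 0)).
Definition crossp v w : R := v.1 * w.2 - v.2 * w.1.
Definition dotp v w : R := v.1 * w.1 + v.2 * w.2.
Definition cut v w := (lower v (+) lower w) && (lower v (+) (0 < crossp v w)).

Lemma lowerN v : v != 0 -> lower (- v) = ~~ lower v.
Proof.
case: v => x y; rewrite /lower /= oppr_lt0 oppr_eq0 oppr_lt0.
rewrite xpair_eqE negb_and => H.
by case: (ltgtP y 0) H => //= _; case: (ltgtP x 0).
Qed.

(** Negation exchanges the negative and the positive half-axis, and a short turn crosses exactly one
    of them if [lower] changes, neither otherwise. *)
Lemma cutN v w : v != 0 -> w != 0 ->
  cut (- v) (- w) = cut v w (+) (lower v (+) lower w).
Proof.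
move=> v0 w0; rewrite /cut !lowerN //.
have -> : crossp (- v) (- w) = crossp v w by rewrite /crossp /=; ring.
by case: (lower v); case: (lower w); case: (0 < _).
Qed.

Lemma dotp_neq0 (l v : plane) : 0 < dotp l v -> v != 0.
Proof. by apply: contraTneq => ->; rewrite /dotp /= !mulr0 addr0 ltxx. Qed.

(* The relation (w x z) v + (z x v) w + (v x w) z = 0 between three plane
   vectors is evaluated at l and at the second coordinate. *)
Lemma crossp_half_plane (l : plane) v w z :
    0 < dotp l v -> 0 < dotp l w -> 0 < dotp l z ->
    ~~ lower v -> ~~ lower w -> lower z ->
  0 < crossp v z -> 0 < crossp w z.
Proof.
rewrite /lower /crossp /dotp.
case: l v w z => [a b] [x1 y1] [x2 y2] [x3 y3] /= lv lw lz Ev Ew Ez vz.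
rewrite ltNge; apply/negP => wz.
have {}Ew : (0 < y2) || ((y2 == 0) && (0 <= x2)).
  by move: Ew; case: (ltgtP y2 0) => //= _; case: ltP.
have {}Ev : (0 < y1) || ((y1 == 0) && (0 <= x1)).
  by move: Ev; case: (ltgtP y1 0) => //= _; case: ltP.
have Y1 : 0 <= y1 by case/orP: Ev => [/ltW //|/andP[/eqP -> _]].
have Y2 : 0 <= y2 by case/orP: Ew => [/ltW //|/andP[/eqP -> _]].
have Y3 : y3 <= 0 by case/orP: Ez => [/ltW //|/andP[/eqP -> _]].
have c12 : (x1 * y2 - y1 * x2) * (a * x3 + b * y3) =
    (x1 * y3 - y1 * x3) * (a * x2 + b * y2)
    - (x2 * y3 - y2 * x3) * (a * x1 + b * y1) by ring.
have c12y : (x1 * y2 - y1 * x2) * y3 =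
    (x1 * y3 - y1 * x3) * y2 - (x2 * y3 - y2 * x3) * y1 by ring.
have P : 0 < (x1 * y2 - y1 * x2) * (a * x3 + b * y3).
  by rewrite c12 subr_gt0 (le_lt_trans _ (mulr_gt0 vz lw)) // mulr_le0_ge0 // ltW.
have P' : 0 < x1 * y2 - y1 * x2 by rewrite -(pmulr_lgt0 _ lz).
have Q0 := mulr_ge0_le0 (ltW P') Y3.
have Q1 := mulr_ge0 (ltW vz) Y2.
have Q2 := mulr_le0_ge0 wz Y1.
have Z2 : (x1 * y3 - y1 * x3) * y2 = 0 by lra.
have Z3 : (x1 * y2 - y1 * x2) * y3 = 0 by lra.
have y20 : y2 = 0 by move/eqP: Z2; rewrite mulf_eq0 gt_eqF //= => /eqP.
have y30 : y3 = 0 by move/eqP: Z3; rewrite mulf_eq0 gt_eqF //= => /eqP.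
move: Ew Ez; rewrite y20 y30 !ltxx eqxx /= => x2n x3p.
move: lw lz; rewrite y20 y30 !mulr0 !addr0 => lw lz.
have [a0|a0] := ltP 0 a; first by move: lz; rewrite pmulr_rgt0 // ltNge ltW.
by move: lw; rewrite ltNge mulr_le0_ge0.
Qed.

(** An open half-plane bounded by a line through the origin contains at most one of the two
    horizontal half-axes. All turns in it between upper and lower vectors therefore cross the same
    one. *)
Lemma cut_upper_lower (l : plane) v w z :
    0 < dotp l v -> 0 < dotp l w -> 0 < dotp l z ->
    lower v = lower w -> lower z = ~~ lower v ->
  (0 < crossp v z) = (0 < crossp w z).
Proof.
wlog Lv : l v w z / ~~ lower v.
  move=> H lv lw lz e1 e2; case: (boolP (lower v)) => [Lv|Lv]; last exact: (H l).
  have oppE (x y : plane) : crossp x y = crossp (- x) (- y) by rewrite /crossp /=; ring.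
  have dotE (x : plane) : dotp l x = dotp (- l) (- x) by rewrite /dotp /=; ring.
  rewrite (oppE v) (oppE w); apply: (H (- l)); rewrite -?dotE ?lowerN ?(dotp_neq0 lv)
    ?(dotp_neq0 lw) ?(dotp_neq0 lz) ?Lv ?e2 ?Lv // -?e1 ?Lv //.
move=> lv lw lz vw zv; rewrite (negbTE Lv) in vw zv.
by apply/idP/idP; apply: (@crossp_half_plane l) => //; rewrite -?vw.
Qed.

Lemma crosspC v w : crossp w v = - crossp v w.
Proof. by rewrite /crossp; ring. Qed.

Lemma crossp_neq0 (l : plane) v w : 0 < dotp l v -> 0 < dotp l w ->
  lower v != lower w -> crossp v w != 0.
Proof.
move=> lv lw; apply: contra => /eqP; move: lv lw.
rewrite /lower /crossp /dotp; case: l v w => [a b] [x1 y1] [x2 y2] /= lv lw e.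
have e1 : y1 * (a * x2 + b * y2) = y2 * (a * x1 + b * y1).
  apply/eqP; rewrite -subr_eq0; apply/eqP.
  by transitivity (- a * (x1 * y2 - y1 * x2)); [ring|rewrite e mulr0].
have e2 : x1 * (a * x2 + b * y2) = x2 * (a * x1 + b * y1).
  apply/eqP; rewrite -subr_eq0; apply/eqP.
  by transitivity (b * (x1 * y2 - y1 * x2)); [ring|rewrite e mulr0].
have ay : (y1 < 0) = (y2 < 0).
  by rewrite -(pmulr_llt0 _ lw) e1 pmulr_llt0.
have ax : (x1 < 0) = (x2 < 0).
  by rewrite -(pmulr_llt0 _ lw) e2 pmulr_llt0.
have az : (y1 == 0) = (y2 == 0).
  have : (y1 * (a * x2 + b * y2) == 0) = (y2 * (a * x1 + b * y1) == 0) by rewrite e1.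
  by rewrite !mulf_eq0 (gt_eqF lv) (gt_eqF lw) !orbF.
by rewrite ay ax az.
Qed.

(** Symmetry can fail only where the cross product vanishes although [lower] differs, as for
    opposite vectors; a common half-plane excludes this. *)
Lemma cutC (l : plane) v w : 0 < dotp l v -> 0 < dotp l w -> cut v w = cut w v.
Proof.
move=> lv lw; rewrite /cut; have [->|n] := eqVneq (lower v) (lower w); first by rewrite !addbb.
have := crossp_neq0 lv lw n; rewrite (crosspC v w) oppr_gt0.
by move: n; case: (lower v); case: (lower w) => //= _; case: ltgtP.
Qed.

(** Two of the three vectors agree on [lower], and [cut_upper_lower] makes them indistinguishable
    for the third. *)
Lemma cut_cocycle (l : plane) v w z :
  0 < dotp l v -> 0 < dotp l w -> 0 < dotp l z -> cut v w (+) cut w z = cut v z.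
Proof.
move=> lv lw lz; rewrite (cutC lv lw).
have [vw|vw] := eqVneq (lower v) (lower w).
  rewrite /cut vw addbb /=; have [->|wz] := eqVneq (lower w) (lower z); first by rewrite addbb.
  rewrite (cut_upper_lower lv lw lz vw) //.
  by rewrite vw; move: wz; case: (lower w); case: (lower z).
have [wz|wz] := eqVneq (lower w) (lower z).
  rewrite (cutC lw lv) (cutC lv lz) (cutC lv lw) /cut wz addbb addbF /=.
  rewrite (cut_upper_lower lw lz lv wz) //.
  by move: vw; rewrite wz; case: (lower v); case: (lower z).
have vz : lower v = lower z by move: vw wz; case: (lower v); case: (lower w); case: (lower z).
rewrite (cutC lw lz) (cutC lw lv) /cut vz addbb /= (cut_upper_lower lv lz lw vz) ?addbb //.
by move: wz; rewrite vz; case: (lower w); case: (lower z).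
Qed.

End Cut.

Section ChainSum.
Variables (T : Type).
Fixpoint csum (C : T -> T -> bool) (x : T) (s : seq T) : bool :=
  if s is y :: s' then C x y (+) csum C y s' else false.

Lemma csum_cat C x s t : csum C x (s ++ t) = csum C x s (+) csum C (last x s) t.
Proof. by elim: s x => //= y s IH x; rewrite IH addbA. Qed.

Lemma csum_addb C D x s :
  csum (fun a b => C a b (+) D a b) x s = csum C x s (+) csum D x s.
Proof. by elim: s x => //= y s IH x; rewrite IH addbACA. Qed.

Lemma csum_telescope (h : T -> bool) x s :
  csum (fun a b => h a (+) h b) x s = h x (+) h (last x s).
Proof. elim: s x => [|y s IH] x /=; first by rewrite addbb. by rewrite IH addbA addbK. Qed.

Fixpoint chain (A : T -> Prop) (e : T -> T -> Prop) (x : T) (s : seq T) : Prop :=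
  if s is y :: s' then [/\ A x, e x y & chain A e y s'] else A x.

Lemma chain_head A e x s : chain A e x s -> A x.
Proof. by case: s => //= y s []. Qed.

Lemma chain_last A e x s : chain A e x s -> A (last x s).
Proof. by elim: s x => //= y s IH x [_ _ /IH]. Qed.

Lemma chain_sub (A B : T -> Prop) (e f : T -> T -> Prop) x s :
    (forall y, A y -> B y) -> (forall y z, e y z -> f y z) ->
  chain A e x s -> chain B f x s.
Proof. by move=> AB ef; elim: s x => [|y s IH] x /=; [exact: AB|case=> /AB ? /ef ? /IH]. Qed.

Lemma chain_cat A e x s t :
  chain A e x s -> chain A e (last x s) t -> chain A e x (s ++ t).
Proof. by elim: s x => //= y s IH x [Ax exy /IH H] /H. Qed.

Lemma eq_csum_chain A e C D x s :
    (forall y z, A y -> A z -> e y z -> C y z = D y z) ->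
  chain A e x s -> csum C x s = csum D x s.
Proof.
move=> CD; elim: s x => //= y s IH x [Ax exy ch].
rewrite (IH _ ch) CD //; exact: chain_head ch.
Qed.

Lemma csum_cocycle (A : T -> Prop) (e : T -> T -> Prop) (C : T -> T -> bool) x s :
    (forall y z t, A y -> A z -> A t -> C y z (+) C z t = C y t) -> (forall y, A y -> C y y = false) ->
  chain A e x s -> csum C x s = C x (last x s).
Proof.
move=> CC C0; elim: s x => [|y s IH] x /=; first by move/C0.
case=> Ax _ ch; rewrite (IH _ ch) CC //; [exact: chain_head ch|exact: chain_last ch].
Qed.

End ChainSum.

Section Green.
Variables (A B T : Type) (F : A -> B -> T) (C : T -> T -> bool).
Variables (XA : A -> Prop) (XB : B -> Prop) (eA : A -> A -> Prop) (eB : B -> B -> Prop).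
Hypothesis cell : forall a a' b b', XA a -> XA a' -> XB b -> XB b' -> eA a a' -> eB b b' ->
  C (F a b) (F a b') (+) C (F a b') (F a' b') = C (F a b) (F a' b) (+) C (F a' b) (F a' b').

Lemma green_strip a a' y t : XA a -> XA a' -> eA a a' -> chain XB eB y t ->
  csum (fun b b' => C (F a b) (F a b')) y t (+) C (F a (last y t)) (F a' (last y t)) =
  C (F a y) (F a' y) (+) csum (fun b b' => C (F a' b) (F a' b')) y t.
Proof.
move=> Xa Xa' ea; elim: t y => [|b t IH] y /=; first by move=> _; rewrite addbF.
case=> Xy ey ch; rewrite -addbA IH // addbA cell ?addbA //; exact: chain_head ch.
Qed.

(** A discrete Green formula modulo 2: the relations of the single cells add up to the relation for
    the boundary of the whole grid, the inner sides cancelling in pairs. *)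
Lemma green x s y t : chain XA eA x s -> chain XB eB y t ->
  csum (fun b b' => C (F x b) (F x b')) y t (+) csum (fun a a' => C (F a (last y t)) (F a' (last
    y t))) x s =
  csum (fun a a' => C (F a y) (F a' y)) x s (+) csum (fun b b' => C (F (last x s) b) (F (last x
    s) b')) y t.
Proof.
move=> + cht; elim: s x => [|a s IH] x /=; first by rewrite addbF.
case=> Xx ex chs; rewrite addbA green_strip //; last exact: chain_head chs.
by rewrite -addbA IH // addbA.
Qed.
End Green.

Section Crossing.
Variable R : realFieldType.
Notation plane := (R * R)%type.
Implicit Types u v w z x y : plane.

(** On the boundary of the product of two chains one factor stands still at an end point u: [mrev]
    is the side on which the subtracted point moves, [mfor] the side on which the other one does. *)
Definition mrev u x s := csum (fun a b => cut (u - a) (u - b)) x s.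
Definition mfor u x s := csum (fun a b => cut (a - u) (b - u)) x s.

Definition crosspar x s y t :=
  (mrev x y t (+) mrev (last x s) y t) (+) (mfor y x s (+) mfor (last y t) x s).

Lemma crosspar_catl x s s' y t :
  crosspar x (s ++ s') y t = crosspar x s y t (+) crosspar (last x s) s' y t.
Proof.
rewrite /crosspar last_cat /mfor !csum_cat -!/(mfor _ _ _).
by addb_tauto.
Qed.

Lemma crosspar_catr x s y t t' :
  crosspar x s y (t ++ t') = crosspar x s y t (+) crosspar x s (last y t) t'.
Proof.
rewrite /crosspar last_cat /mrev !csum_cat -!/(mrev _ _ _).
by addb_tauto.
Qed.

(** Each summand of [crosspar] involves one chain and only the end points of the other, so it occurs
    twice. Geometrically, two closed curves in the plane have even intersection. *)
Lemma crosspar_closed x s s' y t t' : last x s = last x s' -> last y t = last y t' ->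
  crosspar x s y t (+) crosspar x s' y t (+) crosspar x s y t' (+) crosspar x s' y t' = false.
Proof.
move=> es et; rewrite /crosspar -es -et.
by addb_tauto.
Qed.

Lemma mfor_mrev (A : plane -> Prop) (e : plane -> plane -> Prop) u x s : chain A e x s -> ~ A u ->
  mfor u x s = mrev u x s (+) (lower (x - u) (+) lower (last x s - u)).
Proof.
move=> ch Au; rewrite -(csum_telescope (fun a => lower (a - u))) /mfor /mrev.
rewrite -csum_addb; apply: eq_csum_chain ch => y z Ay Az _.
have nz (a : plane) : A a -> a - u != 0.
  by move=> Aa; rewrite subr_eq0; apply/eqP => au; apply: Au; rewrite -au.
by rewrite -(opprB y u) -(opprB z u) cutN ?nz // addbK.
Qed.

End Crossing.

Section K33.
Variable R : realFieldType.
Notation plane := (R * R)%type.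

(** There are 18 unordered pairs of independent edges. Once all [mfor] are turned into [mrev], each
    [m] occurs twice in the sum of their parities, and so do the corrections by [lower], up to even
    multiplicity, except [lower (b j - b l)]. Each of these occurs three times, and the two orders
    of j and l contribute 1 together, so the sum has the parity of 3 * 3. *)
Lemma K33_crossing (a b : 'I_3 -> plane) (S : 'I_3 -> 'I_3 -> seq plane)
    (X : 'I_3 -> 'I_3 -> plane -> Prop) (e : plane -> plane -> Prop) :
    injective b ->
    (forall i j, chain (X i j) e (a i) (S i j)) ->
    (forall i j, last (a i) (S i j) = b j) ->
    (forall i j k, k != i -> ~ X i j (a k)) ->
    (forall i j l, l != j -> ~ X i j (b l)) ->
  exists i j k l, [/\ k != i, l != j & crosspar (a i) (S i j) (a k) (S k l)].
Proof.
move=> binj ch lst Xa Xb; apply: contrapT => noI.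
pose m u i j := mrev u (a i) (S i j).
have I i j k l : k != i -> l != j ->
    (m (a i) k l (+) m (b j) k l) (+) ((m (a k) i j (+) (lower (a i - a k) (+) lower (b j - a k)))
     (+) (m (b l) i j (+) (lower (a i - b l) (+) lower (b j - b l)))) = false.
  move=> ki lj; rewrite /m -(lst i j) -(lst k l).
  rewrite -(mfor_mrev (ch i j)); last exact: Xa.
  rewrite -(mfor_mrev (ch i j)) ?lst; last exact: Xb.
  apply/negP => H; apply: noI; exists i, j, k, l; split=> //.
  by rewrite /crosspar !lst.
have lowC j l : j != l -> lower (b l - b j) = ~~ lower (b j - b l).
  by move=> jl; rewrite -opprB lowerN // subr_eq0; apply: contra jl => /eqP/binj/eqP.
pose o0 : 'I_3 := ord0; pose o1 : 'I_3 := @Ordinal 3 1 isT; pose o2 : 'I_3 := @Ordinal 3 2 isT.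
have L01 := lowC o0 o1 isT; have L02 := lowC o0 o2 isT; have L12 := lowC o1 o2 isT.
have E01 j l (lj : l != j) := I o0 j o1 l isT lj.
have E02 j l (lj : l != j) := I o0 j o2 l isT lj.
have E12 j l (lj : l != j) := I o1 j o2 l isT lj.
have := E01 o0 o1 isT; have := E01 o0 o2 isT; have := E01 o1 o2 isT.
have := E01 o1 o0 isT; have := E01 o2 o0 isT; have := E01 o2 o1 isT.
have := E02 o0 o1 isT; have := E02 o0 o2 isT; have := E02 o1 o2 isT.
have := E02 o1 o0 isT; have := E02 o2 o0 isT; have := E02 o2 o1 isT.
have := E12 o0 o1 isT; have := E12 o0 o2 isT; have := E12 o1 o2 isT.
have := E12 o1 o0 isT; have := E12 o2 o0 isT; have := E12 o2 o1 isT.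
rewrite {}L01 {}L02 {}L12; clear.
have comb (p q : bool) : p = false -> q = false -> p (+) q = false by move=> -> ->.
do 17 (move=> H1 H2; move: (comb _ _ H1 H2) => {H1 H2}).
set t := (X in X = false); suff -> : t = true by [].
by rewrite /t; clear; addb_tauto.
Qed.
End K33.

Lemma connected_clopen (T : topologicalType) (S C : set T) u v : connected S ->
    (forall x, S x -> C x -> nbhs x (fun y => S y -> C y)) ->
    (forall x, S x -> ~ C x -> nbhs x (fun y => S y -> ~ C y)) ->
  S u -> C u -> S v -> C v.
Proof.
move=> cS oC oD Su Cu Sv.
have CE : S `&` C = S `&` [set y | S y -> C y]°.
  apply/seteqP; split=> x [Sx Cx]; split=> //; first exact: oC.
  exact: (nbhs_singleton Cx).
have DE : S `&` C = S `&` ~` [set y | S y -> ~ C y]°.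
  apply/seteqP; split=> x [Sx Cx]; split=> //; first by move=> /nbhs_singleton; exact.
  by apply: contrapT => nC; apply: Cx; exact: oD.
suff : (S `&` C) v by case.
rewrite (cS (S `&` C)) //; first by exists u.
- by exists [set y | S y -> C y]° => //; exact: open_interior.
- by exists (~` [set y | S y -> ~ C y]°) => //; exact/open_closedC/open_interior.
Qed.

Section PseudoMetric.
Variables (R : realType) (T : pseudoMetricType R).

(** A Lebesgue number argument, stated for an arbitrary property that survives shrinking of the
    radius; it is the source of the uniform radii below. *)
Lemma compact_uniform (A : set T) (P : R -> T -> Prop) :
    compact A -> (forall e e' x, e' <= e -> P e x -> P e' x) ->
    (forall x, A x -> exists2 e, 0 < e & forall y, ball x e y -> P e y) ->
  exists2 e, 0 < e & forall x, A x -> P e x.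
Proof.
move=> /compact_near_coveringP cA Pmono locP.
have /= : \forall e \near 0^'+, A `<=` P e.
  apply: (cA _ (0^'+) P) => x /locP[e e0 eP].
  exists (ball x e, [set d | 0 < d <= e]); last first.
    by move=> [y d] /= [/eP Pe /andP[d0 de]]; exact: Pmono de Pe.
  split; first exact: nbhsx_ballx.
  near=> d; apply/andP; split; first by near: d; exact: nbhs_right_gt.
  by near: d; exact: nbhs_right_le.
move=> H; have : \forall e \near 0^'+, 0 < e /\ A `<=` P e.
  by near=> e; split; [near: e; exact: nbhs_right_gt|near: e].
by case/filter_ex => e [e0 eP]; exists e.
Unshelve. all: by end_near. Qed.

(** The set of points that can be reached by chains of mesh e is relatively open and closed. *)
Lemma connected_chain (A : set T) u v e : connected A -> A u -> A v -> 0 < e ->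
  exists2 s, chain A (fun x y => ball x e y) u s & last u s = v.
Proof.
move=> cA Au Av e0.
pose B := [set w | exists2 s, chain A (fun x y => ball x e y) u s & last u s = w].
have Bstep w w' : B w -> A w' -> ball w e w' -> B w'.
  move=> [s ch <-] Aw' bw; exists (s ++ [:: w']); last by rewrite last_cat.
  by apply: chain_cat => //=; split=> //; exact: chain_last ch.
apply: (@connected_clopen _ A B u v cA _ _ Au _ Av) => [x Ax Bx|x Ax nBx|]; last by exists [::].
- by apply: filterS (nbhsx_ballx x e e0) => y bxy Ay; exact: (Bstep x).
- apply: filterS (nbhsx_ballx x e e0) => y bxy Ay By; apply: nBx.
  by apply: (Bstep y) => //; exact: ball_sym.
Qed.

Lemma openP_ball (A : set T) : (forall x, A x -> exists2 e, 0 < e & ball x e `<=` A) -> open A.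
Proof.
move=> H; rewrite openE => x /H[e e0 eA].
by apply/nbhs_ballP; exists e.
Qed.

Lemma open_ballE (A : set T) x : open A -> A x -> exists2 e, 0 < e & ball x e `<=` A.
Proof. by rewrite openE => H /H /nbhs_ballP[e]; exists e. Qed.

End PseudoMetric.

Section Plane.
Variable R : realType.
Notation plane := (R * R)%type.
Implicit Types u v x y z p q : plane.

Lemma ball_plane x e y : ball x e y <-> `|x.1 - y.1| < e /\ `|x.2 - y.2| < e.
Proof. by []. Qed.

Lemma plane_hausdorff : hausdorff_space plane.
Proof. exact: norm_hausdorff. Qed.

Lemma compact_closed_dist (A B : set plane) : compact A -> closed B -> A `&` B = set0 ->
  exists2 d, 0 < d & forall a b, A a -> B b -> ~ ball a d b.
Proof.
move=> cA cB AB; have oB := closed_openC cB.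
have [] := @compact_uniform _ _ A (fun d a => forall b, B b -> ~ ball a d b) cA.
- by move=> e e' x ee H b Bb /(le_ball ee); exact: H.
- move=> x Ax; have nBx : (~` B) x by move=> Bx; rewrite -[False]/(set0 x) -AB.
  have [e e0 eB] := open_ballE oB nBx; exists (e / 2); first by rewrite divr_gt0.
  by move=> y xy b Bb yb; apply: (eB b) => //; exact: ball_split yb.
- by move=> d d0 H; exists d => // a b Aa; exact: H.
Qed.

(** Balls of the product are axis-parallel squares. In one coordinate x is at distance at least d
    from p, and this coordinate alone separates the ball around x from p. *)
Lemma cut_half_plane p x d : 0 < d -> ~ ball p d x ->
  exists l : plane, forall y, ball x d y -> 0 < dotp l (y - p).
Proof.
move=> d0 nb.
have [h|h] : d <= `|p.1 - x.1| \/ d <= `|p.2 - x.2|.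
  case: (leP d `|p.1 - x.1|) => h1; [by left|right].
  by rewrite leNgt; apply/negP => h2; apply: nb.
- exists (if p.1 < x.1 then 1 else -1, 0) => y /ball_plane[/= h1 _]; rewrite /dotp /= mul0r addr0.
  move: h h1; rewrite ler_normr ltr_norml => h /andP[h1 h2].
  by case: ifP => px; case/orP: h => h; lra.
- exists (0, if p.2 < x.2 then 1 else -1) => y /ball_plane[/= _ h1]; rewrite /dotp /= mul0r add0r.
  move: h h1; rewrite ler_normr ltr_norml => h /andP[h1 h2].
  by case: ifP => px; case/orP: h => h; lra.
Qed.

Definition cutat p x y := cut (x - p) (y - p).

Lemma cutat_cocycle p x d y z w : 0 < d -> ~ ball p d x ->
  ball x d y -> ball x d z -> ball x d w -> cutat p y z (+) cutat p z w = cutat p y w.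
Proof. by move=> d0 /(cut_half_plane d0)[l H] /H hy /H hz /H; exact: cut_cocycle. Qed.

Lemma cutatxx p x : cutat p x x = false.
Proof. by rewrite /cutat /cut addbb. Qed.

(** All meshes below the threshold are included, so that a minimum of thresholds serves several
    pairs of sets at once. *)
Definition nocross (A B : set plane) := exists2 e : R, 0 < e & forall e', 0 < e' <= e ->
  forall x s y t, chain A (fun x y => ball x e' y) x s -> chain B (fun x y => ball x e' y) y t ->
  crosspar x s y t = false.

Lemma disjoint_nocross (A B : set plane) : compact A -> compact B -> A `&` B = set0 -> nocross A B.
Proof.
move=> cA cB AB; have [d d0 dAB] := compact_closed_dist cA (compact_closed plane_hausdorff cB) AB.
exists (d / 2); first by rewrite divr_gt0.
move=> e /andP[e0 ed] x s y t chs cht.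
rewrite /crosspar /mrev /mfor.
have := @green plane plane plane (fun a b => a - b) (@cut R) A B
  (fun x y => ball x e y) (fun x y => ball x e y) _ x s y t chs cht.
set c1 := csum _ _ _; set c2 := csum _ _ _; set c3 := csum _ _ _; set c4 := csum _ _ _.
move=> /(_ _)/wrap[]; last by move: c1 c2 c3 c4 => [] [] [] [].
move=> a a' b b' Aa Aa' Bb Bb' /ball_plane[a1 a2] /ball_plane[b1 b2].
(* The difference a - b is at least d away from the origin, and each chain moves by less than d / 2
   per step. All four differences of a cell thus lie in a ball that a half-plane separates from the
   origin. *)
have [l Hl] : exists l : plane, forall v, ball (a - b) d v -> 0 < dotp l v.
  have : ~ ball (0 : plane) d (a - b).
    move=> /ball_plane[/=]; rewrite !sub0r !opprB => h1 h2; apply: (dAB a b) => //.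
    by apply/ball_plane; split; rewrite distrC.
  by move=> /(cut_half_plane d0)[l H]; exists l => v /H; rewrite subr0.
rewrite !ltr_norml in a1 a2 b1 b2.
rewrite (@cut_cocycle R l) ?(@cut_cocycle R l) //; apply: Hl; apply/ball_plane; split => /=;
  rewrite ltr_norml; apply/andP; split; clear -a1 a2 b1 b2 ed; lra.
Qed.

End Plane.

(** * Connected sets and lifting along curves *)

Section Joined.
Variable R : realType.
Notation plane := (R * R)%type.
Implicit Types (u v x y z p q : plane) (W S : set plane).

Definition segpt x y (t : R) : plane := (x.1 + t * (y.1 - x.1), x.2 + t * (y.2 - x.2)).
Definition seg x y : set plane := segpt x y @` `[0, 1].

Lemma segpt_continuous x y : continuous (segpt x y).
Proof.
have aff (a b t : R) : (fun t => a + t * b) @ t --> a + t * b.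
  by apply: cvgD; [exact: cvg_cst|apply: cvgM; [exact: cvg_id|exact: cvg_cst]].
by move=> t; exact: (cvg_pair (aff _ _ t) (aff _ _ t)).
Qed.

Lemma segpt0 x y : segpt x y 0 = x.
Proof. by rewrite /segpt !mul0r !addr0; case: x. Qed.

Lemma segpt1 x y : segpt x y 1 = y.
Proof. by rewrite /segpt !mul1r !subrKC; case: y. Qed.

Lemma seg_compact x y : compact (seg x y).
Proof.
apply: continuous_compact (@segment_compact _ _ _).
exact/continuous_subspaceT/segpt_continuous.
Qed.

Lemma seg_connected x y : connected (seg x y).
Proof.
apply: connected_continuous_connected (@segment_connected _ _ _) _.
exact/continuous_subspaceT/segpt_continuous.
Qed.

Lemma seg_left x y : seg x y x.
Proof. by exists 0; rewrite ?segpt0 //= in_itv /= lexx ler01. Qed.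

Lemma seg_right x y : seg x y y.
Proof. by exists 1; rewrite ?segpt1 //= in_itv /= lexx ler01. Qed.

Lemma seg_ball x e y : ball x e y -> seg x y `<=` ball x e.
Proof.
move=> /ball_plane[]; rewrite !ltr_norml => /andP[h1 h2] /andP[h3 h4] z [t /=].
rewrite in_itv /= => /andP[t0 t1] <-; apply/ball_plane; split=> /=; rewrite ltr_norml; nra.
Qed.

(** Continua replace paths: they are closed under unions with a common point, and chains of any mesh
    can be drawn from them. *)
Definition joined W u v := exists K, [/\ compact K, connected K, K `<=` W, K u & K v].

Lemma joined_sym W u v : joined W u v -> joined W v u.
Proof. by case=> K [cK kK KW Ku Kv]; exists K. Qed.

Lemma joined_trans W v u w : joined W u v -> joined W v w -> joined W u w.
Proof.
move=> [K [cK kK KW Ku Kv]] [L [cL kL LW Lv Lw]]; exists (K `|` L); split.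
- exact: compactU.
- by apply: connectedU => //; exists v.
- by move=> z [/KW|/LW].
- by left.
- by right.
Qed.


Lemma seg_joined W u v : seg u v `<=` W -> joined W u v.
Proof.
by move=> sW; exists (seg u v); split=> //; [exact: seg_compact|exact: seg_connected|
  exact: seg_left|exact: seg_right].
Qed.

Lemma connected_joined W S u v : open W -> connected S -> S `<=` W -> S u -> S v -> joined W u v.
Proof.
move=> oW cS SW Su Sv.
have near z : W z -> exists2 e, 0 < e & forall w, ball z e w -> joined W z w.
  move=> /(open_ballE oW)[e e0 eW]; exists e => // y /seg_ball sy.
  by apply: seg_joined => t /sy /eW.
apply: (@connected_clopen _ S (joined W u) u v) => // [x Sx ux|x Sx nux|].
- have [e e0 H] := near x (SW _ Sx); apply: filterS (nbhsx_ballx x e e0) => y /H xy _.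
  exact: joined_trans xy.
- have [e e0 H] := near x (SW _ Sx); apply: filterS (nbhsx_ballx x e e0) => y /H xy _ uy.
  by apply: nux; apply: joined_trans uy (joined_sym xy).
- by apply: seg_joined => z [t _ <-]; rewrite /segpt !subrr !mulr0 !addr0 -surjective_pairing;
  exact: SW.
Qed.

End Joined.

Section Lifting.
Variable R : realType.
Notation plane := (R * R)%type.
Implicit Types (x y z p q : plane) (f : R -> plane).

Lemma within_uniform f e : {within `[0, 1], continuous f} -> 0 < e ->
  exists2 d : R, 0 < d & forall s t : R, `[0, 1]%classic s -> `[0, 1]%classic t ->
    `|s - t| < d -> ball (f s) e (f t).
Proof.
move=> cf e0.
have [] := @compact_uniform R R `[0, 1]%classic (fun d s => forall t : R, `[0, 1]%classic s ->
  `[0, 1]%classic t ->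
    `|s - t| < d -> ball (f s) e (f t)) (@segment_compact _ _ _).
- by move=> d d' s dd H t s1 t1 st; apply: H => //; exact: lt_le_trans dd.
- move=> s s1.
  have /subspace_continuousP/(_ _ s1) cfs := cf.
  have : nbhs (f s) (ball (f s) (e / 2)) by apply: nbhsx_ballx; rewrite divr_gt0.
  move=> /cfs; rewrite /fmap /= /within /= => /nbhs_ballP[r /= r0 H].
  exists (r / 2); first by rewrite divr_gt0.
  move=> y sy t y1 t1 yt; apply: (@ball_split _ _ (f s)).
  + by apply/ball_sym/H => //; apply: le_ball sy; lra.
  + apply: H => //; apply: (@ball_split _ _ y) => //; exact: yt.
- by move=> d d0 H; exists d => // s t s1 t1; exact: H.
Qed.

(** A parity version of lifting the angle along f: [H t] sums the cuts met on the way from f 0 to f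
    t in steps of length at most k. It is compared at nearby parameters by contracting the way
    through the stages [m j], from the constant 0 at j = 0 to the identity at j = N. *)
Lemma cutat_lift f p : {within `[0, 1], continuous f} -> ~ (f @` `[0, 1]) p ->
  exists H : R -> bool, exists2 h : R, 0 < h & forall s t : R, `[0, 1]%classic s -> `[0, 1]%classic t ->
    `|s - t| < h -> cutat p (f s) (f t) = H s (+) H t.
Proof.
move=> cf fp.
have cJ : compact (f @` `[0, 1]) by apply: continuous_compact (@segment_compact _ _ _).
have [d d0 dJ] : exists2 d : R, 0 < d & forall t : R, `[0, 1]%classic t -> ~ ball p d (f t).
  have [||d d0 dJ] := compact_closed_dist cJ (B := [set p]).
  - exact: (compact_closed (@plane_hausdorff R) (@compact_set1 _ p)).
  - by apply/seteqP; split=> // x [Jx xp]; apply: fp; rewrite -xp.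
  - by exists d => // t t1 /ball_sym; apply: dJ => //; exists t.
have [h h0 hf] := within_uniform cf d0.
(* The corners of one cell of the contraction have parameters less than 2 k apart, so 2 k < h keeps
   their images in one ball that avoids p. *)
pose N := (Num.bound (2 / h)).+1; pose k : R := N%:R^-1.
have N0 : 0 < N%:R :> R by rewrite ltr0n.
have k0 : 0 < k by rewrite invr_gt0.
have kh : 2 * k < h.
  rewrite /k ltr_pdivrMr // mulrC -ltr_pdivrMr //.
  have := archi_boundP (divr_ge0 (ler0n R 2) (ltW h0)).
  by move/lt_trans; apply; rewrite ltr_nat.
pose m (j : nat) (t : R) := Num.min (j%:R * k) t.
have m1 j (t : R) : `[0, 1]%classic t -> `[0, 1]%classic (m j t).
  rewrite /= !in_itv /= => /andP[t0 t1]; rewrite /m; case: (leP (j%:R * k) t) => jt; last by rewrite t0.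
  by rewrite (le_trans jt t1) mulr_ge0 ?ler0n ?(ltW k0).
have mlip j s t : `|m j s - m j t| <= `|s - t|.
  rewrite /m; case: (leP _ s) => a; case: (leP _ t) => b //.
  - by rewrite subrr normr0.
  - by rewrite ger0_norm ?ger0_norm; lra.
  - by rewrite ler0_norm ?ler0_norm; lra.
have mstep j t : `|m j t - m j.+1 t| <= k.
  rewrite /m -natr1 mulrDl mul1r; set a := j%:R * k.
  case: (leP a t) => h1; case: (leP (a + k) t) => h2.
  - by rewrite ler0_norm; lra.
  - by rewrite ler0_norm; lra.
  - by rewrite ler0_norm; lra.
  - by rewrite subrr normr0 ltW.
pose S (j : nat) t := \big[addb/false]_(i < j) cutat p (f (m i t)) (f (m i.+1 t)).
have main j (s t : R) : `[0, 1]%classic s -> `[0, 1]%classic t -> `|s - t| < k ->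
    S j s (+) S j t = cutat p (f (m j s)) (f (m j t)) (+) cutat p (f (m 0%N s)) (f (m 0%N t)).
  move=> s1 t1 st; elim: j => [|j IH]; first by rewrite /S !big_ord0 !addbb.
  rewrite /S !big_ord_recr /= -/(S j s) -/(S j t) addbACA IH.
  set a := f (m j s); set b := f (m j t); set a' := f (m j.+1 s); set b' := f (m j.+1 t).
  have close (z : R) : `[0, 1]%classic z -> `|m j s - z| < 2 * k -> ball a d (f z).
    by move=> z1 H; apply: hf => //; [exact: m1|exact: lt_trans kh].
  have A : ball a d a by exact: ballxx.
  have ms := mstep j s; have mt := mstep j t.
  have ml := mlip j s t.
  have A' : ball a d a' by apply: close; [exact: m1|lra].
  have B : ball a d b by apply: close; [exact: m1|lra].
  have B' : ball a d b'.
    apply: close; [exact: m1|].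
    by have := ler_distD (m j t) (m j s) (m j.+1 t); lra.
  have na : ~ ball p d a by apply: dJ; exact: m1.
  have C x y z := @cutat_cocycle R p a d x y z d0 na.
  have e1 : cutat p a b (+) cutat p b b' = cutat p a a' (+) cutat p a' b' by rewrite !C.
  by move: e1; do 5 case: (cutat _ _ _).
exists (S N), k => // s t s1 t1 st; rewrite main //.
have mN (x : R) : `[0, 1]%classic x -> m N x = x.
  rewrite /= in_itv /= => /andP[_ x1]; rewrite /m /k divff ?gt_eqF //.
  by apply/min_idPr.
have m0 (x : R) : `[0, 1]%classic x -> m 0%N x = 0.
  by rewrite /= in_itv /= => /andP[x0 _]; rewrite /m mul0r; apply/min_idPl.
by rewrite !mN // !m0 // cutatxx addbF.
Qed.

Lemma neq_not_ball x y : x <> y -> exists2 d : R, 0 < d & ~ ball x d y.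
Proof.
move=> xy; have [e1|n1] := eqVneq x.1 y.1; last first.
  exists `|x.1 - y.1|; first by rewrite normr_gt0 subr_eq0.
  by move=> /ball_plane[]; rewrite ltxx.
have [e2|n2] := eqVneq x.2 y.2; last first.
  exists `|x.2 - y.2|; first by rewrite normr_gt0 subr_eq0.
  by move=> /ball_plane[]; rewrite ltxx.
by case: xy; move: e1 e2; case: x; case: y => /= ? ? ? ? -> ->.
Qed.

(** This is uniform continuity of the inverse parametrization, on the circle obtained by identifying
    0 and 1. The second alternative is closeness across the identified ends. *)
Lemma simple_closed_inverse f h : {within `[0, 1], continuous f} ->
    {in `[0, 1[ &, injective f} -> f 0 = f 1 -> 0 < h ->
  exists2 d : R, 0 < d & forall s t : R, `[0, 1]%classic s -> `[0, 1]%classic t ->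
    ball (f s) d (f t) -> `|s - t| < h \/ 1 - h < `|s - t|.
Proof.
move=> cf finj f01 h0.
have [] := @compact_uniform R (R * R)%type (`[0, 1] `*` `[0, 1]) (fun d st =>
    `[0, 1]%classic st.1 -> `[0, 1]%classic st.2 ->
    ball (f st.1) d (f st.2) -> `|st.1 - st.2| < h \/ 1 - h < `|st.1 - st.2|).
- by apply: compact_setX; exact: segment_compact.
- by move=> e e' x ee H a b /(le_ball ee); exact: H.
- move=> [s t] /= [s1 t1].
  have [near|far] := pselect (f s = f t).
    exists (h / 2); first by rewrite divr_gt0.
    move=> [s' t'] /ball_plane[/= hs ht] _ _ _.
    have [st|[st|st]] : s = t \/ `|s - t| = 1 \/ `|s - t| = 1.
      have [e|ne] := eqVneq s t; [by left|right; left].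
      move: s1 t1; rewrite /= !in_itv /= => /andP[s0 s1] /andP[t0 t1].
      have [sl|sg] := eqVneq s 1; have [tl|tg] := eqVneq t 1.
      + by rewrite sl tl eqxx in ne.
      + have : 0 = t :> R.
          by apply: finj; rewrite ?in_itv /= ?lexx ?ltr01 ?t0 ?lt_neqAle ?tg ?t1 // f01 -near sl.
        by move=> <-; rewrite sl subr0 normr1.
      + have : 0 = s :> R.
          by apply: finj; rewrite ?in_itv /= ?lexx ?ltr01 ?s0 ?lt_neqAle ?sg ?s1 // f01 near tl.
        by move=> <-; rewrite tl sub0r normrN1.
      + case/eqP: ne; apply: finj; rewrite ?in_itv /= ?s0 ?t0 ?lt_neqAle ?sg ?tg ?s1 ?t1 //.
    + left; rewrite st in hs; rewrite !ltr_norml in hs ht *; lra.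
    + right; have := ler_distD s' s t; have := ler_distD t' s' t; rewrite (distrC t' t); lra.
    + right; have := ler_distD s' s t; have := ler_distD t' s' t; rewrite (distrC t' t); lra.
  have [d d0 dst] : exists2 d : R, 0 < d & ~ ball (f s) d (f t).
    exact: neq_not_ball.
  have d3 : 0 < d / 3 by rewrite divr_gt0.
  have [e e0 eH] := within_uniform cf d3.
  exists (Num.min e (d / 3)); first by rewrite lt_min e0 d3.
  move=> [s' t'] /ball_plane[/= hs ht] s'1 t'1 b; exfalso; apply: dst.
  rewrite !lt_min in hs ht; case/andP: hs => hs _; case/andP: ht => ht _.
  have b1 : ball (f s) (d / 3) (f s') by exact: eH.
  have b2 : ball (f t') (d / 3) (f t) by apply: eH => //; rewrite distrC.
  have b3 : ball (f s') (d / 3) (f t') by apply: le_ball b; rewrite ge_min lexx orbT.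
  have -> : d = d / 3 + d / 3 + d / 3 by field.
  exact: ball_triangle (ball_triangle b1 b3) b2.
- by move=> d d0 H; exists d => // s t s1 t1; exact: (H (s, t)).
Qed.

End Lifting.

(** * Complements of simple closed regions *)

Section Borsuk.
Variable R : realType.
Notation plane := (R * R)%type.
Implicit Types (x y z p q : plane) (J K : set plane).

Lemma seg_frontier K J x y : open K -> closure K `<=` K `|` J -> K x -> ~ K y ->
  exists2 j, J j & seg x y j.
Proof.
move=> oK clK Kx nKy; apply: contrapT => noJ; apply: nKy.
apply: (@connected_clopen _ (seg x y) K x y (@seg_connected _ x y)) => //.
- by move=> z _ Kz; apply: filterS (open_nbhs_nbhs (conj oK Kz)).
- move=> z sz nKz.
  have : ~ closure K z.
    by move=> /clK[//|Jz]; apply: noJ; exists z.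
  rewrite closureEnbhs => H.
  have oC : open (~` closure K) by exact/closed_openC/closed_closure.
  have nz : (~` closure K) z by move=> /clK[//|Jz]; apply: noJ; exists z.
  apply: filterS (open_nbhs_nbhs (conj oC nz)) => w nw _ Kw.
  by apply: nw; exact: subset_closure.
- exact: seg_left.
- exact: seg_right.
Qed.

(* If [cutat p + cutat q] were a coboundary on J, replacing the cocycle [cutat p] by [cutat q]
   plus that coboundary inside K would remove its only singularity [p] without
   changing it on a large square around [p], where its sum is odd. *)
Lemma cutat_not_coboundary J K p q (h : plane -> bool) (d M : R) :
    compact J -> open K -> closure K `<=` K `|` J -> K `&` J = set0 ->
    (forall z, K z -> `|z.1| < M /\ `|z.2| < M) ->
    K p -> ~ K q -> ~ J q -> 0 < d ->
  ~ (forall x y, J x -> J y -> ball x d y -> cutat p x y (+) cutat q x y = h x (+) h y).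
Proof.
move=> cJ oK clK KJ bK Kp nKq nJq d0 hJ.
have [d1 d10 d1K] := open_ballE oK Kp.
have [d2 d20 d2K] : exists2 d2 : R, 0 < d2 & forall z, K z \/ J z -> ~ ball q d2 z.
  have cl : closed (closure K `|` J).
    by apply: closedU; [exact: closed_closure|exact: (compact_closed (@plane_hausdorff R))].
  have nq : (~` (closure K `|` J)) q by move=> [/clK[]|].
  have [e e0 eH] := open_ballE (closed_openC cl) nq.
  exists e => // z Kz /eH; apply; case: Kz => Kz; [left; exact: subset_closure|by right].
(* The longest distance below is that from [pr x] over x and y to [pr y], less than 2 r + r + 2 r,
   so 8 r leaves room. *)
pose r := Num.min d (Num.min d1 d2) / 8.
have m0 : 0 < Num.min d (Num.min d1 d2) by rewrite !lt_min d0 d10.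
have r8 : 8 * r = Num.min d (Num.min d1 d2) by rewrite /r; field.
have r0 : 0 < r by rewrite divr_gt0.
have rd : 8 * r <= d by rewrite r8 ge_min lexx.
have rd1 : 8 * r <= d1 by rewrite r8 !ge_min lexx orbT.
have rd2 : 8 * r <= d2 by rewrite r8 !ge_min lexx !orbT.
have pfar z : ~ K z -> ~ ball p (8 * r) z by move=> nK /(le_ball rd1) /d1K.
have qfar z : K z \/ J z -> ~ ball q (8 * r) z by move=> Kz /(le_ball rd2); exact: d2K.
have r80 : 0 < 8 * r by rewrite mulr_gt0.
have JnK z : J z -> ~ K z by move=> Jz Kz; have : set0 z by rewrite -KJ.
have Jp x y z w : J x -> ball x (8 * r) y -> ball x (8 * r) z -> ball x (8 * r) w ->
    cutat p y z (+) cutat p z w = cutat p y w.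
  by move=> Jx; apply: cutat_cocycle => //; apply: pfar; exact: JnK.
have Jq x y z w : J x -> ball x (8 * r) y -> ball x (8 * r) z -> ball x (8 * r) w ->
    cutat q y z (+) cutat q z w = cutat q y w.
  by move=> Jx; apply: cutat_cocycle => //; apply: qfar; right.
pose g x y := cutat p x y (+) cutat q x y.
have Jg x y z w : J x -> ball x (8 * r) y -> ball x (8 * r) z -> ball x (8 * r) w ->
    g y z (+) g z w = g y w.
  by move=> Jx y1 z1 w1; rewrite /g addbACA (Jp x) // (Jq x).
pose nearJ x j := J j /\ ball j (2 * r) x.
have [pr prP] : exists pr : plane -> plane, forall x, (exists j, nearJ x j) -> nearJ x (pr x).
  suff /choice[pr prP] : forall x, exists y, (exists j, nearJ x j) -> nearJ x y by exists pr.
  move=> x; by have [[j jx]|n] := pselect (exists j, nearJ x j); [exists j|exists x].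
(* [H] extends h, as a primitive of g, to the points within 2 r of J. *)
pose H x := h (pr x) (+) g (pr x) x.
have gH x y : (exists j, nearJ x j) -> (exists j, nearJ y j) -> ball x r y -> g x y = H x (+) H y.
  move=> /prP[Jx bx] /prP[Jy by_] xy.
  have b8 e z : e <= 8 * r -> ball (pr x) e z -> ball (pr x) (8 * r) z by move=> ez /(le_ball ez).
  have B1 := ball_triangle bx xy.
  have B2 := ball_triangle B1 (ball_sym by_).
  have X : ball (pr x) (8 * r) x by apply: b8 bx; lra.
  have Y : ball (pr x) (8 * r) y by apply: b8 B1; lra.
  have Z : ball (pr x) (8 * r) (pr y) by apply: b8 B2; lra.
  have W : ball (pr x) (8 * r) (pr x) by exact: ballxx.
  have hh : g (pr x) (pr y) = h (pr x) (+) h (pr y).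
    by apply: hJ => //; apply: le_ball Z.
  have e1 : g (pr x) x (+) g x y = g (pr x) y by exact: (Jg (pr x)).
  have e2 : g (pr x) (pr y) (+) g (pr y) y = g (pr x) y by exact: (Jg (pr x)).
  move: e1 e2; rewrite hh /H.
  by case: (g x y); case: (g (pr x) x); case: (g (pr y) y); case: (g (pr x) y);
    case: (h (pr x)); case: (h (pr y)).
pose C x y := if `[< K x \/ K y >] then cutat q x y (+) (H x (+) H y) else cutat p x y.
(* If some corners are in K and others are not, a segment between two of them meets J. All corners
   are then near J, where both branches of [C] agree with [cutat p]. The remaining cells have all
   corners in K, far from q, or all outside K, far from p. *)
have cell x y z w : ball x r y -> ball y r w -> ball x r z -> ball z r w -> ball x r w -> ball y r z ->
    C x y (+) C y w = C x z (+) C z w.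
  move=> xy yw xz zw xw yz.
  have mixed a b : K a -> ~ K b -> ball a r b ->
      (forall c, ball a r c -> exists j, nearJ c j) .
    move=> Ka nKb ab c ac; have [j Jj sj] := seg_frontier oK clK Ka nKb.
    exists j; split=> //; have := ball_triangle (ball_sym (seg_ball ab sj)) ac.
    by have -> : r + r = 2 * r by ring.
  have rr (a : plane) : ball a r a by exact: ballxx.
  have [allnear|nomix] := pselect (forall c, c \in [:: x; y; z; w] -> exists j, nearJ c j).
    have Cp a b : a \in [:: x; y; z; w] -> b \in [:: x; y; z; w] -> ball a r b -> C a b = cutat p a b.
      move=> /allnear an /allnear bn ab; rewrite /C; case: ifP => // _.
      by rewrite -gH // /g; case: (cutat p a b); case: (cutat q a b).
    rewrite !Cp ?inE ?eqxx ?orbT //.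
    have [j [Jj jx]] := allnear x (mem_head _ _).
    have b8 c : ball x r c -> ball j (8 * r) c.
      by move=> xc; apply: le_ball (ball_triangle jx xc); lra.
    by rewrite !(Jp j) //; apply: b8.
  have [allK|nK] := pselect (forall c, c \in [:: x; y; z; w] -> K c).
    have Cq a b : a \in [:: x; y; z; w] -> C a b = cutat q a b (+) (H a (+) H b).
      by move=> /allK Ka; rewrite /C; case: asboolP => // -[]; left.
    rewrite !Cq ?inE ?eqxx ?orbT //.
    have xf : ~ ball q (8 * r) x by apply: qfar; left; apply: allK; exact: mem_head.
    have b8 c : ball x r c -> ball x (8 * r) c by apply: le_ball; rewrite ler_peMl ?ltW // ?ltr1n.
    have e1 : cutat q x y (+) cutat q y w = cutat q x z (+) cutat q z w.
      by rewrite !(cutat_cocycle r80 xf) //; apply: b8.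
    transitivity ((cutat q x y (+) cutat q y w) (+) (H x (+) H w)); first by clear; addb_tauto.
    by rewrite e1; clear; addb_tauto.
  have noK c : c \in [:: x; y; z; w] -> ~ K c.
    move=> cin Kc; apply: nomix => e ein.
    have all_close a b : a \in [:: x; y; z; w] -> b \in [:: x; y; z; w] -> ball a r b.
      have wx := ball_sym xw; have zy := ball_sym yz; have yx := ball_sym xy; have wy := ball_sym yw.
      have zx := ball_sym xz; have wz := ball_sym zw.
      by rewrite !inE => /or4P[]/eqP-> /or4P[]/eqP->.
    have /existsNP[b /not_implyP[bin nKb]] := nK.
    by apply: (mixed c b) => //; exact: all_close.
  have Cp a b : a \in [:: x; y; z; w] -> b \in [:: x; y; z; w] -> C a b = cutat p a b.
    by move=> /noK na /noK nb; rewrite /C; case: asboolP => // -[].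
  rewrite !Cp ?inE ?eqxx ?orbT //.
  have xf : ~ ball p (8 * r) x by apply: pfar; apply: noK; exact: mem_head.
  have b8 c : ball x r c -> ball x (8 * r) c by apply: le_ball; rewrite ler_peMl ?ltW // ?ltr1n.
  by rewrite !(cutat_cocycle r80 xf) //; apply: b8.
have M0 : 0 < M by have [/(le_lt_trans (normr_ge0 _))] := bK p Kp.
have IM (a : R) : `[- M, M]%classic a -> - M <= a <= M by rewrite /= in_itv.
have inM (a : R) : - M <= a <= M -> `[- M, M]%classic a by rewrite /= in_itv.
have MN : - M <= - M <= M by apply/andP; split; lra.
have MP : - M <= M <= M by apply/andP; split; lra.
have [s chs ls] := @connected_chain R R `[- M, M]%classic (- M) M r (@segment_connected _ _ _)
  (inM _ MN) (inM _ MP) r0.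
have bx0 (a : R) : ball a r a by exact: ballxx.
have := @green R R plane pair C `[- M, M]%classic `[- M, M]%classic
  (fun a b : R => ball a r b) (fun a b : R => ball a r b) _ (- M) s (- M) s chs chs.
rewrite ls => /(_ _)/wrap[].
  move=> a a' b b' _ _ _ _ aa bb.
  have aa' := ball_sym aa; have bb' := ball_sym bb.
  by apply: cell; split.
have noK x : M <= `|x.1| \/ M <= `|x.2| -> ~ K x.
  by move=> MM /bK[]; case: MM => MM; rewrite !ltNge MM // => _.
have Cb x y : (M <= `|x.1| \/ M <= `|x.2|) -> (M <= `|y.1| \/ M <= `|y.2|) -> C x y = cutat p x y.
  by move=> /noK nx /noK ny; rewrite /C; case: asboolP => // -[].
have nM : `|M| = M by rewrite gtr0_norm.
have nMM : `|- M| = M by rewrite normrN.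
(* A side of the large square avoids K and lies in a half-plane off p, so its sum collapses to one
   [cutat] between corners. *)
have side (F : R -> plane) (l : plane) :
    (forall a : R, `[- M, M]%classic a -> 0 < dotp l (F a - p)) ->
    (forall a, M <= `|(F a).1| \/ M <= `|(F a).2|) ->
    csum (fun a b => C (F a) (F b)) (- M) s = cutat p (F (- M)) (F M).
  move=> lF FM.
  transitivity (csum (fun a b => cutat p (F a) (F b)) (- M) s).
    by apply: eq_csum_chain chs => y z _ _ _; exact: Cb.
  rewrite (csum_cocycle (C := fun a b => cutat p (F a) (F b)) _ _ chs) ?ls //.
    by move=> a b c /lF la /lF lb /lF lc; exact: cut_cocycle la lb lc.
  by move=> a _; exact: cutatxx.
have [p1 p2] := bK p Kp; rewrite !ltr_norml in p1 p2.
rewrite (side (fun b => (- M, b)) (-1, 0)); last first.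
- by move=> a; left; rewrite /= nMM.
- by move=> a /IM; rewrite /dotp /=; lra.
rewrite (side (fun a => (a, M)) (0, 1)); last first.
- by move=> a; right; rewrite /= nM.
- by move=> a /IM; rewrite /dotp /=; lra.
rewrite (side (fun a => (a, - M)) (0, -1)); last first.
- by move=> a; right; rewrite /= nMM.
- by move=> a /IM; rewrite /dotp /=; lra.
rewrite (side (fun b => (M, b)) (1, 0)); last first.
- by move=> a; left; rewrite /= nM.
- by move=> a /IM; rewrite /dotp /=; lra.
(* Of the four sides only the left one crosses the negative half-axis issuing from p, which makes
   the total odd. *)
have l1 (t : R) : lower (t, - M - p.2) = true by rewrite /lower /=; apply/orP; left; lra.
have l2 (t : R) : lower (t, M - p.2) = false.
  by have H2 : 0 < M - p.2 by [lra|]; rewrite /lower /= ltNge (ltW H2) /= gt_eqF.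
rewrite /cutat /cut.
have E (a b : R) : ((a, b) : plane) - p = (a - p.1, b - p.2) by [].
rewrite !E !l1 !l2 /=.
rewrite /crossp /=.
have -> : (0 < (- M - p.1) * (M - p.2) - (- M - p.2) * (- M - p.1)) = false by apply/negbTE;
  rewrite -leNgt; nra.
have -> : (0 < (M - p.1) * (M - p.2) - (- M - p.2) * (M - p.1)) = true by nra.
by [].
Qed.

End Borsuk.

Section Jordan.
Variable R : realType.
Notation plane := (R * R)%type.
Implicit Types (x y z p q : plane) (A J K : set plane).

Lemma compact_box A : compact A ->
  exists2 M : R, 0 < M & forall z, A z -> `|z.1| < M /\ `|z.2| < M.
Proof.
move=> cA.
have [] := @compact_uniform R plane A (fun e z => e * `|z.1| < 1 /\ e * `|z.2| < 1) cA.
- move=> e e' x ee [h1 h2]; split.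
  + by apply: le_lt_trans h1; apply: ler_wpM2r.
  + by apply: le_lt_trans h2; apply: ler_wpM2r.
- move=> x _; pose B := `|x.1| + `|x.2| + 2.
  have B0 : 0 < B by rewrite /B; have := normr_ge0 x.1; have := normr_ge0 x.2; lra.
  exists B^-1; first by rewrite invr_gt0.
  have B1 : B^-1 <= 1 by rewrite invf_le1 // /B; have := normr_ge0 x.1; have := normr_ge0 x.2; lra.
  move=> y /ball_plane[h1 h2]; rewrite !(mulrC B^-1) !ltr_pdivrMr // !mul1r.
  have := normr_ge0 x.1; have := normr_ge0 x.2.
  have := ler_distD x.1 y.1 0; have := ler_distD x.2 y.2 0; rewrite !subr0 (distrC y.1) (distrC y.2).
  by rewrite /B in h1 h2 B1 *; split; lra.
- move=> e e0 H; exists e^-1; first by rewrite invr_gt0.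
  by move=> z /H[h1 h2]; split; rewrite -[e^-1]mul1r ltr_pdivlMr // mulrC.
Qed.

(** The sum of the two lifts is a function of the parameter. It fails to be one on the curve only by
    its jump between the ends 0 and 1, and equal winding parities of x and y make that jump
    vanish. *)
Lemma cutat_closed_curve (f : R -> plane) x y (Hx Hy : R -> bool) (h : R) :
    {within `[0, 1], continuous f} -> {in `[0, 1[ &, injective f} -> f 0 = f 1 ->
    ~ (f @` `[0, 1]) x -> ~ (f @` `[0, 1]) y -> 0 < h ->
    (forall s t : R, `[0, 1]%classic s -> `[0, 1]%classic t ->
      `|s - t| < h -> cutat x (f s) (f t) = Hx s (+) Hx t) ->
    (forall s t : R, `[0, 1]%classic s -> `[0, 1]%classic t ->
      `|s - t| < h -> cutat y (f s) (f t) = Hy s (+) Hy t) ->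
    Hx 0 (+) Hx 1 = Hy 0 (+) Hy 1 ->
  exists g : plane -> bool, exists2 d : R, 0 < d & forall u v, (f @` `[0, 1]) u -> (f @` `[0, 1]) v ->
    ball u d v -> cutat x u v (+) cutat y u v = g u (+) g v.
Proof.
move=> cf finj f01 fx fy h0 hx hy W.
have cJ : compact (f @` `[0, 1]) by apply: continuous_compact (@segment_compact _ _ _).
have far p : ~ (f @` `[0, 1]) p -> exists2 d : R, 0 < d & forall t : R, `[0, 1]%classic t -> ~
  ball p d (f t).
  move=> fp; have [||d d0 dJ] := compact_closed_dist cJ (B := [set p]).
  - exact: (compact_closed (@plane_hausdorff R) (@compact_set1 _ p)).
  - by apply/seteqP; split=> // z [Jz zp]; apply: fp; rewrite -zp.
  - by exists d => // t t1 /ball_sym; apply: dJ => //; exists t.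
have [dx dx0 dxJ] := far x fx; have [dy dy0 dyJ] := far y fy.
have I0 : `[0, 1]%classic (0 : R) by rewrite /= in_itv /= lexx ler01.
have I1 : `[0, 1]%classic (1 : R) by rewrite /= in_itv /= lexx ler01.
pose m := Num.min dx dy.
have m0 : 0 < m by rewrite lt_min dx0.
have [k k0 kf] := within_uniform cf m0.
pose k' := Num.min h k.
have k'0 : 0 < k' by rewrite lt_min h0.
have [d d0 dinv] := simple_closed_inverse cf finj f01 k'0.
have [inv invP] : exists inv : plane -> R, forall u, (f @` `[0, 1]) u -> `[0, 1]%classic (inv u)
  /\ f (inv u) = u.
  suff /choice[inv ?] : forall u, exists t, (f @` `[0, 1]) u -> `[0, 1]%classic t /\ f t = u by
    exists inv.
  move=> u; have [[t t1 ftu]|n] := pselect ((f @` `[0, 1]) u); first by exists t.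
  by exists 0 => /n.
exists (fun u => Hx (inv u) (+) Hy (inv u)), d => // u v /invP[su fu] /invP[sv fv].
move: (inv u) (inv v) su sv fu fv => s t s1 t1 <- <- {u v} /(dinv _ _ s1 t1).
case=> [|st]; rewrite ?lt_min.
  by move=> /andP[st _]; rewrite hx // hy // addbACA.
(* For parameters near different ends, the step is routed through the common point f 0 = f 1; the
   lifts then differ by the jump, which [W] cancels. *)
have wrap (a b : R) : `[0, 1]%classic a -> `[0, 1]%classic b -> 1 - k' < b - a ->
    cutat x (f a) (f b) (+) cutat y (f a) (f b) = (Hx a (+) Hx b) (+) (Hy a (+) Hy b).
  move=> a1 b1 ab; have := a1; have := b1; rewrite /= !in_itv /= => /andP[b0' b1'] /andP[a0' a1'].
  have a0 : `|a - 0| < k' by rewrite subr0 ger0_norm //; lra.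
  have b0 : `|1 - b| < k' by rewrite ger0_norm //; lra.
  rewrite !lt_min in a0 b0; case/andP: a0 => a0 a0k; case/andP: b0 => b0 b0k.
  have A1 : ball (f 0) m (f a) by apply: kf => //; rewrite distrC.
  have A2 : ball (f 0) m (f b) by rewrite f01; apply: kf.
  have split_at p dp : 0 < dp -> m <= dp -> (forall t : R, `[0, 1]%classic t -> ~ ball p dp (f t)) ->
      cutat p (f a) (f b) = cutat p (f a) (f 0) (+) cutat p (f 1) (f b).
    move=> dp0 mdp pJ; rewrite -f01; apply/esym.
    by apply: (cutat_cocycle dp0 (pJ _ I0)); [exact: le_ball A1|exact: ballxx|exact: le_ball A2].
  rewrite (split_at x dx) ?(split_at y dy) ?ge_min ?lexx ?orbT //.
  rewrite !hx // !hy //.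
  transitivity (((Hx a (+) Hx b) (+) (Hy a (+) Hy b)) (+) ((Hx 0 (+) Hx 1) (+) (Hy 0 (+) Hy 1))).
    by clear; addb_tauto.
  by rewrite W addbb addbF.
rewrite addbACA; move: st; rewrite ltr_normr => /orP[st|st].
  have sym p dp : 0 < dp -> m <= dp -> (forall t : R, `[0, 1]%classic t -> ~ ball p dp (f t)) ->
      cutat p (f s) (f t) = cutat p (f t) (f s).
    move=> dp0 mdp pJ.
    have B1 : ball (f 0) m (f t).
      apply: kf => //; move: (t1) (s1); rewrite /= !in_itv /= sub0r normrN => /andP[? ?] /andP[? ?].
      by rewrite ger0_norm // (@lt_le_trans _ _ k') // ?ge_min ?lexx ?orbT //; lra.
    have B2 : ball (f 0) m (f s).
      rewrite f01; apply: kf => //; move: (t1) (s1); rewrite /= !in_itv /= => /andP[? ?] /andP[? ?].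
      by rewrite ger0_norm ?subr_ge0 // (@lt_le_trans _ _ k') // ?ge_min ?lexx ?orbT //; lra.
    have [l Hl] := cut_half_plane dp0 (pJ _ I0).
    by apply: (@cutC _ l); apply: Hl; [exact: le_ball B2|exact: le_ball B1].
  rewrite (sym x dx) ?(sym y dy) ?ge_min ?lexx ?orbT //.
  rewrite (wrap t s) //.
  by rewrite (addbC (Hx t)) (addbC (Hy t)).
by rewrite (wrap s t) //; lra.
Qed.

(** Suppose y cannot be joined to the far corner r, and let p be an interior point. Two of p, y, r
    have equal winding parity around the boundary, so the sum of their cocycles is a coboundary
    there. But the interior of A separates p from the other two, and the component [K] of y
    separates y from r, so [cutat_not_coboundary] applies in each case. *)
Lemma region_compl_joined A c d : simple_closed_region A -> ~ A c -> ~ A d -> joined (~` A) c d.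
Proof.
move=> [cA [p Op] kO [f [cf finj f01 fJ]]] nAc nAd.
have clA : closed A by exact: (compact_closed (@plane_hausdorff R)).
have oA : open (~` A) by exact: closed_openC.
have [M M0 bA] := compact_box cA.
have JE : frontier A = A `\` A° by rewrite /frontier -(closure_id A).1.
have cJ : compact (frontier A).
  by rewrite fJ; apply: continuous_compact (@segment_compact _ _ _).
pose r : plane := (M, M).
have nAr : ~ A r by move=> /bA[/=]; rewrite gtr0_norm // ltxx.
have tor y : (M <= `|y.1| \/ M <= `|y.2|) -> joined (~` A) y r.
  move=> My.
  have far1 (a b b' : R) : M <= `|a| -> joined (~` A) (a, b) (a, b').
    move=> Ma; apply: seg_joined => _ [t _ <-] /bA[/=].
    by rewrite subrr mulr0 addr0 ltNge Ma.
  have far2 (a a' b : R) : M <= `|b| -> joined (~` A) (a, b) (a', b).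
    move=> Mb; apply: seg_joined => _ [t _ <-] /bA[_ /=].
    by rewrite subrr mulr0 addr0 ltNge Mb.
  have MM : M <= `|M| by rewrite gtr0_norm.
  rewrite [y]surjective_pairing; case: My => My.
    exact: joined_trans (far1 y.1 y.2 M My) (far2 y.1 M M MM).
  exact: joined_trans (far2 y.1 M y.2 My) (far1 M y.2 M MM).
suff tr y : ~ A y -> joined (~` A) y r.
  by apply: joined_trans (tr c nAc) (joined_sym (tr d nAd)).
move=> {c d nAc nAd} nAy; apply: contrapT => nyr.
pose K := joined (~` A) y.
have Ky : K y by apply: (connected_joined (S := [set y]) oA) => //; [exact: connected1|move=> _ ->].
have KA z : K z -> ~ A z by case=> L [_ _ LA _ /LA].
have nearK z : ~ A z -> exists2 e, 0 < e & forall w, ball z e w -> joined (~` A) z w.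
  move=> /(open_ballE oA)[e e0 eW]; exists e => // w /seg_ball sy.
  by apply: seg_joined => t /sy /eW.
have oK : open K.
  apply: openP_ball => z Kz; have [e e0 eH] := nearK z (KA z Kz).
  by exists e => // w /eH; exact: joined_trans Kz.
have clK : closure K `<=` K `|` frontier A.
  move=> z clz; have [Az|nAz] := pselect (A z).
    right; rewrite JE; split=> // Oz.
    have [w [Kw Ow]] := clz _ (open_nbhs_nbhs (conj (@open_interior _ A) Oz)).
    exact: KA Kw (interior_subset Ow).
  left; have [e e0 eH] := nearK z nAz.
  have [w [Kw /eH zw]] := clz _ (nbhsx_ballx z e e0).
  exact: joined_trans Kw (joined_sym zw).
have KJ : K `&` frontier A = set0.
  by apply/seteqP; split=> // z [/KA nA]; rewrite JE => -[].
have bK z : K z -> `|z.1| < M /\ `|z.2| < M.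
  move=> Kz; split; rewrite ltNge; apply/negP => Mz; apply: nyr.
    by apply: joined_trans Kz (tor _ _); left.
  by apply: joined_trans Kz (tor _ _); right.
have nKr : ~ K r by [].
have OJ : A° `&` frontier A = set0 by apply/seteqP; split=> // z []; rewrite JE => Oz [].
have clO : closure A° `<=` A° `|` frontier A.
  move=> z /(closureS (@interior_subset _ A)); rewrite -(closure_id A).1 // => Az.
  by rewrite JE; have [Oz|nOz] := pselect (A° z); [left|right].
have bO z : A° z -> `|z.1| < M /\ `|z.2| < M by move=> /interior_subset /bA.
have oO : open A° by exact: open_interior.
have nOy : ~ A° y by move=> /interior_subset.
have nOr : ~ A° r by move=> /interior_subset.
have nJp : ~ frontier A p by rewrite JE => -[].
have nJy : ~ frontier A y by rewrite JE => -[].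
have nJr : ~ frontier A r by rewrite JE => -[].
rewrite fJ in nJp nJy nJr.
have [Hp [hp hp0 Hp1]] := cutat_lift cf nJp.
have [Hy [hy hy0 Hy1]] := cutat_lift cf nJy.
have [Hr [hr hr0 Hr1]] := cutat_lift cf nJr.
pose h := Num.min hp (Num.min hy hr).
have h0 : 0 < h by rewrite !lt_min hp0 hy0.
have {}Hp1 (s t : R) : `[0, 1]%classic s -> `[0, 1]%classic t -> `|s - t| < h -> cutat p (f s) (f
  t) = Hp s (+) Hp t.
  by move=> s1 t1; rewrite !lt_min => /and3P[? _ _]; exact: Hp1.
have {}Hy1 (s t : R) : `[0, 1]%classic s -> `[0, 1]%classic t -> `|s - t| < h -> cutat y (f s) (f
  t) = Hy s (+) Hy t.
  by move=> s1 t1; rewrite !lt_min => /and3P[_ ? _]; exact: Hy1.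
have {}Hr1 (s t : R) : `[0, 1]%classic s -> `[0, 1]%classic t -> `|s - t| < h -> cutat r (f s) (f
  t) = Hr s (+) Hr t.
  by move=> s1 t1; rewrite !lt_min => /and3P[_ _ ?]; exact: Hr1.
rewrite fJ in cJ clK KJ clO OJ.
have [W|[W|W]] : Hp 0 (+) Hp 1 = Hy 0 (+) Hy 1 \/ Hp 0 (+) Hp 1 = Hr 0 (+) Hr 1 \/ Hy 0 (+) Hy 1
  = Hr 0 (+) Hr 1.
  by case: (_ (+) _); case: (_ (+) _); case: (_ (+) _); auto.
- have [g [e e0 gE]] := cutat_closed_curve cf finj f01 nJp nJy h0 Hp1 Hy1 W.
  exact: (cutat_not_coboundary cJ oO clO OJ bO Op nOy nJy e0 gE).
- have [g [e e0 gE]] := cutat_closed_curve cf finj f01 nJp nJr h0 Hp1 Hr1 W.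
  exact: (cutat_not_coboundary cJ oO clO OJ bO Op nOr nJr e0 gE).
- have [g [e e0 gE]] := cutat_closed_curve cf finj f01 nJy nJr h0 Hy1 Hr1 W.
  exact: (cutat_not_coboundary cJ oK clK KJ bK Ky nKr nJr e0 gE).
Qed.

End Jordan.

(** * Three pairwise good clusters do not exist *)

Section Nocross.
Variable R : realType.
Notation plane := (R * R)%type.
Implicit Types (x y z u v : plane) (A B K L : set plane).

Lemma finite_eps (I : finType) (P : I -> R -> Prop) :
  (forall i, exists2 e : R, 0 < e & forall e', 0 < e' <= e -> P i e') ->
  exists2 e : R, 0 < e & forall i, P i e.
Proof.
move=> /(_ _)/cid2-/all_sig2[e e0 eP].
have m0 : 0 < \big[Num.min/1]_i e i.
  by apply: (big_ind (fun r : R => 0 < r)) => // x y x0 y0; rewrite lt_min x0.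
by exists (\big[Num.min/1]_i e i) => // i; apply: eP; rewrite m0 bigmin_le_cond.
Qed.

(** By [crosspar_closed] the parity of the original chains is the sum of the three parities that
    involve a replacement, and those vanish by disjointness. *)
Lemma closed_nocross K K' L L' u v c d :
    compact K -> compact K' -> compact L -> compact L' ->
    connected K' -> connected L' -> K' u -> K' v -> L' c -> L' d ->
    K' `&` L = set0 -> K `&` L' = set0 -> K' `&` L' = set0 ->
  exists2 e : R, 0 < e & forall e', 0 < e' <= e -> forall s t,
    chain K (fun x y => ball x e' y) u s -> chain L (fun x y => ball x e' y) c t ->
    last u s = v -> last c t = d -> crosspar u s c t = false.
Proof.
move=> cK cK' cL cL' kK' kL' K'u K'v L'c L'd K'L KL' K'L'.
have [e1 e10 H1] := disjoint_nocross cK' cL K'L.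
have [e2 e20 H2] := disjoint_nocross cK cL' KL'.
have [e3 e30 H3] := disjoint_nocross cK' cL' K'L'.
exists (Num.min e1 (Num.min e2 e3)); first by rewrite !lt_min e10 e20.
move=> e; rewrite !le_min => /and4P[e0 ee1 ee2 ee3] s t chs cht ls lt.
have [s' chs' ls'] := connected_chain kK' K'u K'v e0.
have [t' cht' lt'] := connected_chain kL' L'c L'd e0.
have := @crosspar_closed R u s s' c t t'; rewrite ls ls' lt lt' => /(_ erefl erefl).
rewrite (H1 e _ _ _ _ _ chs' cht) ?(H2 e _ _ _ _ _ chs cht') ?(H3 e _ _ _ _ _ chs' cht') ?e0 //.
by rewrite !addbF.
Qed.

(** If A minus B is connected, c and d are first joined by L' outside A. Then A minus B is a
    connected set avoiding B and L', and a continuum near it joins u to v. The other case is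
    symmetric. *)
Lemma region_nocross A B K L u v c d :
    simple_closed_region A -> simple_closed_region B ->
    connected (A `\` B) \/ connected (B `\` A) ->
    compact K -> compact L -> K `<=` A -> L `<=` B ->
    A u -> A v -> B c -> B d -> ~ B u -> ~ B v -> ~ A c -> ~ A d ->
  exists2 e : R, 0 < e & forall e', 0 < e' <= e -> forall s t,
    chain K (fun x y => ball x e' y) u s -> chain L (fun x y => ball x e' y) c t ->
    last u s = v -> last c t = d -> crosspar u s c t = false.
Proof.
move=> rA rB cAB cK cL KA LB Au Av Bc Bd nBu nBv nAc nAd.
have clA : closed A by case: rA => cA _ _ _; exact: (compact_closed (@plane_hausdorff R)).
have clB : closed B by case: rB => cB _ _ _; exact: (compact_closed (@plane_hausdorff R)).
have disj (X Y : set plane) : X `<=` ~` Y -> X `&` Y = set0 by move/disjoints_subset.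
case: cAB => cAB.
- have [L' [cL' kL' L'A L'c L'd]] := region_compl_joined rA nAc nAd.
  have clL' := compact_closed (@plane_hausdorff R) cL'.
  have [] : joined (~` (B `|` L')) u v.
    apply: (connected_joined _ cAB).
    + by apply/closed_openC; exact: closedU.
    + by move=> z [Az nBz] [//|/L'A].
    + by split.
    + by split.
  move=> K' [cK' kK' K'B K'u K'v].
  apply: (closed_nocross cK cK' cL cL' kK' kL') => //; apply: disj => z.
  + by move=> /K'B nB /LB Bz; apply: nB; left.
  + by move=> /KA Az /L'A.
  + by move=> /K'B nB Lz; apply: nB; right.
- have [K' [cK' kK' K'B K'u K'v]] := region_compl_joined rB nBu nBv.
  have clK' := compact_closed (@plane_hausdorff R) cK'.
  have [] : joined (~` (A `|` K')) c d.
    apply: (connected_joined _ cAB).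
    + by apply/closed_openC; exact: closedU.
    + by move=> z [Bz nAz] [//|/K'B].
    + by split.
    + by split.
  move=> L' [cL' kL' L'A L'c L'd].
  apply: (closed_nocross cK cK' cL cL' kK' kL') => //; apply: disj => z.
  + by move=> /K'B nB /LB.
  + by move=> /KA Az /L'A; apply; left.
  + by move=> K'z /L'A; apply; right.
Qed.

End Nocross.

(** * The family of clustered graphs *)

Section Stars.
Variable n : nat.

Definition star_adj : rel ('I_3 * option 'I_n) :=
  [rel u v | (u.1 == v.1) && (isSome u.2 != isSome v.2)].

Lemma star_adj_sym : symmetric star_adj.
Proof. by move=> u v; rewrite /star_adj /= eq_sym (eq_sym (isSome u.2)). Qed.

Lemma star_adj_irr : irreflexive star_adj.
Proof. by move=> u; rewrite /star_adj /= !eqxx. Qed.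

Definition stars : sgraph := SGraph star_adj_sym star_adj_irr.

Lemma stars_wf (mu : option 'I_n) : exists k, iter k (fun _ => None) mu = None :> option 'I_n.
Proof. by exists 1%N. Qed.

Lemma stars_has_child (mu : option 'I_n) : (exists v : stars, v.2 = mu) \/
  (exists2 nu : option 'I_n, nu != None & None = mu :> option 'I_n).
Proof. by left; exists (ord0, mu). Qed.

(** [snd] is the parent map of the leaves of the tree: a hub (s, None) hangs at the root [None], the
    leaf (s, Some i) of a star at cluster i. *)
Definition clustered_stars : clustered_graph :=
  @ClusteredGraph stars (option 'I_n) None snd (fun _ => None) erefl stars_wf stars_has_child.

Definition sedge (s : 'I_3) (i : 'I_n) : {set stars} :=
  [set ((s, None) : stars); ((s, Some i) : stars)]%SET.

Lemma stars_descendant (mu nu : cnode clustered_stars) :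
  descendant mu nu = (mu == nu) || (nu == None).
Proof.
rewrite /descendant; apply/idP/orP.
  move=> /iter_findex <-; case: (findex _ _ _) => [|k]; [by left|by right].
case=> [/eqP->|/eqP->]; first exact: connect0.
exact: (@fconnect_iter _ _ 1).
Qed.

Lemma in_star_cluster (v : stars) (mu : cnode clustered_stars) :
  (v \in cluster_vertices mu) = (v.2 == mu) || (mu == None).
Proof. by rewrite inE stars_descendant. Qed.

Lemma stars_incomparable (mu nu : cnode clustered_stars) :
  incomparable mu nu = [&& mu != nu, mu != None & nu != None].
Proof.
rewrite /incomparable !stars_descendant !negb_or (eq_sym nu mu).
by case: (mu != nu); case: (mu != None); case: (nu != None).
Qed.

Lemma sedge_adj s i : adj ((s, Some i) : stars) (s, None).
Proof. by rewrite /= /star_adj /= eqxx. Qed.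

Lemma edgesP (e : {set stars}) : reflect (exists s i, e = sedge s i) (e \in edges stars).
Proof.
apply: (iffP idP) => [|[s [i ->]]].
  rewrite inE => /existsP[[s u] /existsP[[s' v] /andP[/andP[/= /eqP-> uv] /eqP->]]].
  exists s'; case: u v uv => [i|] [j|] //= _; [exists i|exists j] => //.
  by rewrite /sedge finset.setUC.
by rewrite inE; apply/existsP; exists (s, None); apply/existsP; exists (s, Some i); rewrite /=
  /star_adj /= !eqxx.
Qed.

Lemma sedge_inj s i s' i' : sedge s i = sedge s' i' -> s = s' /\ i = i'.
Proof.
move=> E; have : ((s, Some i) : stars) \in sedge s' i' by rewrite -E !inE eqxx orbT.
by rewrite !inE !xpair_eqE /= andbF /= => /andP[/eqP-> /eqP[->]].
Qed.

Lemma stars_flat : flat clustered_stars.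
Proof. by move=> mu nu mu0 nm; rewrite stars_descendant negb_or nm. Qed.

Lemma stars_not_c_connected (i : 'I_n) : ~ c_connected clustered_stars.
Proof.
move=> /(_ (Some i)) /(_ (ord0, Some i) (ord_max, Some i)).
rewrite !in_star_cluster /= eqxx => /(_ isT isT) /connectP[[|v p] //=].
move=> /andP[+ _] _; rewrite /induced_adj /= !in_star_cluster /= !orbF => /and3P[_ /eqP e].
by rewrite /star_adj /= e andbF.
Qed.

Lemma card_stars : #|stars| = (3 * n.+1)%N.
Proof. by rewrite /= card_prod card_option !card_ord. Qed.

End Stars.

Section GoodTriple.
Variables (R : realType) (n : nat).
Notation plane := (R * R)%type.
Notation C := (clustered_stars n).
Variable D : predrawing R C.
Hypothesis drawD : clustered_drawing D.
Notation hub s := (pos D ((s, None) : ugraph C)).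
Notation leaf s i := (pos D ((s, Some i) : ugraph C)).
Notation reg i := (region D (Some i : cnode C)).

Lemma drawing_leaf s i : (reg i)° (leaf s i).
Proof.
case: drawD => _ reg_ vert _ _; have [[_ H] nf] := vert (Some i) (s, Some i).
apply: contrapT => nint; apply: nf; split=> //.
by apply: subset_closure; apply: H; rewrite in_star_cluster /= eqxx.
Qed.

Lemma drawing_leaf_out s i j : j != i -> ~ reg j (leaf s i).
Proof.
case: drawD => _ _ vert _ _ ji; have [[H _] _] := vert (Some j) (s, Some i).
by move=> /H; rewrite in_star_cluster /= orbF => /eqP[] ij; rewrite ij eqxx in ji.
Qed.

Lemma drawing_hub_out s j : ~ reg j (hub s).
Proof.
by case: drawD => _ _ vert _ _; have [[H _] _] := vert (Some j) (s, None) => /H; rewrite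
  in_star_cluster.
Qed.

Lemma edge_closed_curve s i : exists f : R -> plane,
  [/\ {within `[0, 1], continuous f}, {in `[0, 1] &, injective f}, f 0 = leaf s i, f 1 = hub s
    & ecurve D (sedge s i) = f @` `]0, 1[].
Proof.
case: drawD => -[_ arc _] _ _ _ _.
have [f [cf finj f0 f1 fE]] := arc _ _ (@sedge_adj n s i).
by exists f; split=> //; rewrite -fE /sedge finset.setUC.
Qed.

Lemma edge_closure s i : exists E : set plane,
  [/\ compact E, connected E, E (leaf s i), E (hub s) &
      forall z, E z -> [\/ z = leaf s i, z = hub s | ecurve D (sedge s i) z]].
Proof.
have [f [cf finj f0 f1 fE]] := edge_closed_curve s i.
exists (f @` `[0, 1]); split.
- exact: continuous_compact (@segment_compact _ _ _).
- exact: connected_continuous_connected (@segment_connected _ _ _) cf.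
- by exists 0; rewrite //= in_itv /= lexx ler01.
- by exists 1; rewrite //= in_itv /= lexx ler01.
- move=> z [t /=]; rewrite in_itv /= => /andP[t0 t1] <-.
  have [->|tn0] := eqVneq t 0; first by constructor 1.
  have [->|tn1] := eqVneq t 1; first by constructor 2.
  by constructor 3; rewrite fE; exists t => //=; rewrite in_itv /= !lt_neqAle eq_sym tn0 t0 tn1.
Qed.

Lemma pos_inj : injective (pos D).
Proof. by case: drawD => -[]. Qed.

Lemma edge_no_vertex s i v : ~ ecurve D (sedge s i) (pos D v).
Proof. by case: drawD => -[_ _ H] _ _ _ _; apply: H; apply/edgesP; exists s, i. Qed.

(** The continuum stays in the interior because [good_pair] keeps foreign edges out of the interior
    only. *)
Lemma cluster_continuum i : exists K : set plane,
  [/\ compact K, connected K, K `<=` (reg i)° & forall s, K (leaf s i)].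
Proof.
case: drawD => _ reg_ _ _ _; have [cR _ kO _] := reg_ (Some i).
have J s s' : joined (reg i)° (leaf s i) (leaf s' i).
  by apply: (connected_joined (@open_interior _ _) kO) => //; exact: drawing_leaf.
have [K [cK kK KO K0 K1]] := J ord0 (@Ordinal 3 1 isT).
have [L [cL kL LO L0 L1]] := J ord0 (@Ordinal 3 2 isT).
exists (K `|` L); split.
- exact: compactU.
- by apply: connectedU => //; exists (leaf ord0 i).
- by move=> z [/KO|/LO].
- case=> [[|[|[|//]]] s3].
  + by left; have -> : Ordinal s3 = ord0 by exact: val_inj.
  + by left; have -> : Ordinal s3 = @Ordinal 3 1 isT by exact: val_inj.
  + by right; have -> : Ordinal s3 = @Ordinal 3 2 isT by exact: val_inj.
Qed.

(** This is what the absence of counted crossings between i and j provides. One orientation of the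
    difference is enough because only one is counted. *)
Definition good_pair i j :=
  [/\ forall s s', ecurve D (sedge s i) `&` ecurve D (sedge s' j) = set0,
      forall s, ecurve D (sedge s i) `&` (reg j)° = set0,
      forall s, ecurve D (sedge s j) `&` (reg i)° = set0
    & connected (reg i `\` reg j) \/ connected (reg j `\` reg i)].

(** Cluster a is represented by its leaf in star [ord0], which is joined to the hub of star s
    through [K a] and then along the edge of leaf (s, a). For distinct clusters and distinct stars
    the parity of two such paths splits into four. *)
Lemma good_triple_false (c : 'I_3 -> 'I_n) : injective c ->
  ~ (forall a b, a != b -> good_pair (c a) (c b)).
Proof.
move=> cinj good.
have cn a b : a != b -> c a != c b by apply: contra => /eqP/cinj->.
have /choice[K KP] := fun a => cluster_continuum (c a).
have /choice[E' E'P] := fun sa : 'I_3 * 'I_3 => edge_closure sa.1 (c sa.2).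
pose E s a := E' (s, a); have EP s a := E'P (s, a); rewrite /= in EP.
pose I4 := ('I_3 * 'I_3 * ('I_3 * 'I_3))%type.
(* The first three parities vanish by disjointness, for all chains. The last one, between the paths
   inside two possibly overlapping regions, vanishes only for chains with prescribed ends, since the
   paths are exchanged there. *)
have [] := @finite_eps R I4 (fun x e => forall a b s t, x = ((a, b), (s, t)) -> a != b -> s != t ->
  [/\ forall x u y v, chain (E s a) (fun x y => ball x e y) x u -> chain (E t b) (fun x y => ball
    x e y) y v ->
        crosspar x u y v = false,
      forall x u y v, chain (K a) (fun x y => ball x e y) x u -> chain (E t b) (fun x y => ball x
        e y) y v ->
        crosspar x u y v = false,
      forall x u y v, chain (E s a) (fun x y => ball x e y) x u -> chain (K b) (fun x y => ball x
        e y) y v ->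
        crosspar x u y v = false &
      forall u v, chain (K a) (fun x y => ball x e y) (leaf ord0 (c a)) u ->
        chain (K b) (fun x y => ball x e y) (leaf ord0 (c b)) v ->
        last (leaf ord0 (c a)) u = leaf s (c a) -> last (leaf ord0 (c b)) v = leaf t (c b) ->
        crosspar (leaf ord0 (c a)) u (leaf ord0 (c b)) v = false]).
  move=> [[a b] [s t]].
  have [ab|nab] := eqVneq a b; first by exists 1 => // e' _ a' b' s' t' [<- <- _ _]; rewrite ab eqxx.
  have [st|nst] := eqVneq s t; first by exists 1 => // e' _ a' b' s' t' [_ _ <- <-] _; rewrite st eqxx.
  have [g1 g2 g3 g4] := good a b nab.
  have [cKa kKa KaO Kal] := KP a; have [cKb kKb KbO Kbl] := KP b.
  have [cEa kEa Ea0 Ea1 EaP] := EP s a; have [cEb kEb Eb0 Eb1 EbP] := EP t b.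
  have disj (X Y : set plane) : (forall z, X z -> Y z -> False) -> X `&` Y = set0.
    by move=> H; apply/seteqP; split=> // z [/H].
  have no0 (X Y : set plane) z : X `&` Y = set0 -> X z -> Y z -> False.
    by move=> XY Xz Yz; have : set0 z by rewrite -XY.
  have neqv (v w : ugraph C) : pos D v = pos D w -> v == w by move=> /pos_inj ->.
  have [e1 e10 H1] : nocross (E s a) (E t b).
    apply: disjoint_nocross => //; apply: disj => z /EaP[->|->|ez] /EbP[zE|zE|ez'].
    - by move/neqv: zE; rewrite !xpair_eqE (negbTE nst).
    - by move/neqv: zE; rewrite !xpair_eqE (negbTE nst).
    - by move/edge_no_vertex: ez'.
    - by move/neqv: zE; rewrite !xpair_eqE (negbTE nst).
    - by move/neqv: zE; rewrite !xpair_eqE (negbTE nst).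
    - by move/edge_no_vertex: ez'.
    - by move: ez; rewrite zE => /edge_no_vertex.
    - by move: ez; rewrite zE => /edge_no_vertex.
    - exact: no0 (g1 s t) ez ez'.
  have [e2 e20 H2] : nocross (K a) (E t b).
    apply: disjoint_nocross => //; apply: disj => z /KaO Oz /EbP[zE|zE|ez].
    - by move: Oz; rewrite zE => /interior_subset; apply: drawing_leaf_out; exact: cn.
    - by move: Oz; rewrite zE => /interior_subset; apply: drawing_hub_out.
    - exact: no0 (g3 t) ez Oz.
  have [e3 e30 H3] : nocross (E s a) (K b).
    apply: disjoint_nocross => //; apply: disj => z /EaP[zE|zE|ez] /KbO Oz.
    - by move: Oz; rewrite zE => /interior_subset; apply: drawing_leaf_out; rewrite eq_sym; exact: cn.
    - by move: Oz; rewrite zE => /interior_subset; apply: drawing_hub_out.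
    - exact: no0 (g2 s) ez Oz.
  have := drawD; case=> _ reg_ _ _ _.
  have lin s' a' : reg (c a') (leaf s' (c a')) by apply: interior_subset; exact: drawing_leaf.
  have lout s' a' b' : a' != b' -> ~ reg (c a') (leaf s' (c b')) by move=> /cn; exact: drawing_leaf_out.
  have nba : b != a by rewrite eq_sym.
  have [e4 e40 H4] := region_nocross (reg_ _) (reg_ _) g4 cKa cKb
    (subset_trans KaO (@interior_subset _ _)) (subset_trans KbO (@interior_subset _ _))
    (lin ord0 a) (lin s a) (lin ord0 b) (lin t b)
    (lout ord0 _ _ nba) (lout s _ _ nba) (lout ord0 _ _ nab) (lout t _ _ nab).
  exists (Num.min (Num.min e1 e2) (Num.min e3 e4)); first by rewrite !lt_min e10 e20 e30.
  move=> e; rewrite !le_min => /andP[e0 /andP[/andP[l1 l2] /andP[l3 l4]]] a' b' s' t' [<- <- <- <-] _ _.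
  split; [apply: H1|apply: H2|apply: H3|apply: H4]; by rewrite e0.
move=> e e0 noC.
have [Q QP] : exists Q : 'I_3 -> 'I_3 -> seq plane, forall a s,
    chain (K a) (fun x y => ball x e y) (leaf ord0 (c a)) (Q a s) /\
    last (leaf ord0 (c a)) (Q a s) = leaf s (c a).
  suff /choice[Q QP] : forall a_s : 'I_3 * 'I_3, exists q,
      chain (K a_s.1) (fun x y => ball x e y) (leaf ord0 (c a_s.1)) q /\
      last (leaf ord0 (c a_s.1)) q = leaf a_s.2 (c a_s.1).
    by exists (fun a s => Q (a, s)) => a s; exact: (QP (a, s)).
  move=> [a s] /=; have [cKa kKa KaO Kal] := KP a.
  by have [q ? ?] := connected_chain kKa (Kal ord0) (Kal s) e0; exists q.
have [P PP] : exists P : 'I_3 -> 'I_3 -> seq plane, forall a s,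
    chain (E s a) (fun x y => ball x e y) (leaf s (c a)) (P a s) /\
    last (leaf s (c a)) (P a s) = hub s.
  suff /choice[P PP] : forall a_s : 'I_3 * 'I_3, exists q,
      chain (E a_s.2 a_s.1) (fun x y => ball x e y) (leaf a_s.2 (c a_s.1)) q /\
      last (leaf a_s.2 (c a_s.1)) q = hub a_s.2.
    by exists (fun a s => P (a, s)) => a s; exact: (PP (a, s)).
  move=> [a s] /=; have [cEa kEa Ea0 Ea1 EaP] := EP s a.
  by have [q ? ?] := connected_chain kEa Ea0 Ea1 e0; exists q.
have [] := @K33_crossing R (fun a => leaf ord0 (c a)) (fun s => hub s) (fun a s => Q a s ++ P a s)
  (fun a s => K a `|` E s a) (fun x y => ball x e y).
- by move=> s s' /pos_inj [].
- move=> a s; have [q1 q2] := QP a s; have [p1 p2] := PP a s; apply: chain_cat.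
    by apply: chain_sub q1 => // z; left.
  by rewrite q2; apply: chain_sub p1 => // z; right.
- by move=> a s; have [q1 q2] := QP a s; have [p1 p2] := PP a s; rewrite last_cat q2.
- move=> a s b ba; have [_ _ KaO _] := KP a; have [_ _ _ _ EaP] := EP s a.
  case=> [/KaO /interior_subset|/EaP[/pos_inj[_ /cinj ab]|/pos_inj[]|/edge_no_vertex]] //.
    by apply: drawing_leaf_out; rewrite eq_sym cn.
  by rewrite ab eqxx in ba.
- move=> a s t ts; have [_ _ KaO _] := KP a; have [_ _ _ _ EaP] := EP s a.
  case=> [/KaO /interior_subset|/EaP[/pos_inj[]|/pos_inj[st]|/edge_no_vertex]] //.
    exact: drawing_hub_out.
  by rewrite st eqxx in ts.
move=> a [s [b [t [ba ts]]]].
have [q1 q2] := QP a s; have [p1 p2] := PP a s; have [q3 q4] := QP b t; have [p3 p4] := PP b t.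
have [] := noC (a, b, (s, t)) a b s t erefl; rewrite 1?eq_sym // => N1 N2 N3 N4.
by rewrite crosspar_catl !crosspar_catr q2 q4 (N4 _ _ q1 q3 q2 q4) (N2 _ _ _ _ q1 p3) (N3 _ _ _ _
  p1 q3) (N1 _ _ _ _ p1 p3).
Qed.

End GoodTriple.

(** * Counting crossings *)

Section CardTools.

Lemma card_eq_inj (T : Type) (A : set T) k : A #= `I_k ->
  exists f : T -> nat, (forall x, A x -> (f x < k)%N) /\ (forall x y, A x -> A y -> f x = f y -> x = y).
Proof.
move=> /card_set_bijP[f [fA finj _]]; exists f; split=> [x Ax|x y Ax Ay].
  exact: (fA x).
by apply: finj; rewrite inE.
Qed.

Lemma card_ge2 (T : Type) (A : set T) k x y : A #= `I_k -> A x -> A y -> x <> y -> (1 < k)%N.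
Proof.
move=> /card_eq_inj[f [fk finj]] Ax Ay xy; rewrite ltnNge; apply/negP => k1.
apply: xy; apply: finj => //; have := fk x Ax; have := fk y Ay.
by move: k1; case: k {fk} => [|[|k]] // _; rewrite !ltnS !leqn0 => /eqP-> /eqP->.
Qed.

(** The predecessor is also 0 for k = 0, when A is empty. *)
Lemma components_connected (R : realType) (A : set (R * R)) k :
  components A #= `I_k -> (k.-1 = 0)%N -> connected A.
Proof.
move=> Ak k1; have [[x Ax]|A0] := pselect (exists x, A x); last first.
  have -> : A = set0 by apply/seteqP; split=> // y Ay; apply: A0; exists y.
  exact: connected0.
suff -> : A = connected_component A x by exact: component_connected.
apply/seteqP; split=> [y Ay|]; last exact: connected_component_sub.
have -> : connected_component A x = connected_component A y.
  apply: contrapT => ne; have : (1 < k)%N.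
    by apply: (card_ge2 Ak _ _ ne); [exists x|exists y].
  by case: k k1 {Ak} => [|[|k]].
exact: connected_component_refl.
Qed.

End CardTools.

Section Counting.
Variables (R : realType) (n : nat).
Notation plane := (R * R)%type.
Notation C := (clustered_stars n).
Variable D : predrawing R C.
Hypothesis drawD : clustered_drawing D.
Notation reg i := (region D (Some i : cnode C)).

Lemma good_pairC i j : good_pair D i j -> good_pair D j i.
Proof.
case=> g1 g2 g3 g4; split=> //; last by case: g4; [right|left].
by move=> s s'; rewrite setIC.
Qed.

Lemma connected_frontier (A X : set plane) x y : closed A -> connected X -> X x -> X y ->
  A° x -> ~ A y -> exists2 z, X z & frontier A z.
Proof.
move=> clA cX Xx Xy Ox nAy; apply: contrapT => nofr; apply: nAy; apply: (@interior_subset _ A).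
apply: (@connected_clopen _ X (A°) x y) => // z Xz.
  by move=> Oz; apply: filterS (open_nbhs_nbhs (conj (@open_interior _ A) Oz)).
move=> nOz; have nAz : (~` A) z.
  by move=> Az; apply: nofr; exists z => //; split=> //; exact: subset_closure.
apply: filterS (open_nbhs_nbhs (conj (closed_openC clA) nAz)) => w nAw _.
by move=> /interior_subset.
Qed.

(** Both ends of the edge lie outside the region, so the curve meets the boundary once before and
    once after it is in the interior. This makes the edge-region term at least 1. *)
Lemma edge_region_ge2 s i j k : j != i -> (ecurve D (sedge s i) `&` frontier (reg j)) #= `I_k ->
  ecurve D (sedge s i) `&` (reg j)° !=set0 -> (1 < k)%N.
Proof.
move=> ji hk [x [ex Ox]].
have [f [cf finj f0 f1 fE]] := edge_closed_curve drawD s i.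
have clR : closed (reg j).
  by case: drawD => _ /(_ (Some j))[cR _ _ _] _ _ _; exact: (compact_closed (@plane_hausdorff R)).
move: ex; rewrite fE => -[t /=]; rewrite in_itv /= => /andP[t0 t1] ftx.
have sub (a b : R) : 0 <= a -> b <= 1 -> `[a, b] `<=` `[0, 1].
  by move=> a0 b1 r /=; rewrite !in_itv /= => /andP[? ?]; apply/andP; split; lra.
have piece (a b : R) : 0 <= a -> b <= 1 -> connected (f @` `[a, b]).
  move=> a0 b1; apply: connected_continuous_connected (@segment_connected _ _ _) _.
  exact: continuous_subspaceW (sub _ _ a0 b1) cf.
have nofr v : ~ frontier (reg j) (pos D v) by case: drawD => _ _ /(_ (Some j) v)[].
have [z1 [r1 /= + rz1] fr1] : exists2 z, (f @` `[0, t]) z & frontier (reg j) z.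
  apply: (connected_frontier (x := f t) (y := f 0) clR (piece _ _ (lexx _) (ltW t1))).
  - by exists t; rewrite //= in_itv /= lexx ltW.
  - by exists 0; rewrite //= in_itv /= lexx ltW.
  - by rewrite ftx.
  - by rewrite f0; exact: drawing_leaf_out.
have [z2 [r2 /= + rz2] fr2] : exists2 z, (f @` `[t, 1]) z & frontier (reg j) z.
  apply: (connected_frontier (x := f t) (y := f 1) clR (piece _ _ (ltW t0) (lexx _))).
  - by exists t; rewrite //= in_itv /= lexx ltW.
  - by exists 1; rewrite //= in_itv /= lexx ltW.
  - by rewrite ftx.
  - by rewrite f1; exact: drawing_hub_out.
rewrite !in_itv /= => /andP[tr2 r21] /andP[r10 r1t].
have nt : ~ frontier (reg j) (f t) by rewrite ftx; case=> _; apply.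
have r1n0 : r1 != 0 by apply/eqP => e; apply: (nofr (s, Some i)); rewrite -f0 -e rz1.
have r2n1 : r2 != 1 by apply/eqP => e; apply: (nofr (s, None)); rewrite -f1 -e rz2.
have r1nt : r1 != t by apply/eqP => e; apply: nt; rewrite -e rz1.
have lt1 : r1 < t by rewrite lt_neqAle r1nt.
have gt1 : 0 < r1 by rewrite lt_neqAle eq_sym r1n0.
have lt2 : r2 < 1 by rewrite lt_neqAle r2n1.
apply: (card_ge2 (x := z1) (y := z2) hk).
- by split=> //; rewrite fE; exists r1 => //=; rewrite in_itv /=; apply/andP; split; lra.
- by split=> //; rewrite fE; exists r2 => //=; rewrite in_itv /=; apply/andP; split; lra.
- rewrite -rz1 -rz2 => /finj; rewrite !in_itv /= => H.
  have : r1 = r2 by apply: H; apply/andP; split; lra.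
  lra.
Qed.

Definition crossing_pair i j :=
  exists z s s', ecurve D (sedge s i) z /\ ecurve D (sedge s' j) z.

(** A crossing point determines its pair of clusters, as no three edges share a point; [P] selects
    at most one order of each pair. *)
Lemma crossing_pairs_card (a : nat) (P : rel 'I_n) : edge_edge_crossings D a ->
    (forall i j, P i j -> ~~ P j i) ->
  (#|[set ij : 'I_n * 'I_n | P ij.1 ij.2 & `[< crossing_pair ij.1 ij.2 >]]| <= a)%N.
Proof.
move=> /card_eq_inj[f [fa finj]] asymP; set S := [set ij | _]%SET.
have neqP i j : P i j -> i != j.
  by apply: contraTneq => ->; apply/negP => Pjj; move: (asymP _ _ Pjj); rewrite Pjj.
have [g gP] : exists g : 'I_n * 'I_n -> plane, forall ij, ij \in S ->
    exists s s', ecurve D (sedge s ij.1) (g ij) /\ ecurve D (sedge s' ij.2) (g ij).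
  suff /choice[g gP] : forall ij : 'I_n * 'I_n, exists z, ij \in S ->
      exists s s', ecurve D (sedge s ij.1) z /\ ecurve D (sedge s' ij.2) z by exists g.
  move=> ij; case: (boolP (ij \in S)) => [|_]; last by exists (0, 0).
  by rewrite inE => /andP[_ /asboolP[z H]]; exists z.
have gin ij : ij \in S -> [set p | exists e f0, [/\ e \in edges (ugraph C), f0 \in edges (ugraph C),
    e != f0, ecurve D e p & ecurve D f0 p]] (g ij).
  move=> ijS; have [s [s' [e1 e2]]] := gP _ ijS; exists (sedge s ij.1), (sedge s' ij.2); split=> //.
  - by apply/edgesP; exists s, ij.1.
  - by apply/edgesP; exists s', ij.2.
  - move: ijS; rewrite inE => /andP[/neqP ne _]; apply: contra ne => /eqP/sedge_inj[_ ->].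
    by [].
have fgin : {in S &, injective (fun ij => f (g ij))}.
  move=> [i j] [i' j'] ijS ijS' /finj; move/(_ (gin _ ijS) (gin _ ijS')) => gE.
  have [s [s' [e1 e2]]] := gP _ ijS; have [t [t' [e3 e4]]] := gP _ ijS'.
  rewrite -gE /= in e1 e2 e3 e4; move: (g (i, j)) e1 e2 e3 e4 => p e1 e2 e3 e4.
  have three k x : k != i -> k != j -> i != j -> ecurve D (sedge x k) p -> False.
    move=> ki kj ij ek; case: drawD => _ _ _ _ [_ noT].
    have isE y l : is_curve (C := C) (inl (sedge y l)) by apply/edgesP; exists y, l.
    have neE y l y' l' : l != l' -> (inl (sedge y l) : {set ugraph C} + cnode C) != inl (sedge y' l').
      by apply: contra => /eqP[] /sedge_inj[_ ->].
    have := noT _ _ _ (isE s i) (isE s' j) (isE x k) (neE s i s' j ij) (neE s' j x k _) (neE s i x k _).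
    rewrite ![_ == k]eq_sym => /(_ kj ki) T0.
    by have : set0 p by rewrite -T0.
  move: ijS ijS'; rewrite !inE /= => /andP[Pij _] /andP[Pij' _].
  have ij := neqP _ _ Pij; have ij' := neqP _ _ Pij'.
  have [i'i|ni'i] := eqVneq i' i.
    have [j'j|nj'j] := eqVneq j' j; first by rewrite i'i j'j.
    by case: (three j' t') => //; rewrite -i'i eq_sym.
  have [i'j|ni'j] := eqVneq i' j; last by case: (three i' t).
  have [j'i|nj'i] := eqVneq j' i; last first.
    by case: (three j' t') => //; rewrite -i'j eq_sym.
  by move: (asymP _ _ Pij); rewrite -i'j -j'i Pij'.
have fga ij : ij \in S -> (f (g ij) < a)%N by move=> /gin /fa.
case: a fa fga => [|a] fa fga.
  have -> : S = finset.set0; last by rewrite cards0.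
  by apply/setP => ij; rewrite !inE; apply/negP => ijS; have := fga ij; rewrite !inE ijS => /(_ isT).
have inj : {in S &, injective (fun ij => inord (f (g ij)) : 'I_a.+1)}.
  move=> x y xS yS /(congr1 val) /=; rewrite !inordK ?fga //; exact: fgin.
by rewrite -(card_in_imset inj) -[X in (_ <= X)%N]card_ord max_card.
Qed.

End Counting.

(** * The quadratic lower bound *)

Section LowerBound.
Variables (R : realType) (n : nat).
Notation C := (clustered_stars n).
Variable D : predrawing R C.
Notation reg i := (region D (Some i : cnode C)).

Lemma big_option_ge (F : option 'I_n -> nat) : (\sum_(i < n) F (Some i) <= \sum_mu F mu)%N.
Proof.
rewrite [X in (_ <= X)%N](bigD1 None) //= (reindex_omap Some id) /=; last by case.
apply: leq_trans (leq_addl _ _); rewrite leq_eqVlt; apply/orP; left.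
by apply/eqP/eq_bigl => i; rewrite eqxx.
Qed.

Lemma sum_sedge (F : {set stars n} -> nat) :
  (\sum_(s < 3) \sum_(i < n) F (sedge s i) = \sum_(e in edges (stars n)) F e)%N.
Proof.
rewrite pair_bigA /=.
have -> : edges (stars n) = [set sedge si.1 si.2 | si in [set: 'I_3 * 'I_n]]%SET.
  apply/setP => e; apply/edgesP/imsetP => [[s [i ->]]|[[s i] _ ->]]; last by exists s, i.
  by exists (s, i).
rewrite big_imset /=; first by apply: eq_bigl => x; rewrite inE.
by move=> [s i] [s' i'] _ _ /sedge_inj[/= -> ->].
Qed.

(* Every triple of clusters contains a bad pair; summing over all ordered
   triples, with each pair (i, i) declared bad, gives n^3 <= 3 n (2 B + n) for the
   number B of unordered bad pairs. *)
Lemma triple_count (bad : 'I_n -> 'I_n -> nat) (t : nat) :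
    (forall i j k, 1 <= bad i j + bad j k + bad i k)%N ->
    (\sum_(i < n) \sum_(j < n) bad i j <= 2 * t + n)%N ->
  (n ^ 2 <= 3 * (2 * t + n))%N.
Proof.
move=> tri le; case: (posnP n) => [->//|n0].
rewrite -(leq_pmul2l n0) -expnS.
apply: (@leq_trans (\sum_(i < n) \sum_(j < n) \sum_(k < n) (bad i j + bad j k + bad i k))).
  apply: (@leq_trans (\sum_(i < n) \sum_(j < n) \sum_(k < n) 1)).
    by rewrite !sum_nat_const !card_ord muln1 !expnS expn0 muln1.
  by do 3 (apply: leq_sum => ? _); exact: tri.
under eq_bigr do under eq_bigr do rewrite 2!big_split /=.
under eq_bigr do rewrite 2!big_split /=.
rewrite 2!big_split /=.
have e1 : (\sum_(i < n) \sum_(j < n) \sum_(k < n) bad i j = n * \sum_(i < n) \sum_(j < n) bad i j)%N.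
  rewrite big_distrr; apply: eq_bigr => i _; rewrite big_distrr; apply: eq_bigr => j _ /=.
  by rewrite sum_nat_const card_ord.
have e2 : (\sum_(i < n) \sum_(j < n) \sum_(k < n) bad j k = n * \sum_(i < n) \sum_(j < n) bad i j)%N.
  by rewrite sum_nat_const card_ord.
have e3 : (\sum_(i < n) \sum_(j < n) \sum_(k < n) bad i k = n * \sum_(i < n) \sum_(j < n) bad i j)%N.
  rewrite big_distrr; apply: eq_bigr => i _ /=.
  by rewrite sum_nat_const card_ord.
rewrite e1 e2 e3 -!mulnDr leq_pmul2l //.
by apply: leq_trans (leq_mul (leqnn 3) le); rewrite !mulSn mul0n addn0 addnA.
Qed.

(** A bad pair of distinct clusters is charged to an edge crossing ([X]), to an edge entering a
    region ([Y]) or to a region crossing ([Z]). Sums run over ordered pairs, so each of a, b and c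
    is used twice, and the pairs (i, i) add n. *)
Lemma stars_lower_bound (a b c : nat) : abc_drawing D a b c -> (n ^ 2 <= 3 * (2 * (a + b + c) + n))%N.
Proof.
move=> [drawD ea [kb kbP ->] [kc kcP ->]].
pose bad i j : nat := ~~ `[< i != j /\ good_pair D i j >].
apply: (@triple_count bad).
  move=> i j k; rewrite lt0n !addn_eq0; apply/negP.
  rewrite /bad !eqb0 !negbK => /andP[/andP[/asboolP[ij gij] /asboolP[jk gjk]] /asboolP[ik gik]].
  apply: (good_triple_false drawD (c := fun x : 'I_3 => nth i [:: i; j; k] x)).
    move=> x y /eqP; rewrite nth_uniq //= ?inE ?negb_or ?ij ?ik ?jk //.
    by move=> /eqP; exact: val_inj.
  case=> [[|[|[|//]]] x3] [[|[|[|//]]] y3] //= _ //; exact: good_pairC.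
(* [r] is the order in which region-region crossings are counted. For distinct i and j exactly one
   of [r i j] and [r j i] holds, so the symmetric [X] is charged once in [bad_le]. *)
pose r (i j : 'I_n) := (enum_rank (Some i : cnode C) < enum_rank (Some j : cnode C))%N.
pose X (i j : 'I_n) : nat := `[< crossing_pair D i j >].
pose Y (i j : 'I_n) := (\sum_(s < 3) (kb (sedge s i) (Some j))./2)%N.
pose Z (i j : 'I_n) := (if r i j then (kc (Some i) (Some j)).-1 else 0)%N.
have rtot i j : i != j -> r i j || r j i.
  move=> ij; rewrite /r; case: ltngtP => // /val_inj/enum_rank_inj [] e; by rewrite e eqxx in ij.
have rasym i j : r i j -> ~~ r j i by rewrite /r -leqNgt => /ltnW.
have bad_le i j : i != j -> (bad i j <= (r i j * X i j + r j i * X i j) + (Y i j + Y j i) + (Z i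
  j + Z j i))%N.
  move=> ij; rewrite /bad; case: asboolP => //= ngood; rewrite lt0n; apply/negP.
  rewrite !addn_eq0 => /andP[/andP[/andP[X1 X2] /andP[Y1 Y2]] /andP[Z1 Z2]].
  apply: ngood; split=> //.
  have noX : ~ crossing_pair D i j.
    move=> H; move: (rtot i j ij) X1 X2; rewrite /X; case: asboolP => // _; rewrite !muln1 !eqb0.
    by move=> /orP[] -> //; rewrite andbF.
  have noY u v : u != v -> Y u v == 0%N -> forall s, ecurve D (sedge s u) `&` (reg v)° = set0.
    move=> uv /eqP Y0 s; apply: contrapT => /eqP/set0P ne.
    have eE : sedge s u \in edges (ugraph C) by apply/edgesP; exists s, u.
    have vu : v != u by rewrite eq_sym.
    have := edge_region_ge2 drawD vu (kbP _ (Some v) eE) ne.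
    move/eqP: Y0; rewrite /Y sum_nat_eq0 => /forall_inP/(_ s isT).
    by case: (kb _ _) => [|[|?]].
  have noZ u v : u != v -> r u v -> Z u v == 0%N -> connected (reg u `\` reg v).
    move=> uv ruv; rewrite /Z ruv => /eqP; apply: components_connected.
    apply: kcP; rewrite stars_incomparable /= andbT.
    by apply: contra uv => /eqP[->].
  split.
  - move=> s s'; apply/seteqP; split=> // z [e1 e2]; apply: noX; by exists z, s, s'.
  - exact: noY.
  - by apply: noY; rewrite // eq_sym.
  - by case/orP: (rtot i j ij) => rr; [left|right]; apply: noZ => //; rewrite eq_sym.
have bad_ii i : bad i i = 1%N by rewrite /bad; case: asboolP => // -[]; rewrite eqxx.
apply: (@leq_trans (\sum_(i < n) (\sum_(j < n) ((r i j * X i j + r j i * X i j) + (Y i j + Y j i)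
  + (Z i j + Z j i)) + 1))).
  apply: leq_sum => i _; rewrite (bigD1 i) //= bad_ii addnC leq_add2r.
  apply: (@leq_trans (\sum_(j < n | j != i) ((r i j * X i j + r j i * X i j) + (Y i j + Y j i) +
    (Z i j + Z j i)))).
    by apply: leq_sum => j ji; apply: bad_le; rewrite eq_sym.
  by rewrite [X in (_ <= X)%N](bigD1 i) //= leq_addl.
rewrite big_split /= sum_nat_const card_ord muln1 leq_add2r.
have XA (P : rel 'I_n) : (forall i j, P i j -> ~~ P j i) -> (\sum_(i < n) \sum_(j < n) P i j * X
  i j <= a)%N.
  move=> asymP; apply: leq_trans (crossing_pairs_card drawD ea asymP).
  rewrite pair_bigA -sum1_card [X in (_ <= X)%N]big_mkcond /=; apply: leq_sum => -[i j] _ /=.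
  by rewrite inE /= /X; case: (P i j); case: asboolP.
have YB : (\sum_(i < n) \sum_(j < n) Y i j <= \sum_(e in edges (ugraph C)) \sum_mu (kb e mu)./2)%N.
  rewrite -sum_sedge /Y; under eq_bigr do rewrite exchange_big /=.
  rewrite exchange_big /=.
  apply: leq_sum => s _; apply: leq_sum => i _.
  exact: (big_option_ge (fun mu => (kb (sedge s i) mu)./2)).
have ZC : (\sum_(i < n) \sum_(j < n) Z i j <= \sum_(mu : cnode C) \sum_(nu : cnode C |
  incomparable mu nu && (enum_rank mu < enum_rank nu)) (kc mu nu).-1)%N.
  apply: leq_trans (big_option_ge (fun mu : cnode C => \sum_(nu : cnode C | incomparable mu nu &&
    (enum_rank mu < enum_rank nu)) (kc mu nu).-1)%N).
  apply: leq_sum => i _; rewrite [X in (_ <= X)%N]big_mkcond /=.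
  apply: leq_trans (big_option_ge (fun nu : cnode C => if incomparable (Some i : cnode C) nu &&
    (enum_rank (Some i : cnode C) < enum_rank nu) then (kc (Some i) nu).-1 else 0)%N).
  apply: leq_sum => j _; rewrite /Z; case: ifP => // rij.
  rewrite stars_incomparable /= andbT; have ij : i != j by apply: contraTneq rij => ->; rewrite /r ltnn.
  have -> : (Some i != Some j :> cnode C) by apply: contra ij => /eqP[->].
  by rewrite -/(r i j) rij.
under eq_bigr do rewrite 5!big_split /=.
rewrite 5!big_split /=.
rewrite [X in (_ + (_ + X))%N]exchange_big /= [X in (_ + (_ + X) + _)%N]exchange_big /=.
have X1 := XA r rasym.
have X2 := XA (fun i j => r j i) (fun i j => rasym j i).
apply: leq_trans (leq_add (leq_add (leq_add X1 X2) (leq_add YB YB)) (leq_add ZC ZC)) _.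
by rewrite !addnn -!doubleD mul2n.
Qed.

End LowerBound.

(** * Segments and parallelograms *)

Section Affine.
Variable R : realType.
Notation plane := (R * R)%type.
Implicit Types (x y z w : plane) (A B : set plane).

Definition aff (a b c : R) z : R := a * z.1 + b * z.2 + c.

Lemma aff_continuous a b c : continuous (aff a b c).
Proof.
move=> z; apply: cvgD; last exact: cvg_cst.
by apply: cvgD; apply: cvgM; try exact: cvg_cst; [exact: cvg_fst|exact: cvg_snd].
Qed.

Lemma aff2_continuous a b c a' b' c' :
  continuous (fun z => (aff a b c z, aff a' b' c' z) : plane).
Proof. by move=> z; exact: (cvg_pair (@aff_continuous a b c z) (@aff_continuous a' b' c' z)). Qed.

Lemma open_aff_lt a b c (k : R) : open [set z | aff a b c z < k].
Proof.
have -> : [set z | aff a b c z < k] = aff a b c @^-1` [set r | r < k] by [].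
by apply: open_comp; [move=> z _; exact: aff_continuous|exact: open_lt].
Qed.

Lemma open_aff_gt a b c (k : R) : open [set z | k < aff a b c z].
Proof.
have -> : [set z | k < aff a b c z] = aff a b c @^-1` [set r | k < r] by [].
by apply: open_comp; [move=> z _; exact: aff_continuous|exact: open_gt].
Qed.

Lemma convex_connected A : (forall x y, A x -> A y -> seg x y `<=` A) -> connected A.
Proof.
move=> cvx; have [[x Ax]|A0] := pselect (exists x, A x); last first.
  have -> : A = set0 by apply/seteqP; split=> // y Ay; apply: A0; exists y.
  exact: connected0.
have -> : A = \bigcup_(y in A) seg x y.
  apply/seteqP; split=> [y Ay|z [y Ay]]; first by exists y => //; exact: seg_right.
  exact: cvx.
apply: bigcup_connected; last by move=> y _; exact: seg_connected.
by exists x => y _; exact: seg_left.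
Qed.

Definition loc_line A z (a b : R) := exists U : set plane,
  [/\ open U, U z & forall w, U w -> (A w <-> a * (w.1 - z.1) + b * (w.2 - z.2) = 0)].

(** The two linear equations themselves serve as local coordinates; the nonzero determinant gives
    the inverse by Cramer's rule. *)
Lemma loc_line_alternate A B z a b a' b' : loc_line A z a b -> loc_line B z a' b' ->
  a * b' - a' * b != 0 -> alternate_at A B z.
Proof.
move=> [U [oU Uz UA]] [U' [oU' U'z U'B]] det.
pose h w : plane := (aff a' b' (- (a' * z.1 + b' * z.2)) w, aff a b (- (a * z.1 + b * z.2)) w).
pose k := (a * b' - a' * b)^-1.
pose g w : plane := (aff (- b * k) (b' * k) z.1 w, aff (a * k) (- a' * k) z.2 w).
have gh w : g (h w) = w.
  by rewrite /g /h /aff /= [w]surjective_pairing /= /k; congr pair; field.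
have hg w : h (g w) = w.
  by rewrite /g /h /aff /= [w]surjective_pairing /= /k; congr pair; field.
exists (U `&` U'), (g @^-1` (U `&` U')), h, g; split.
- split; first exact: openI.
  + apply: open_comp; last exact: openI.
    by move=> w _; exact: aff2_continuous.
  + by split.
  + by rewrite /h /aff; congr pair; ring.
- apply/seteqP; split=> [w [v Uv <-]|w Uw]; first by rewrite /preimage /= gh.
  by exists (g w); rewrite ?hg.
- by move=> w _; exact: gh.
- by split; apply: continuous_subspaceT => w; exact: aff2_continuous.
- move=> w [/UA wA /U'B wB]; split.
  + by rewrite wA /h /aff /=; split=> H; rewrite -[RHS]H; ring.
  + by rewrite wB /h /aff /=; split=> H; rewrite -[RHS]H; ring.
Qed.

Definition oseg x y : set plane := segpt x y @` `]0, 1[.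

Lemma osegP x y z : oseg x y z <-> exists t : R, [/\ 0 < t, t < 1 & z = segpt x y t].
Proof.
split=> [[t /=]|[t [t0 t1 ->]]]; last by exists t; rewrite //= in_itv /= t0.
by rewrite in_itv /= => /andP[t0 t1] <-; exists t.
Qed.

Lemma oseg_sym x y : oseg x y = oseg y x.
Proof.
wlog suff : x y / oseg x y `<=` oseg y x by move=> H; apply/seteqP; split; exact: H.
move=> z /osegP[t [t0 t1 ->]]; apply/osegP; exists (1 - t); split; [lra|lra|].
by rewrite /segpt; congr pair; ring.
Qed.

Lemma segpt_inj x y : x <> y -> injective (segpt x y).
Proof.
move=> xy s t [/addrI e1 /addrI e2].
have [n1|n1] := eqVneq (y.1 - x.1) 0; last exact: (mulIf n1).
have [n2|n2] := eqVneq (y.2 - x.2) 0; last exact: (mulIf n2).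
case: xy; rewrite [x]surjective_pairing [y]surjective_pairing; congr pair; apply/eqP.
  by rewrite eq_sym -subr_eq0 n1.
by rewrite eq_sym -subr_eq0 n2.
Qed.

Lemma oseg_open_arc x y : x <> y -> open_arc (oseg x y) x y.
Proof.
move=> xy; exists (segpt x y); split=> //.
- exact/continuous_subspaceT/segpt_continuous.
- by move=> s t _ _; exact: segpt_inj.
- exact: segpt0.
- exact: segpt1.
Qed.

Lemma oseg_loc_line x y z : x <> y -> oseg x y z ->
  loc_line (oseg x y) z (- (y.2 - x.2)) (y.1 - x.1).
Proof.
move=> xy /osegP[t [t0 t1 zE]].
pose d1 := y.1 - x.1; pose d2 := y.2 - x.2; pose N := d1 ^+ 2 + d2 ^+ 2.
have N0 : 0 < N.
  have : 0 <= N by rewrite addr_ge0 ?sqr_ge0.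
  rewrite le_eqVlt => /predU1P[/esym/eqP|//]; rewrite paddr_eq0 ?sqr_ge0 // !sqrf_eq0 !subr_eq0.
  move=> /andP[/eqP e1 /eqP e2]; case: xy.
  by rewrite [x]surjective_pairing [y]surjective_pairing e1 e2.
pose f := aff d1 d2 (- (d1 * x.1 + d2 * x.2)).
have fs s : f (segpt x y s) = s * N by rewrite /f /aff /segpt /N /d1 /d2 /=; ring.
(* f is N times the parameter of the orthogonal projection to the line. In the strip where this
   parameter is between 0 and 1, the line and the open segment coincide. *)
exists ([set w | 0 < f w] `&` [set w | f w < N]); split.
- by apply: openI; [exact: open_aff_gt|exact: open_aff_lt].
- by split; rewrite /= zE fs; [rewrite mulr_gt0|rewrite gtr_pMl].
- move=> w [/= f0 f1]; rewrite -/d1 -/d2; split.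
    by move=> /osegP[s [_ _ ->]]; rewrite zE /segpt /= -/d1 -/d2; ring.
  move=> lin; apply/osegP; exists (f w / N); split.
  + by rewrite divr_gt0.
  + by rewrite ltr_pdivrMr // mul1r.
  + have lin0 : d1 * (w.2 - x.2) = d2 * (w.1 - x.1).
      apply/eqP; rewrite -subr_eq0 -lin zE /segpt /= -/d1 -/d2; apply/eqP; ring.
    rewrite [w]surjective_pairing /segpt /= -/d1 -/d2; congr pair.
    * have -> : f w / N * d1 = w.1 - x.1; last by ring.
      apply: (mulIf (lt0r_neq0 N0)); rewrite mulrAC divfK ?lt0r_neq0 //.
      have -> : f w * d1 = d1 * d1 * (w.1 - x.1) + d2 * (d1 * (w.2 - x.2)) by rewrite /f /aff; ring.
      by rewrite lin0 /N; ring.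
    * have -> : f w / N * d2 = w.2 - x.2; last by ring.
      apply: (mulIf (lt0r_neq0 N0)); rewrite mulrAC divfK ?lt0r_neq0 //.
      have -> : f w * d2 = d2 * d2 * (w.2 - x.2) + d1 * (d2 * (w.1 - x.1)) by rewrite /f /aff; ring.
      by rewrite -lin0 /N; ring.
Qed.

End Affine.

Section Para.
Variable R : realType.
Notation plane := (R * R)%type.
Implicit Types (x y z w : plane) (M p q d : R).

Definition off p q z : R := z.2 - p * z.1 - q.

(** A parallelogram with two vertical sides around the line of slope p and intercept q; [skew] maps
    the square with corners (1, 1) and (-1, -1) onto it. *)
Definition para M p q d : set plane := [set z | `|z.1| <= M /\ `|off p q z| <= d].

Definition skew M p q d z : plane := (M * z.1, d * z.2 + p * (M * z.1) + q).

Lemma skew_continuous M p q d : continuous (skew M p q d).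
Proof.
have -> : skew M p q d = (fun z => (aff M 0 0 z, aff (p * M) d q z)).
  by apply/funext => z; rewrite /skew /aff; congr pair; ring.
exact: aff2_continuous.
Qed.

Variables (M p q d : R).
Hypotheses (M0 : 0 < M) (d0 : 0 < d).

Let unskew z : plane := (z.1 / M, off p q z / d).

Lemma unskewK z : skew M p q d (unskew z) = z.
Proof.
by rewrite [z]surjective_pairing /skew /unskew /off /=; congr pair; field; rewrite ?lt0r_neq0.
Qed.

Lemma skewK z : unskew (skew M p q d z) = z.
Proof.
by rewrite [z]surjective_pairing /skew /unskew /off /=; congr pair; field; rewrite ?lt0r_neq0.
Qed.

Lemma off_skew z : off p q (skew M p q d z) = d * z.2.
Proof. by rewrite /off /skew /=; ring. Qed.

Lemma norm_pmul_le (k r : R) : 0 < k -> (`|k * r| <= k) = (`|r| <= 1).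
Proof. by move=> k0; rewrite normrM gtr0_norm // ger_pMr. Qed.


Lemma norm_pmul_eq (k r : R) : 0 < k -> (`|k * r| = k) = (`|r| = 1).
Proof.
move=> k0; apply/propext; rewrite normrM gtr0_norm //; split=> [e|->]; last by rewrite mulr1.
by apply: (mulfI (lt0r_neq0 k0)); rewrite mulr1.
Qed.

Lemma in_para_skew w : para M p q d (skew M p q d w) <-> `|w.1| <= 1 /\ `|w.2| <= 1.
Proof. by rewrite /para /= off_skew norm_pmul_le // norm_pmul_le. Qed.

Lemma para_compact : compact (para M p q d).
Proof.
have -> : para M p q d = skew M p q d @` (`[-1, 1] `*` `[-1, 1]).
  apply/seteqP; split=> [z|_ [w [/= w1 w2] <-]].
    rewrite -(unskewK z) => /in_para_skew; rewrite !ler_norml => -[h1 h2].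
    by exists (unskew z) => //; split; rewrite /= in_itv.
  by apply/in_para_skew; rewrite !ler_norml; move: w1 w2; rewrite !in_itv.
apply: continuous_compact; first exact/continuous_subspaceT/skew_continuous.
by apply: compact_setX; exact: segment_compact.
Qed.

Lemma para_interior z : (para M p q d)° z <-> `|z.1| < M /\ `|off p q z| < d.
Proof.
have offE w : off p q w = aff (- p) 1 (- q) w by rewrite /off /aff; ring.
have fstE w : w.1 = aff 1 0 0 w by rewrite /aff; ring.
split=> [/nbhs_ballP[e /= e0 eP]|[z1 z2]].
  have e20 : 0 < e / 2 by rewrite divr_gt0.
  have e2 : `|e / 2| < e by rewrite gtr0_norm // ltr_pdivrMr // ltr_pMr // ltr1n.
  have pt (a b : R) : `|a| < e -> `|b| < e ->
      `|z.1 + a| <= M /\ `|off p q z + b - p * a| <= d.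
    move=> ae be; have [] : para M p q d (z.1 + a, z.2 + b).
      by apply: eP; apply/ball_plane; split; rewrite /= opprD addNKr normrN.
    by rewrite /off /= => h1 h2; split=> //; apply: le_trans h2; rewrite le_eqVlt; apply/orP;
      left; apply/eqP; congr (`|_|); ring.
  have e00 : `|0 : R| < e by rewrite normr0.
  have e2N : `|- (e / 2)| < e by rewrite normrN.
  have [p1 _] := pt _ _ e2 e00; have [p2 _] := pt _ _ e2N e00.
  have [_ p3] := pt _ _ e00 e2; have [_ p4] := pt _ _ e00 e2N.
  move: p1 p2 p3 p4; rewrite !mulr0 !subr0 !ler_norml !ltr_norml.
  by move=> /andP[? ?] /andP[? ?] /andP[? ?] /andP[? ?]; split; apply/andP; split; lra.
pose U := ([set w | - M < aff 1 0 0 w] `&` [set w | aff 1 0 0 w < M]) `&`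
  ([set w | - d < aff (- p) 1 (- q) w] `&` [set w | aff (- p) 1 (- q) w < d]).
have oU : open U by apply: openI; apply: openI; try exact: open_aff_gt; exact: open_aff_lt.
have Uz : U z by rewrite /U /= -fstE -offE; move: z1 z2; rewrite !ltr_norml => /andP[] ? ? /andP[].
apply: filterS (open_nbhs_nbhs (conj oU Uz)) => w; rewrite /U /= -fstE -offE => -[[? ?] [? ?]].
by split; rewrite ler_norml !ltW.
Qed.

Lemma para_closed : closed (para M p q d).
Proof. exact: (compact_closed (@plane_hausdorff R) para_compact). Qed.

Lemma para_frontier z : frontier (para M p q d) z <->
  [/\ `|z.1| <= M, `|off p q z| <= d & `|z.1| = M \/ `|off p q z| = d].
Proof.
rewrite /frontier -(closure_id _).1; last exact: para_closed.
split=> [[[z1 z2] nint]|[z1 z2 z12]].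
  split=> //; move: z1 z2; rewrite !le_eqVlt => /predU1P[?|h1]; first by left.
  by move=> /predU1P[?|h2]; [right|case: nint; apply/para_interior].
by split=> // /para_interior[]; case: z12 => ->; rewrite ltxx.
Qed.

Lemma seg_norm_aff (a b c k : R) x y z : seg x y z ->
  (`|aff a b c x| < k -> `|aff a b c y| < k -> `|aff a b c z| < k).
Proof.
move=> [t /=]; rewrite in_itv /= => /andP[t0 t1] <-.
have -> : aff a b c (segpt x y t) = (1 - t) * aff a b c x + t * aff a b c y.
  by rewrite /aff /segpt /=; ring.
move=> ax ay; have [->|tn1] := eqVneq t 1; first by rewrite subrr mul0r add0r mul1r.
have s0 : 0 < 1 - t by rewrite subr_gt0 lt_neqAle tn1.
apply: le_lt_trans (ler_normD _ _) _; rewrite !normrM (gtr0_norm s0) (ger0_norm t0).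
have -> : k = (1 - t) * k + t * k by ring.
by apply: ltr_leD; [rewrite ltr_pM2l|rewrite ler_wpM2l // ltW].
Qed.

Definition clamp (r : R) := (`|r + 1| - `|r - 1|) / 2.

Lemma clamp_mid r : -1 <= r -> r <= 1 -> clamp r = r.
Proof. by move=> h1 h2; rewrite /clamp ger0_norm ?ler0_norm; lra. Qed.

Lemma clamp_hi r : 1 <= r -> clamp r = 1.
Proof. by move=> h1; rewrite /clamp !ger0_norm; lra. Qed.

Lemma clamp_lo r : r <= -1 -> clamp r = -1.
Proof. by move=> h1; rewrite /clamp !ler0_norm; lra. Qed.

(** The boundary of the square at speed 8, counterclockwise from (1, 0). Writing it with absolute
    values makes continuity immediate. The last summand of the ordinate vanishes up to t = 3 / 4 and
    then turns the descent into an ascent. *)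
Definition square_curve (t : R) : plane :=
  (clamp (`|8 * t - 4| - 2), clamp (2 - `|8 * t - 2| + (8 * t - 6 + `|8 * t - 6|))).

Lemma square_curve_val t : 0 <= t -> t <= 1 ->
  [\/ 8 * t <= 1 /\ square_curve t = (1, 8 * t),
      1 <= 8 * t <= 3 /\ square_curve t = (2 - 8 * t, 1),
      3 <= 8 * t <= 5 /\ square_curve t = (-1, 4 - 8 * t) |
      (5 <= 8 * t <= 7 /\ square_curve t = (8 * t - 6, -1)) \/
      (7 <= 8 * t /\ square_curve t = (1, 8 * t - 8))].
Proof.
move=> t0 t1; rewrite /square_curve.
have [h1|h1] := lerP (8 * t) 1; [constructor 1|].
  split=> //; have -> : `|8 * t - 4| = 4 - 8 * t by rewrite ler0_norm; lra.
  have -> : `|8 * t - 2| = 2 - 8 * t by rewrite ler0_norm; lra.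
  have -> : `|8 * t - 6| = 6 - 8 * t by rewrite ler0_norm; lra.
  by congr pair; [rewrite clamp_hi //; lra|rewrite clamp_mid; lra].
have [h2|h2] := lerP (8 * t) 3; [constructor 2|].
  split; first by apply/andP; split; lra.
  have -> : `|8 * t - 4| = 4 - 8 * t by rewrite ler0_norm; lra.
  have -> : `|8 * t - 6| = 6 - 8 * t by rewrite ler0_norm; lra.
  congr pair; first by rewrite clamp_mid; lra.
  by rewrite clamp_hi //; case: (ger0P (8 * t - 2)) => ?; lra.
have [h3|h3] := lerP (8 * t) 5; [constructor 3|].
  split; first by apply/andP; split; lra.
  have -> : `|8 * t - 2| = 8 * t - 2 by rewrite ger0_norm; lra.
  have -> : `|8 * t - 6| = 6 - 8 * t by rewrite ler0_norm; lra.
  congr pair; last by rewrite clamp_mid; lra.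
  by rewrite clamp_lo //; case: (ger0P (8 * t - 4)) => ?; lra.
constructor 4; have [h4|h4] := lerP (8 * t) 7; [left|right].
  split; first by apply/andP; split; lra.
  have -> : `|8 * t - 2| = 8 * t - 2 by rewrite ger0_norm; lra.
  have -> : `|8 * t - 4| = 8 * t - 4 by rewrite ger0_norm; lra.
  congr pair; first by rewrite clamp_mid; lra.
  by rewrite clamp_lo //; case: (ger0P (8 * t - 6)) => ?; lra.
split; first lra.
have -> : `|8 * t - 2| = 8 * t - 2 by rewrite ger0_norm; lra.
have -> : `|8 * t - 4| = 8 * t - 4 by rewrite ger0_norm; lra.
have -> : `|8 * t - 6| = 8 * t - 6 by rewrite ger0_norm; lra.
by congr pair; [rewrite clamp_hi //; lra|rewrite clamp_mid; lra].
Qed.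

Lemma square_curve_continuous : continuous square_curve.
Proof.
have cN (f : R -> R) : continuous f -> continuous (fun t => `|f t|).
  by move=> cf t; apply: cvg_norm; exact: cf.
have cD (f g : R -> R) : continuous f -> continuous g -> continuous (fun t => f t + g t).
  by move=> cf cg t; apply: cvgD; [exact: cf|exact: cg].
have cB (f g : R -> R) : continuous f -> continuous g -> continuous (fun t => f t - g t).
  by move=> cf cg t; apply: cvgB; [exact: cf|exact: cg].
have cM (f g : R -> R) : continuous f -> continuous g -> continuous (fun t => f t * g t).
  by move=> cf cg t; apply: cvgM; [exact: cf|exact: cg].
have cc (k : R) : continuous (fun _ : R => k) by move=> t; exact: cvg_cst.
have ci : continuous (fun t : R => t) by move=> t; exact: cvg_id.
have c8 (k : R) : continuous (fun t : R => 8 * t - k) by apply: (cB) => //; exact: (cM).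
have ccl (f : R -> R) : continuous f -> continuous (fun t => clamp (f t)).
  by move=> cf; apply: (cM) => //; apply: (cB); apply: (cN); [exact: (cD)|exact: (cB)].
have c1 : continuous (fun t : R => clamp (`|8 * t - 4| - 2)).
  by apply: (ccl); apply: (cB) => //; exact: (cN).
have c2 : continuous (fun t : R => clamp (2 - `|8 * t - 2| + (8 * t - 6 + `|8 * t - 6|))).
  apply: (ccl); apply: (cD); first by apply: (cB) => //; exact: (cN).
  by apply: (cD) => //; exact: (cN).
by move=> t; exact: (cvg_pair (c1 t) (c2 t)).
Qed.

Lemma square_curve_inj : {in `[0, 1[ &, injective square_curve}.
Proof.
move=> s t; rewrite !in_itv /= => /andP[s0 s1] /andP[t0 t1].
have [[? ->]|[/andP[? ?] ->]|[/andP[? ?] ->]|[[/andP[? ?] ->]|[? ->]]] := square_curve_val s0 (ltW s1);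
have [[? ->]|[/andP[? ?] ->]|[/andP[? ?] ->]|[[/andP[? ?] ->]|[? ->]]] := square_curve_val t0 (ltW t1);
  by move=> /pair_equal_spec[? ?]; lra.
Qed.

Lemma square_curve_image z : (square_curve @` `[0, 1]) z <->
  [/\ `|z.1| <= 1, `|z.2| <= 1 & `|z.1| = 1 \/ `|z.2| = 1].
Proof.
split=> [[t /=]|].
  rewrite in_itv /= => /andP[t0 t1] <-.
  have [[? ->]|[/andP[? ?] ->]|[/andP[? ?] ->]|[[/andP[? ?] ->]|[? ->]]] := square_curve_val t0 t1;
  rewrite /= ?normrN1 ?normr1 ?lexx !ler_norml; split=> //; try (by left); try (by right);
  by apply/andP; split; lra.
have at_ (t u v : R) : 0 <= t -> t <= 1 -> 8 * t <= 1 /\ (u, v) = (1, 8 * t) \/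
    1 <= 8 * t <= 3 /\ (u, v) = (2 - 8 * t, 1) \/
    3 <= 8 * t <= 5 /\ (u, v) = (-1, 4 - 8 * t) \/
    5 <= 8 * t <= 7 /\ (u, v) = (8 * t - 6, -1) \/
    7 <= 8 * t /\ (u, v) = (1, 8 * t - 8) -> (square_curve @` `[0, 1]) (u, v).
  move=> t0 t1 H; exists t; first by rewrite /= in_itv /= t0.
  have [[? ->]|[/andP[? ?] ->]|[/andP[? ?] ->]|[[/andP[? ?] ->]|[? ->]]] := square_curve_val t0 t1;
  case: H => [[? [-> ->]]|[[/andP[? ?] [-> ->]]|[[/andP[? ?] [-> ->]]|[[/andP[? ?] [-> ->]]|[?
    [-> ->]]]]]];
  by congr pair; lra.
case: z => u v /= []; rewrite !ler_norml => /andP[u1 u2] /andP[v1 v2].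
have nn (r : R) : `|r| = 1 -> r = 1 \/ r = -1.
  by have [r0|r0] := lerP 0 r; [rewrite ger0_norm|rewrite ltr0_norm] => // e; [left|right]; lra.
move=> [/nn[]|/nn[]] E.
- have [v0|v0] := lerP 0 v.
    apply: (at_ (v / 8)); [lra|lra|left]; split; first lra; by congr pair; lra.
  apply: (at_ ((v + 8) / 8)); [lra|lra|do 4 right]; split; first lra; by congr pair; lra.
- apply: (at_ ((4 - v) / 8)); [lra|lra|do 2 right; left]; split; first by apply/andP; split; lra.
  by congr pair; lra.
- apply: (at_ ((2 - u) / 8)); [lra|lra|right; left]; split; first by apply/andP; split; lra.
  by congr pair; lra.
- apply: (at_ ((u + 6) / 8)); [lra|lra|do 3 right; left]; split; first by apply/andP; split; lra.
  by congr pair; lra.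
Qed.

Lemma para_simple : simple_closed_region (para M p q d).
Proof.
have fstE w : w.1 = aff 1 0 0 w by rewrite /aff; ring.
have offE w : off p q w = aff (- p) 1 (- q) w by rewrite /off /aff; ring.
split; first exact: para_compact.
- exists (0, q); apply/para_interior; rewrite /off /= normr0 mulr0 subr0 subrr normr0.
  by split.
- apply: convex_connected => x y /para_interior[x1 x2] /para_interior[y1 y2] z xyz.
  apply/para_interior; move: x1 x2 y1 y2; rewrite !fstE !offE => x1 x2 y1 y2.
  by split; [exact: seg_norm_aff xyz x1 y1|exact: seg_norm_aff xyz x2 y2].
- exists (fun t => skew M p q d (square_curve t)); split.
  + apply: continuous_subspaceT => t.
    by apply: continuous_comp; [exact: square_curve_continuous|exact: skew_continuous].
  + move=> s t s1 t1 /(congr1 unskew); rewrite !skewK; exact: square_curve_inj.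
  + congr skew.
    have [[? ->]|[/andP[? ?] _]|[/andP[? ?] _]|[[/andP[? ?] _]|[? _]]] := square_curve_val (lexx
      0) ler01; [|exfalso; lra|exfalso; lra|exfalso; lra|exfalso; lra].
    have [[? _]|[/andP[? ?] _]|[/andP[? ?] _]|[[/andP[? ?] _]|[? ->]]] := square_curve_val ler01
      (lexx 1); [exfalso; lra|exfalso; lra|exfalso; lra|exfalso; lra|].
    by congr pair; lra.
  + have frE w : frontier (para M p q d) (skew M p q d w) <->
        [/\ `|w.1| <= 1, `|w.2| <= 1 & `|w.1| = 1 \/ `|w.2| = 1].
      by rewrite para_frontier off_skew /= !norm_pmul_le // !norm_pmul_eq.
    apply/seteqP; split=> [z|_ [t t1 <-]].
      rewrite -(unskewK z) => /frE /square_curve_image[t t1 tz].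
      by exists t => //; rewrite tz.
    by apply/frE/square_curve_image; exists t.
Qed.

(** The condition that the abscissa has the sign of z.1 isolates one of the two vertical sides; the
    bound on [off] cuts away the corners. *)
Lemma para_loc_line_side z : `|z.1| = M -> `|off p q z| < d -> loc_line (frontier (para M p q d)) z 1 0.
Proof.
move=> z1 z2.
have offE w : off p q w = aff (- p) 1 (- q) w by rewrite /off /aff; ring.
pose U := [set w | 0 < aff z.1 0 0 w] `&`
  ([set w | - d < aff (- p) 1 (- q) w] `&` [set w | aff (- p) 1 (- q) w < d]).
have zn0 : z.1 != 0 by rewrite -normr_gt0 z1.
exists U; split.
- by apply: openI; [exact: open_aff_gt|apply: openI; [exact: open_aff_gt|exact: open_aff_lt]].
- rewrite /U /= -offE; split; last by apply/andP; rewrite -ltr_norml.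
  by rewrite /aff mul0r !addr0 -expr2 exprn_even_gt0 ?zn0.
- move=> w [/= s [o1 o2]]; rewrite -offE in o1 o2; rewrite mul1r mul0r addr0.
  have o : `|off p q w| < d by rewrite ltr_norml o1.
  rewrite /aff mul0r !addr0 in s; split=> [/para_frontier[w1 _ [e|e]]|e].
  + move: s e z1; case: (lerP 0 z.1) => zs; case: (lerP 0 w.1) => ws s.
    * by rewrite !ger0_norm // => -> ->; rewrite subrr.
    * by move: s; rewrite ltNge mulr_ge0_le0 // ltW.
    * by move: s; rewrite ltNge mulr_le0_ge0 // ltW.
    * by rewrite !ltr0_norm //; lra.
  + by move: o; rewrite e ltxx.
  + apply/para_frontier; have -> : w.1 = z.1 by lra.
    by rewrite z1 lexx ltW //; split=> //; left.
Qed.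

Lemma para_loc_line_flat z : `|z.1| < M -> `|off p q z| = d -> loc_line (frontier (para M p q d))
  z (- p) 1.
Proof.
move=> z1 z2.
have offE w : off p q w = aff (- p) 1 (- q) w by rewrite /off /aff; ring.
have fstE w : w.1 = aff 1 0 0 w by rewrite /aff; ring.
pose o := off p q z.
have on0 : o != 0 by rewrite -normr_gt0 z2.
pose U := [set w | 0 < aff (o * - p) o (o * - q) w] `&`
  ([set w | - M < aff 1 0 0 w] `&` [set w | aff 1 0 0 w < M]).
have UE w : aff (o * - p) o (o * - q) w = o * off p q w by rewrite /off /aff; ring.
exists U; split.
- by apply: openI; [exact: open_aff_gt|apply: openI; [exact: open_aff_gt|exact: open_aff_lt]].
- rewrite /U /= -fstE; split; last by apply/andP; rewrite -ltr_norml.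
  by rewrite UE -/o -expr2 exprn_even_gt0 ?on0.
- move=> w [/= s [o1 o2]]; rewrite -fstE in o1 o2; rewrite UE in s.
  have w1 : `|w.1| < M by rewrite ltr_norml o1.
  have -> : (- p * (w.1 - z.1) + 1 * (w.2 - z.2) = 0) <-> (off p q w = o).
    by rewrite /o /off; split=> ?; lra.
  split=> [/para_frontier[_ w2 [e|e]]|e].
  + by move: w1; rewrite e ltxx.
  + rewrite -/o in z2; move: s e z2; case: (lerP 0 o) => zs; case: (lerP 0 (off p q w)) => ws s.
    * by rewrite !ger0_norm // => -> ->.
    * by move: s; rewrite ltNge mulr_ge0_le0 // ltW.
    * by move: s; rewrite ltNge mulr_le0_ge0 // ltW.
    * by rewrite !ltr0_norm //; lra.
  + apply/para_frontier; rewrite e -/o in z2 *.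
    by rewrite z2 lexx ltW //; split=> //; right.
Qed.

End Para.

(** * Straight-line drawings *)

Section CrossingNumbers.
Variables (R : realType) (C : clustered_graph) (D : predrawing R C).

Lemma card_subset1 (T : Type) (A : set T) : is_subset1 A -> exists2 k, (k <= 1)%N & A #= `I_k.
Proof.
move=> A1; have [[x Ax]|A0] := pselect (exists x, A x).
  exists 1%N => //; have -> : A = [set x].
    by apply/seteqP; split=> [y Ay|y ->//]; exact: A1.
  by rewrite card_set1.
exists 0%N => //; have -> : A = set0 by apply/seteqP; split=> // y Ay; apply: A0; exists y.
by rewrite II0; exact: card_eq00.
Qed.

Lemma edge_edge_none : (forall e f z, e \in edges (ugraph C) -> f \in edges (ugraph C) ->
    e != f -> ecurve D e z -> ecurve D f z -> False) -> edge_edge_crossings D 0.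
Proof.
move=> H; rewrite /edge_edge_crossings II0; set A := mkset _.
have -> : A = set0 by apply/seteqP; split=> // z [e [f [eE fE ef ez fz]]]; exact: (H e f z).
exact: card_eq00.
Qed.

Lemma edge_edge_finite : (forall e f, e \in edges (ugraph C) -> f \in edges (ugraph C) ->
    e != f -> is_subset1 (ecurve D e `&` ecurve D f)) -> exists a, edge_edge_crossings D a.
Proof.
move=> H; apply/finite_setP.
apply: (@sub_finite_set _ _ (\bigcup_(ef in [set ef : {set ugraph C} * {set ugraph C} |
    [/\ ef.1 \in edges (ugraph C), ef.2 \in edges (ugraph C) & ef.1 != ef.2]])
    (ecurve D ef.1 `&` ecurve D ef.2))).
  by move=> z [e [f [eE fE ef ez fz]]]; exists (e, f).
apply: bigcup_finite; first exact: finite_finset.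
move=> [e f] [/= eE fE ef]; have [k _ kE] := card_subset1 (H e f eE fE ef).
by apply/finite_setP; exists k.
Qed.

Lemma edge_region_finite : (forall e mu, e \in edges (ugraph C) ->
    finite_set (ecurve D e `&` frontier (region D mu))) -> exists b, edge_region_crossings D b.
Proof.
move=> H.
have /choice[k kP] : forall em : {set ugraph C} * cnode C, exists k, em.1 \in edges (ugraph C) ->
    (ecurve D em.1 `&` frontier (region D em.2)) #= `I_k.
  move=> [e mu] /=; case: (boolP (e \in edges (ugraph C))) => eE; last by exists 0%N.
  by have /finite_setP[k kE] := H e mu eE; exists k.
eexists; exists (fun e mu => k (e, mu)); last reflexivity.
by move=> e mu; exact: (kP (e, mu)).
Qed.

Lemma edge_region_none : (forall e mu, e \in edges (ugraph C) ->
    is_subset1 (ecurve D e `&` frontier (region D mu))) -> edge_region_crossings D 0.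
Proof.
move=> H.
have /choice[k kP] : forall em : {set ugraph C} * cnode C, exists k, (k <= 1)%N /\ (em.1 \in
  edges (ugraph C) ->
    (ecurve D em.1 `&` frontier (region D em.2)) #= `I_k).
  move=> [e mu] /=; case: (boolP (e \in edges (ugraph C))) => eE; last by exists 0%N.
  by have [k k1 kE] := card_subset1 (H e mu eE); exists k.
exists (fun e mu => k (e, mu)); first by move=> e mu; exact: (kP (e, mu)).2.
rewrite big1 // => e _; rewrite big1 // => mu _.
by have [+ _] := kP (e, mu); case: (k _) => [|[|?]].
Qed.

Lemma region_region_finite : (forall mu nu, incomparable mu nu ->
    finite_set (components (region D mu `\` region D nu))) -> exists c, region_region_crossings D c.
Proof.
move=> H.
have /choice[k kP] : forall mn : cnode C * cnode C, exists k, incomparable mn.1 mn.2 ->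
    components (region D mn.1 `\` region D mn.2) #= `I_k.
  move=> [mu nu] /=; case: (boolP (incomparable mu nu)) => i; last by exists 0%N.
  by have /finite_setP[k kE] := H mu nu i; exists k.
eexists; exists (fun mu nu => k (mu, nu)); last reflexivity.
by move=> mu nu; exact: (kP (mu, nu)).
Qed.

Lemma region_region_none : (forall mu nu, incomparable mu nu ->
    is_subset1 (components (region D mu `\` region D nu))) -> region_region_crossings D 0.
Proof.
move=> H.
have /choice[k kP] : forall mn : cnode C * cnode C, exists k, (k <= 1)%N /\ (incomparable mn.1 mn.2 ->
    components (region D mn.1 `\` region D mn.2) #= `I_k).
  move=> [mu nu] /=; case: (boolP (incomparable mu nu)) => i; last by exists 0%N.
  by have [k k1 kE] := card_subset1 (H mu nu i); exists k.
exists (fun mu nu => k (mu, nu)); first by move=> mu nu; exact: (kP (mu, nu)).2.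
rewrite big1 // => mu _; rewrite big1 // => nu _.
by have [+ _] := kP (mu, nu); case: (k _) => [|[|?]].
Qed.

End CrossingNumbers.

Section Components.
Variable R : realType.

Lemma component_connected_eq (S A : set (R * R)) x y : connected A -> A `<=` S -> A x -> A y ->
  connected_component S x = connected_component S y.
Proof.
move=> cA AS Ax Ay; apply: same_connected_component.
by exists A => //; split=> //; rewrite ?inE.
Qed.

Lemma components_connected1 (S : set (R * R)) : connected S -> is_subset1 (components S).
Proof. by move=> cS _ _ [x Sx <-] [y Sy <-]; exact: component_connected_eq cS _ Sx Sy. Qed.

Lemma components_cover2 (S A B : set (R * R)) : S = A `|` B -> connected A -> connected B ->
  finite_set (components S).
Proof.
move=> SE cA cB.
have fin X : connected X -> X `<=` S -> finite_set (connected_component S @` X).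
  move=> cX XS; have [k _ kE] : exists2 k, (k <= 1)%N & (connected_component S @` X) #= `I_k.
    by apply: card_subset1 => _ _ [x Xx <-] [y Xy <-]; exact: component_connected_eq cX XS Xx Xy.
  by apply/finite_setP; exists k.
rewrite /components; have -> : connected_component S @` S = connected_component S @` A `|`
  connected_component S @` B.
  by rewrite -image_setU -SE.
by rewrite finite_setU; split; apply: fin => // z; rewrite SE; [left|right].
Qed.

End Components.

Section StraightDrawing.
Variables (R : realType) (n : nat).
Notation plane := (R * R)%type.
Notation C := (clustered_stars n).
Variables (hubp : 'I_3 -> plane) (leafp : 'I_3 -> 'I_n -> plane).
Variables (M d Mr Dr : R) (p q : 'I_n -> R).

Definition spos (v : stars n) : plane := if v.2 is Some i then leafp v.1 i else hubp v.1.

Definition scurve s i : set plane := oseg (hubp s) (leafp s i).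

Definition securve (e : {set stars n}) : set plane :=
  [set z | exists s i, e = sedge s i /\ scurve s i z].

Definition sregion (mu : option 'I_n) : set plane :=
  if mu is Some i then para M (p i) (q i) d else para Mr 0 0 Dr.

Definition sdraw : predrawing R C := @Predrawing R C spos securve sregion.

Lemma securveE s i : securve (sedge s i) = scurve s i.
Proof.
by apply/seteqP; split=> [z [s' [i' [/sedge_inj[-> ->] //]]]|z zs]; exists s, i.
Qed.

(** The conditions on a drawing, translated into inequalities and determinants. Two curves may meet
    only transversally and where both are locally lines, hence not at the corners of the
    parallelograms. The root rectangle contains everything else strictly, so its boundary meets no
    other curve. *)
Record straight_hyp := StraightHyp {
  sh_M : 0 < M; sh_d : 0 < d; sh_Mr : 0 < Mr; sh_Dr : 0 < Dr;
  sh_inj : injective spos;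
  sh_avoid : forall s i v, ~ scurve s i (spos v);
  sh_leaf_in : forall s i, `|(leafp s i).1| < M /\ `|off (p i) (q i) (leafp s i)| < d;
  sh_leaf_out : forall s i j, j != i -> ~ para M (p j) (q j) d (leafp s i);
  sh_hub_out : forall s j, ~ para M (p j) (q j) d (hubp s);
  sh_root : forall v, `|(spos v).1| < Mr /\ `|(spos v).2| < Dr;
  sh_root_region : forall i z, para M (p i) (q i) d z -> `|z.1| < Mr /\ `|z.2| < Dr;
  sh_edge_edge : forall s i s' i' z, sedge s i != sedge s' i' -> scurve s i z -> scurve s' i' z ->
    crossp (leafp s i - hubp s) (leafp s' i' - hubp s') != 0;
  sh_edge_region : forall s i j z, scurve s i z -> frontier (para M (p j) (q j) d) z ->
    [/\ `|z.1| = M, `|off (p j) (q j) z| < d & (leafp s i).1 != (hubp s).1] \/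
    [/\ `|z.1| < M, `|off (p j) (q j) z| = d & off (p j) (q j) (leafp s i) != off (p j) (q j) (hubp s)];
  sh_region_region : forall i j z, i != j -> frontier (para M (p i) (q i) d) z ->
    frontier (para M (p j) (q j) d) z ->
    [/\ `|z.1| < M, `|off (p i) (q i) z| = d, `|off (p j) (q j) z| = d & p i != p j];
  sh_eee : forall s i s' i' s'' i'' z, sedge s i != sedge s' i' -> sedge s' i' != sedge s'' i'' ->
    sedge s i != sedge s'' i'' -> scurve s i z -> scurve s' i' z -> scurve s'' i'' z -> False;
  sh_eer : forall s i s' i' j z, sedge s i != sedge s' i' -> scurve s i z -> scurve s' i' z ->
    frontier (para M (p j) (q j) d) z -> False;
  sh_err : forall s i j k z, j != k -> scurve s i z ->
    frontier (para M (p j) (q j) d) z -> frontier (para M (p k) (q k) d) z -> False;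
  sh_rrr : forall i j k z, i != j -> j != k -> i != k -> frontier (para M (p i) (q i) d) z ->
    frontier (para M (p j) (q j) d) z -> frontier (para M (p k) (q k) d) z -> False
}.

Hypothesis H : straight_hyp.

Lemma hub_neq_leaf s i : hubp s <> leafp s i.
Proof. by move=> e; have := sh_inj H (x1 := (s, None)) (x2 := (s, Some i)) e. Qed.

Lemma root_para_frontier z : frontier (para Mr 0 0 Dr) z -> `|z.1| < Mr -> `|z.2| < Dr -> False.
Proof.
move=> /(para_frontier _ _ (sh_Mr H) (sh_Dr H))[_ _]; rewrite /off mul0r !subr0.
by case=> ->; rewrite ltxx.
Qed.

Lemma scurve_root s i z : scurve s i z -> frontier (para Mr 0 0 Dr) z -> False.
Proof.
move=> /osegP[t [t0 t1 zE]] /root_para_frontier.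
have sz : seg (hubp s) (leafp s i) z by exists t => //=; rewrite in_itv /= !ltW.
have [h1 h2] := sh_root H (s, None); have [l1 l2] := sh_root H (s, Some i).
have E1 (w : plane) : w.1 = aff 1 0 0 w by rewrite /aff; ring.
have E2 (w : plane) : w.2 = aff 0 1 0 w by rewrite /aff; ring.
rewrite /spos /= E1 in h1; rewrite /spos /= E1 in l1; rewrite /spos /= E2 in h2; rewrite /spos /=
  E2 in l2.
apply.
- by rewrite E1; exact: (seg_norm_aff sz h1 l1).
- by rewrite E2; exact: (seg_norm_aff sz h2 l2).
Qed.

Lemma region_root_frontier i z : frontier (para M (p i) (q i) d) z -> frontier (para Mr 0 0 Dr) z
  -> False.
Proof.
move=> /(para_frontier _ _ (sh_M H) (sh_d H))[z1 z2 _] /root_para_frontier.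
by have [h1 h2] := sh_root_region H (conj z1 z2); exact.
Qed.

Lemma scurve_loc_line s i z : scurve s i z ->
  loc_line (scurve s i) z (- ((leafp s i).2 - (hubp s).2)) ((leafp s i).1 - (hubp s).1).
Proof. by apply: oseg_loc_line; exact: hub_neq_leaf. Qed.

Lemma loc_line_alternate2 (A B : set plane) z a b a' b' : loc_line A z a b -> loc_line B z a' b' ->
  a * b' - a' * b != 0 -> alternate_at A B z /\ alternate_at B A z.
Proof.
move=> lA lB det; split; first exact: loc_line_alternate lA lB det.
by apply: (loc_line_alternate lB lA); rewrite -oppr_eq0 opprB.
Qed.

Lemma edge_region_alternate s i j z : scurve s i z -> frontier (para M (p j) (q j) d) z ->
  alternate_at (scurve s i) (frontier (para M (p j) (q j) d)) z /\
  alternate_at (frontier (para M (p j) (q j) d)) (scurve s i) z.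
Proof.
move=> zs zf; have ll := scurve_loc_line zs.
have [[z1 z2 ne]|[z1 z2 ne]] := sh_edge_region H zs zf.
- apply: (loc_line_alternate2 ll (para_loc_line_side (sh_M H) (sh_d H) z1 z2)).
  by rewrite mulr0 mul1r sub0r oppr_eq0 subr_eq0.
- apply: (loc_line_alternate2 ll (para_loc_line_flat (sh_M H) (sh_d H) z1 z2)).
  apply: contra ne; rewrite /off => /eqP e; apply/eqP; lra.
Qed.

Lemma straight_clustered_drawing : clustered_drawing sdraw.
Proof.
have dE s i : securve (sedge s i) = scurve s i by exact: securveE.
split.
- split; first exact: (sh_inj H).
  + move=> [s o] [s' o'] /= /andP[/= /eqP <- {s'}]; case: o o' => [i|] [j|] //= _.
      have -> : [set (s, Some i); (s, None)]%SET = sedge s i by rewrite /sedge finset.setUC.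
      rewrite dE /scurve oseg_sym; apply: oseg_open_arc => /esym; exact: hub_neq_leaf.
    rewrite -/(sedge s j) dE; apply: oseg_open_arc; exact: hub_neq_leaf.
  + by move=> e v /edgesP[s [i ->]]; rewrite /= dE; exact: (sh_avoid H).
- by case=> [i|]; apply: para_simple; [exact: (sh_M H)|exact: (sh_d H)|exact: (sh_Mr H)|exact:
  (sh_Dr H)].
- case=> [j|] [s o]; rewrite in_star_cluster /=.
  + split.
      split; rewrite orbF; last first.
        move=> /eqP->; have [h1 h2] := sh_leaf_in H s j.
        by rewrite /= /spos /=; split; exact: ltW.
      case: o => [i|] Hz; last by case: (sh_hub_out H Hz).
      by apply: contrapT => ne; apply: (sh_leaf_out H _ Hz); apply/eqP => e; apply: ne; rewrite e.
    move=> /(para_frontier _ _ (sh_M H) (sh_d H))[z1 z2 z12].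
    case: o z1 z2 z12 => [i|]; rewrite /spos /= => z1 z2 z12; last by apply: (sh_hub_out H) (conj
      z1 z2).
    have [e|ne] := eqVneq i j.
      by have := sh_leaf_in H s i; rewrite e => -[]; rewrite e in z12; case: z12 => ->; rewrite ltxx.
    by apply: (sh_leaf_out H _ (conj z1 z2)); rewrite eq_sym.
  + have [h1 h2] := sh_root H (s, o).
    split.
      split=> _; first by rewrite ?eqxx ?orbT.
      by split; rewrite /off ?mul0r ?subr0; exact: ltW.
    by move=> /root_para_frontier; apply.
- move=> mu nu; rewrite stars_descendant => /orP[/eqP->//|/eqP->].
  case: mu => [i|//] z zi /=; have [h1 h2] := sh_root_region H zi.
  by split; rewrite /off ?mul0r ?subr0; exact: ltW.
- split.
  + case=> [e|[i|]] [f|[j|]] z /=.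
    * move=> /edgesP[s [i ->]] /edgesP[s' [j ->]] ne; rewrite !dE => z1 z2.
      have {}ne : sedge s i != sedge s' j by apply: contra ne => /eqP->.
      apply: (loc_line_alternate (scurve_loc_line z1) (scurve_loc_line z2)).
      have := sh_edge_edge H ne z1 z2; rewrite /crossp /=; apply: contra => /eqP e0; apply/eqP; lra.
    * by move=> /edgesP[s [i ->]] _ _; rewrite !dE => z1 z2; case: (edge_region_alternate z1 z2).
    * by move=> /edgesP[s [i ->]] _ _; rewrite !dE => z1 z2; case: (scurve_root z1 z2).
    * by move=> _ /edgesP[s [k ->]] _; rewrite !dE => z1 z2; case: (edge_region_alternate z2 z1).
    * move=> _ _ ne z1 z2; have {}ne : i != j by apply: contra ne => /eqP->.
      have [h1 h2 h3 h4] := sh_region_region H ne z1 z2.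
      apply: (loc_line_alternate (para_loc_line_flat (sh_M H) (sh_d H) h1 h2)
        (para_loc_line_flat (sh_M H) (sh_d H) h1 h3)).
      by apply: contra h4 => /eqP e; apply/eqP; lra.
    * by move=> _ _ _ z1 z2; case: (region_root_frontier z1 z2).
    * by move=> _ /edgesP[s [k ->]] _; rewrite !dE => z1 z2; case: (scurve_root z2 z1).
    * by move=> _ _ _ z1 z2; case: (region_root_frontier z2 z1).
    * by move=> _ _ /eqP.
  + have inlN (e f : {set stars n}) : (inl e : {set stars n} + option 'I_n) != inl f -> e != f.
      by apply: contra => /eqP->.
    have inrN (i j : 'I_n) : (inr (Some i) : {set stars n} + option 'I_n) != inr (Some j) -> i != j.
      by apply: contra => /eqP->.
    have E (e : {set stars n}) z : e \in edges (stars n) -> securve e z -> exists s i, e = sedge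
      s i /\ scurve s i z.
      by move=> /edgesP[s [i ->]]; rewrite dE; exists s, i.
    move=> c1 c2 c3 k1 k2 k3 n12 n23 n13; apply/seteqP; split=> // z [[]].
    case: c1 k1 n12 n13 => [e1|[i1|]] k1 n12 n13; case: c2 k2 n12 n23 => [e2|[i2|]] k2 n12 n23;
      case: c3 k3 n13 n23 => [e3|[i3|]] k3 n13 n23 z1 z2 z3;
      rewrite /= in k1 k2 k3 z1 z2 z3;
      try (move: n12 n13 n23; rewrite ?eqxx; done);
      try (case: (E _ _ k1 z1) => s1 [j1 [? {}z1]]; subst e1);
      try (case: (E _ _ k2 z2) => s2 [j2 [? {}z2]]; subst e2);
      try (case: (E _ _ k3 z3) => s3 [j3 [? {}z3]]; subst e3);
      try (by case: (scurve_root z1 z3)); try (by case: (scurve_root z1 z2)); try (by case: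
        (scurve_root z2 z3));
      try (by case: (scurve_root z2 z1)); try (by case: (scurve_root z3 z1)); try (by case:
        (scurve_root z3 z2));
      try (by case: (region_root_frontier z1 z2)); try (by case: (region_root_frontier z1 z3));
      try (by case: (region_root_frontier z2 z3)); try (by case: (region_root_frontier z2 z1));
      try (by case: (region_root_frontier z3 z1)); try (by case: (region_root_frontier z3 z2)).
    * exact: (sh_eee H (inlN _ _ n12) (inlN _ _ n23) (inlN _ _ n13) z1 z2 z3).
    * exact: (sh_eer H (inlN _ _ n12) z1 z2 z3).
    * exact: (sh_eer H (inlN _ _ n13) z1 z3 z2).
    * exact: (sh_err H (inrN _ _ n23) z1 z2 z3).
    * exact: (sh_eer H (inlN _ _ n23) z2 z3 z1).
    * exact: (sh_err H (inrN _ _ n13) z2 z1 z3).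
    * exact: (sh_err H (inrN _ _ n12) z3 z1 z2).
    * exact: (sh_rrr H (inrN _ _ n12) (inrN _ _ n23) (inrN _ _ n13) z1 z2 z3).
Qed.

Lemma straight_edge_edge_finite : exists a, edge_edge_crossings sdraw a.
Proof.
apply: edge_edge_finite => _ _ /edgesP[s [i ->]] /edgesP[s' [j ->]] ne z w.
rewrite /= !securveE => -[zs zs'] [ws ws'].
have := sh_edge_edge H ne zs zs'; move/osegP: zs => [t [_ _ zE]]; move/osegP: ws => [u [_ _ wE]].
move/osegP: zs' => [t' [_ _ zE']]; move/osegP: ws' => [u' [_ _ wE']].
rewrite zE wE in zE' wE' *; rewrite /crossp /=.
set a1 := (leafp s i).1; set a2 := (leafp s i).2; set b1 := (hubp s).1; set b2 := (hubp s).2.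
case: zE' => e1 e2; case: wE' => e3 e4; rewrite -/a1 -/a2 -/b1 -/b2 in e1 e2 e3 e4.
move=> det; suff -> : t = u by [].
apply/eqP; rewrite -subr_eq0.
set x := (leafp s' j).1 - (hubp s').1 in e1 e3 det; set y := (leafp s' j).2 - (hubp s').2 in e2 e4 det.
have E1 : (t - u) * (a1 - b1) = (t' - u') * x by lra.
have E2 : (t - u) * (a2 - b2) = (t' - u') * y by lra.
have : (t - u) * ((a1 - b1) * y - (a2 - b2) * x) = 0.
  transitivity ((t - u) * (a1 - b1) * y - (t - u) * (a2 - b2) * x); first by ring.
  by rewrite E1 E2; ring.
by move=> /eqP; rewrite mulf_eq0 (negbTE det) orbF.
Qed.

Lemma straight_edge_region_finite : exists b, edge_region_crossings sdraw b.
Proof.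
apply: edge_region_finite => e mu /edgesP[s [i ->]]; rewrite /= securveE.
case: mu => [j|]; last first.
  have -> : scurve s i `&` frontier (para Mr 0 0 Dr) = set0.
    by apply/seteqP; split=> // z [z1 z2]; case: (scurve_root z1 z2).
  exact: finite_set0.
pose h := hubp s; pose l := leafp s i; pose o := off (p j) (q j).
(* The four parameters at which the edge can meet the lines carrying the sides. An entry with zero
   denominator is a default value that is never selected, by the transversality in
   [sh_edge_region]. *)
pose ts := [:: (M - h.1) / (l.1 - h.1); (- M - h.1) / (l.1 - h.1);
  (d - o h) / (o l - o h); (- d - o h) / (o l - o h)].
apply: (@sub_finite_set _ _ (segpt h l @` [set` ts])); last by apply: finite_image; exact: finite_seq.
move=> z [zs zf]; have := sh_edge_region H zs zf; move/osegP: zs => [t [_ _ zE]] K.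
exists t => //=; rewrite !inE.
have nn (r k : R) : `|r| = k -> r = k \/ r = - k.
  by have [r0|r0] := lerP 0 r; [rewrite ger0_norm|rewrite ltr0_norm] => // <-; [left|right;
    rewrite opprK].
have sol (a b k : R) : b != a -> a + t * (b - a) = k -> t == (k - a) / (b - a).
  by move=> ab <-; rewrite addrC addKr mulfK // subr_eq0.
case: K => [[/nn z1 _ ne]|[_ /nn z2 ne]].
  rewrite zE /segpt /= in z1.
  by case: z1 => /(sol _ _ _ ne) ->; rewrite ?orbT.
have oE : off (p j) (q j) z = o h + t * (o l - o h) by rewrite zE /o /off /segpt /=; ring.
rewrite oE in z2.
by case: z2 => /(sol _ _ _ ne) ->; rewrite ?orbT.
Qed.

End StraightDrawing.

(** * The three drawings *)

Section StarLayout.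
Variables (R : realType) (n : nat).
Notation plane := (R * R)%type.
Variables (M d Mr Dr : R) (p q : 'I_n -> R).

(** The conditions that concern a single star; the relative position of different stars is left to
    the hypotheses below. *)
Record star_ok (h : plane) (l : 'I_n -> plane) := StarOk {
  so_leaf_in : forall i, `|(l i).1| < M /\ `|off (p i) (q i) (l i)| < d;
  so_leaf_out : forall i j, j != i -> ~ para M (p j) (q j) d (l i);
  so_hub_out : forall j, ~ para M (p j) (q j) d h;
  so_hub_root : `|h.1| < Mr /\ `|h.2| < Dr;
  so_leaf_root : forall i, `|(l i).1| < Mr /\ `|(l i).2| < Dr;
  so_edge_region : forall i j z, oseg h (l i) z -> frontier (para M (p j) (q j) d) z ->
    [/\ `|z.1| = M, `|off (p j) (q j) z| < d & (l i).1 != h.1] \/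
    [/\ `|z.1| < M, `|off (p j) (q j) z| = d & off (p j) (q j) (l i) != off (p j) (q j) h];
  so_same : forall i j, i != j -> crossp (l i - h) (l j - h) != 0
}.

Lemma oseg_same_hub (h a b z : plane) : crossp (a - h) (b - h) != 0 -> oseg h a z -> oseg h b z
  -> False.
Proof.
move=> det /osegP[t [t0 t1 ->]] /osegP[u [u0 u1]] [/addrI e1 /addrI e2].
case/negP: det; rewrite -(mulrI_eq0 _ (lregP (lt0r_neq0 t0))); apply/eqP.
transitivity (t * (a.1 - h.1) * (b.2 - h.2) - t * (a.2 - h.2) * (b.1 - h.1)).
  by rewrite /crossp /=; ring.
by rewrite e1 e2; ring.
Qed.

Lemma oseg_ends (h a z : plane) : h <> a -> oseg h a z -> z <> h /\ z <> a.
Proof.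
move=> ha /osegP[t [t0 t1 ->]]; split.
  by rewrite -[X in _ <> X](segpt0 h a) => /(segpt_inj ha) e; rewrite e ltxx in t0.
by rewrite -[X in _ <> X](segpt1 h a) => /(segpt_inj ha) e; rewrite e ltxx in t1.
Qed.

Lemma oseg_not_end (h a b : plane) : crossp (a - h) (b - h) != 0 -> ~ oseg h a b.
Proof.
move=> /negP det /osegP[t [t0 t1 bE]]; apply: det; apply/eqP.
by rewrite bE /crossp /segpt /=; ring.
Qed.

Variables (hubp : 'I_3 -> plane) (leafp : 'I_3 -> 'I_n -> plane).
Hypotheses (M0 : 0 < M) (d0 : 0 < d) (Mr0 : 0 < Mr) (Dr0 : 0 < Dr).
Hypothesis ok : forall s, star_ok (hubp s) (leafp s).
Hypothesis root_region : forall i z, para M (p i) (q i) d z -> `|z.1| < Mr /\ `|z.2| < Dr.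
Hypothesis hub_inj : injective hubp.
Hypothesis leaf_neq : forall s s' i, s != s' -> leafp s i <> leafp s' i.
Hypothesis avoid_hub : forall s s' i, s != s' -> ~ oseg (hubp s) (leafp s i) (hubp s').
Hypothesis avoid_leaf : forall s s' i j, s != s' -> ~ oseg (hubp s) (leafp s i) (leafp s' j).
Hypothesis cross_det : forall s s' i j z, s != s' -> oseg (hubp s) (leafp s i) z ->
  oseg (hubp s') (leafp s' j) z -> crossp (leafp s i - hubp s) (leafp s' j - hubp s') != 0.
Hypothesis region_region : forall i j z, i != j -> frontier (para M (p i) (q i) d) z ->
  frontier (para M (p j) (q j) d) z ->
  [/\ `|z.1| < M, `|off (p i) (q i) z| = d, `|off (p j) (q j) z| = d & p i != p j].
Hypothesis eee : forall s i s' i' s'' i'' z, s != s' -> s' != s'' -> s != s'' ->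
  oseg (hubp s) (leafp s i) z -> oseg (hubp s') (leafp s' i') z -> oseg (hubp s'') (leafp s''
    i'') z -> False.
Hypothesis eer : forall s i s' i' j z, s != s' -> oseg (hubp s) (leafp s i) z ->
  oseg (hubp s') (leafp s' i') z -> frontier (para M (p j) (q j) d) z -> False.
Hypothesis err : forall s i j k z, j != k -> oseg (hubp s) (leafp s i) z ->
  frontier (para M (p j) (q j) d) z -> frontier (para M (p k) (q k) d) z -> False.
Hypothesis rrr : forall i j k z, i != j -> j != k -> i != k -> frontier (para M (p i) (q i) d) z ->
  frontier (para M (p j) (q j) d) z -> frontier (para M (p k) (q k) d) z -> False.

Lemma star_layout_straight : straight_hyp hubp leafp M d Mr Dr p q.
Proof.
have hl s s' i : hubp s <> leafp s' i.
  move=> e; apply: (so_hub_out (ok s) (j := i)); rewrite e.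
  by have [h1 h2] := so_leaf_in (ok s') i; split; exact: ltW.
have ll s s' i j : i != j -> leafp s i <> leafp s' j.
  move=> ij e; apply: (so_leaf_out (ok s) (i := i) (j := j)); first by rewrite eq_sym.
  by rewrite e; have [h1 h2] := so_leaf_in (ok s') j; split; exact: ltW.
have same s i j z : i != j -> oseg (hubp s) (leafp s i) z -> oseg (hubp s) (leafp s j) z -> False.
  move=> ij; have dt := so_same (ok s) ij. exact: (oseg_same_hub dt).
have star s i s' i' z : sedge s i != sedge s' i' -> oseg (hubp s) (leafp s i) z ->
    oseg (hubp s') (leafp s' i') z -> s != s'.
  move=> ne z1 z2; apply/eqP => e; subst s'; have [e|ij] := eqVneq i i'; first by rewrite e eqxx in ne.
  exact: same ij z1 z2.
split=> //.
- move=> [s [i|]] [s' [j|]]; rewrite /spos /= => e.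
  + have [ij|ij] := eqVneq i j; last by case: (ll s s' i j ij).
    subst j; have [->//|ss] := eqVneq s s'; by case: (leaf_neq ss e).
  + by case: (hl s' s i).
  + by case: (hl s s' j).
  + by rewrite (hub_inj e).
- move=> s i [s' [j|]]; rewrite /spos /=.
  + have [e|ss] := eqVneq s s'; last exact: avoid_leaf.
    subst s'; have [e|ij] := eqVneq i j; last exact: (oseg_not_end (so_same (ok s) ij)).
    by subst j => /(oseg_ends (hl s s i))[].
  + have [e|ss] := eqVneq s s'; last exact: avoid_hub.
    by subst s' => /(oseg_ends (hl s s i))[].
- by move=> s i; exact: (so_leaf_in (ok s)).
- by move=> s i j; exact: (so_leaf_out (ok s)).
- by move=> s j; exact: (so_hub_out (ok s)).
- by move=> [s [i|]]; [exact: (so_leaf_root (ok s))|exact: (so_hub_root (ok s))].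
- by move=> s i s' i' z ne z1 z2; exact: (cross_det (star _ _ _ _ _ ne z1 z2) z1 z2).
- by move=> s i j z; exact: (so_edge_region (ok s)).
- move=> s i s' i' s'' i'' z n1 n2 n3 z1 z2 z3.
  exact: (eee (star _ _ _ _ _ n1 z1 z2) (star _ _ _ _ _ n2 z2 z3) (star _ _ _ _ _ n3 z1 z3) z1 z2 z3).
- move=> s i s' i' j z n1 z1 z2; exact: (eer (star _ _ _ _ _ n1 z1 z2) z1 z2).
Qed.

End StarLayout.

(** * Stars with hubs beside or above the regions *)

Section Fans.
Variables (R : realType) (n : nat).
Notation plane := (R * R)%type.
Variables (p q : 'I_n -> R).
Notation N := (n%:R : R).
Hypothesis n0 : (0 < n)%N.

(* So small that an edge entering a region of half-width 1/8 through its short side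
   deviates from the axis by less than 1/32 before it reaches the leaf. *)
Definition inset : R := (512 * N ^+ 2)^-1.

Lemma N_ge1 : 1 <= N. Proof. by rewrite ler1n. Qed.

Lemma N_gt0 : 0 < N. Proof. by rewrite ltr0n. Qed.

Lemma eighth_gt0 : 0 < 8^-1 :> R. Proof. by rewrite invr_gt0. Qed.

Lemma inset_gt0 : 0 < inset.
Proof. by rewrite invr_gt0 mulr_gt0 // exprn_gt0 // ltr0n. Qed.

Lemma inset_sqN : inset * N ^+ 2 = 512^-1.
Proof. by rewrite /inset; field; rewrite pnatr_eq0 -lt0n. Qed.

Lemma inset_le : inset <= 512^-1.
Proof.
rewrite -inset_sqN ler_peMr ?(ltW inset_gt0) //.
by rewrite exprn_ege1 // N_ge1.
Qed.

Lemma ord_bound (i : 'I_n) : 0 <= (i : nat)%:R :> R /\ (i : nat)%:R <= N - 1.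
Proof. by rewrite ler0n lerBrDr natr1 ler_nat ltn_ord. Qed.

Lemma ord_gap (i j : 'I_n) : i != j ->
  1 <= (i : nat)%:R - (j : nat)%:R :> R \/ 1 <= (j : nat)%:R - (i : nat)%:R :> R.
Proof.
move=> ij; have : (i : nat) != j by [].
by rewrite neq_ltn => /orP[h|h]; [right|left]; rewrite lerBrDr addrC natr1 ler_nat.
Qed.

Hypothesis p_bound : forall i, 0 <= p i /\ p i <= 2 * N.
Hypothesis q_bound : forall i, - N ^+ 2 <= q i /\ q i <= N ^+ 2.

(** The sign sg selects the right or the left side, w is the height of the hub, and o the height of
    a leaf above the axis of its region. The leaf lies at distance [inset] inside the short side. *)
Definition side_hub (sg w : R) : plane := (sg * (N + 1), w).
Definition side_leaf (sg o : R) (i : 'I_n) : plane :=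
  (sg * (N - inset), p i * (sg * (N - inset)) + q i + o).

Definition gap_at (sg : R) := forall i j, i != j ->
  1 <= off (p j) (q j) (side_leaf sg 0 i) \/ off (p j) (q j) (side_leaf sg 0 i) <= -1.

Lemma side_off_hub sg w j : (sg = 1 \/ sg = -1) -> -2^-1 <= w -> w <= 2^-1 ->
  `|off (p j) (q j) (side_hub sg w)| <= 6 * N ^+ 2.
Proof.
move=> sgE w1 w2; have [p1 p2] := p_bound j; have [q1 q2] := q_bound j.
have N1 := N_ge1; rewrite /off /side_hub /= ler_norml.
have pN : p j * (N + 1) <= 4 * N ^+ 2 by nra.
have pN0 : 0 <= p j * (N + 1) by nra.
have NN : 1 <= N ^+ 2 by nra.
by case: sgE => ->; apply/andP; split; lra.
Qed.

Lemma side_off_leaf sg o i j : (sg = 1 \/ sg = -1) -> -16^-1 <= o -> o <= 16^-1 ->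
  `|off (p j) (q j) (side_leaf sg o i)| <= 5 * N ^+ 2.
Proof.
move=> sgE o1 o2; have [p1 p2] := p_bound j; have [q1 q2] := q_bound j.
have [p3 p4] := p_bound i; have [q3 q4] := q_bound i.
have N1 := N_ge1; have e0 := inset_gt0; have e1 := inset_le; rewrite /off /side_leaf /= ler_norml.
have NN : 1 <= N ^+ 2 by nra.
have a1 : p i * (N - inset) <= 2 * N ^+ 2 by nra.
have a2 : 0 <= p i * (N - inset) by apply: mulr_ge0 => //; lra.
have a3 : p j * (N - inset) <= 2 * N ^+ 2 by nra.
have a4 : 0 <= p j * (N - inset) by apply: mulr_ge0 => //; lra.
by case: sgE => ->; apply/andP; split; lra.
Qed.

Lemma side_edge_x sg w o i z : (sg = 1 \/ sg = -1) -> oseg (side_hub sg w) (side_leaf sg o i) z ->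
  N - inset < sg * z.1 /\ sg * z.1 < N + 1.
Proof.
move=> sgE /osegP[t [t0 t1 ->]]; have e0 := inset_gt0; rewrite /segpt /side_hub /side_leaf /=.
have -> : sg * (sg * (N + 1) + t * (sg * (N - inset) - sg * (N + 1))) = (N + 1) - t * (1 + inset).
  by case: sgE => ->; ring.
by split; nra.
Qed.

(** The part of the edge with abscissa in the range of the regions has 1 - t at most [inset]. Along
    the whole edge [off] changes by at most (6 + 5) N^2, and 11 / 512 < 1 / 32. *)
Lemma side_edge_off sg w o i j z : (sg = 1 \/ sg = -1) -> -2^-1 <= w -> w <= 2^-1 ->
    -16^-1 <= o -> o <= 16^-1 ->
    oseg (side_hub sg w) (side_leaf sg o i) z -> `|z.1| <= N ->
  `|off (p j) (q j) z - off (p j) (q j) (side_leaf sg o i)| < 32^-1.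
Proof.
move=> sgE w1 w2 o1 o2 zs zN; have [_ _] := side_edge_x sgE zs.
have hh := side_off_hub j sgE w1 w2; have hl := side_off_leaf i j sgE o1 o2.
move/osegP: zs => [t [t0 t1 zE]].
have e0 := inset_gt0; have eN := inset_sqN; have N1 := N_ge1.
have sz : sg * z.1 = (N + 1) - t * (1 + inset).
  by rewrite zE /segpt /side_hub /side_leaf /=; case: sgE => ->; ring.
have szN : sg * z.1 <= N.
  by move: zN; rewrite ler_norml => /andP[? ?]; case: sgE => ->; lra.
have t1e : 1 - t <= inset by nra.
have -> : off (p j) (q j) z - off (p j) (q j) (side_leaf sg o i) =
   (1 - t) * (off (p j) (q j) (side_hub sg w) - off (p j) (q j) (side_leaf sg o i)).
  by rewrite zE /off /segpt /=; ring.
rewrite normrM gtr0_norm ?subr_gt0 //.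
have hd : `|off (p j) (q j) (side_hub sg w) - off (p j) (q j) (side_leaf sg o i)| <= 11 * N ^+ 2.
  by apply: le_trans (ler_normB _ _) _; lra.
have s0 : 0 <= 1 - t by lra.
apply: le_lt_trans (ler_pM s0 (normr_ge0 _) t1e hd) _; lra.
Qed.

(** Within the range of the regions, [off] stays within 1 / 32 of its value at the leaf. For another
    region this value is at least 1 - 1 / 16 in absolute value, for its own at most 1 / 16, so the
    edge misses all other regions and the flat sides of its own. *)
Lemma side_edge_frontier sg w o i j z : (sg = 1 \/ sg = -1) -> -2^-1 <= w -> w <= 2^-1 ->
    -16^-1 <= o -> o <= 16^-1 -> gap_at sg ->
    oseg (side_hub sg w) (side_leaf sg o i) z -> frontier (para N (p j) (q j) 8^-1) z ->
  [/\ i = j, `|z.1| = N & `|off (p j) (q j) z| < 8^-1].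
Proof.
move=> sgE w1 w2 o1 o2 gap zs /(para_frontier _ _ N_gt0 eighth_gt0)[zN zd zz].
have offo k : off (p k) (q k) (side_leaf sg o i) = off (p k) (q k) (side_leaf sg 0 i) + o.
  by rewrite /off /side_leaf /=; ring.
have close := side_edge_off j sgE w1 w2 o1 o2 zs zN.
have ij : i = j.
  apply/eqP/negPn/negP => ne; have := gap i j ne; move: close zd.
  rewrite offo ltr_norml ler_norml => /andP[? ?] /andP[? ?]; case; lra.
subst j; have zd' : `|off (p i) (q i) z| < 8^-1.
  move: close; rewrite offo; have -> : off (p i) (q i) (side_leaf sg 0 i) = 0 by rewrite /off
    /side_leaf /=; ring.
  by rewrite !ltr_norml => /andP[? ?]; apply/andP; split; lra.
by split=> //; case: zz => // e; rewrite e ltxx in zd'.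
Qed.

Lemma side_star_ok sg w o : (sg = 1 \/ sg = -1) -> -2^-1 <= w -> w <= 2^-1 ->
    -16^-1 <= o -> o <= 16^-1 -> gap_at sg ->
  star_ok N 8^-1 (N + 2) (100 * N ^+ 2) p q (side_hub sg w) (side_leaf sg o).
Proof.
move=> sgE w1 w2 o1 o2 gap; have e0 := inset_gt0; have e1 := inset_le; have N1 := N_ge1.
have NN : 1 <= N ^+ 2 by nra.
have offo i j : off (p j) (q j) (side_leaf sg o i) = off (p j) (q j) (side_leaf sg 0 i) + o.
  by rewrite /off /side_leaf /=; ring.
have sgn : `|sg| = 1 by case: sgE => ->; rewrite ?normrN1 ?normr1.
have lx i : `|(side_leaf sg o i).1| = N - inset by rewrite /= normrM sgn mul1r ger0_norm; lra.
have hx : `|(side_hub sg w).1| = N + 1 by rewrite /= normrM sgn mul1r ger0_norm; lra.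
split.
- move=> i; rewrite lx; split; first lra.
  rewrite offo; have -> : off (p i) (q i) (side_leaf sg 0 i) = 0 by rewrite /off /side_leaf /=; ring.
  by rewrite add0r ltr_norml; apply/andP; split; lra.
- move=> i j ji [_]; rewrite offo ler_norml => /andP[h1 h2].
  by have [] := gap i j; rewrite 1?eq_sym //; lra.
- by move=> j [+ _]; rewrite hx; lra.
- by rewrite hx; split; [lra|rewrite /= ltr_norml; apply/andP; split; lra].
- move=> i; rewrite lx; split; first lra.
  have := side_off_leaf i i sgE o1 o2; rewrite ler_norml /off => /andP[h1 h2].
  have [p1 p2] := p_bound i; have [q1 q2] := q_bound i.
  have a1 : p i * (N - inset) <= 2 * N ^+ 2 by nra.
  have a2 : 0 <= p i * (N - inset) by apply: mulr_ge0 => //; lra.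
  by rewrite /= ltr_norml; case: sgE => ->; apply/andP; split; lra.
- move=> i j z zs zf; left; have [_ zN zd] := side_edge_frontier sgE w1 w2 o1 o2 gap zs zf.
  by split=> //; apply/eqP => /(congr1 (fun r => `|r|)); rewrite lx hx; lra.
- move=> i j ij; rewrite /crossp /side_hub /side_leaf /=.
  have := gap i j ij; rewrite /off /side_leaf /= => g.
  have -> : (sg * (N - inset) - sg * (N + 1)) * (p j * (sg * (N - inset)) + q j + o - w) -
     (p i * (sg * (N - inset)) + q i + o - w) * (sg * (N - inset) - sg * (N + 1)) =
     (sg * (1 + inset)) * (p i * (sg * (N - inset)) + q i + 0 - p j * (sg * (N - inset)) - q j) by ring.
  rewrite mulf_neq0 //; first by rewrite -normr_gt0 normrM sgn mul1r normr_gt0; apply/eqP; lra.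
  by apply/eqP; case: g; lra.
Qed.

(** The abscissa is strictly monotone along the edge and keeps its sign. A single boundary crossing
    contributes nothing to the edge-region count. *)
Lemma side_edge_subset1 sg w o i (X : set plane) : (sg = 1 \/ sg = -1) ->
    (forall z, X z -> `|z.1| = N) ->
  is_subset1 (oseg (side_hub sg w) (side_leaf sg o i) `&` X).
Proof.
move=> sgE XN x y [xs /XN xN] [ys /XN yN].
have e0 := inset_gt0; have e1 := inset_le; have N1 := N_ge1.
have [x1 x2] := side_edge_x sgE xs; have [y1 y2] := side_edge_x sgE ys.
have nn (r : R) : `|r| = N -> r = N \/ r = - N.
  by have [r0|r0] := lerP 0 r; [rewrite ger0_norm|rewrite ltr0_norm] => // <-; [left|right;
    rewrite opprK].
have xy : x.1 = y.1.
  by move: x1 x2 y1 y2; case: sgE => ->; case: (nn _ xN) => ->; case: (nn _ yN) => ->; lra.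
move/osegP: xs xy => [t [_ _ ->]]; move/osegP: ys => [u [_ _ ->]] /= /addrI /mulIf e.
by rewrite e //; apply/eqP => h; case: sgE h => ->; lra.
Qed.

(** The height 10 N^2 puts the hub at least 9 N^2 above every axis, while the leaves are at most 4
    N^2 above any. So [off] increases strictly from leaf to hub, and the edges are transversal to
    all flat sides. *)
Definition top_hub : plane := (0, 10 * N ^+ 2).
Definition top_leaf (i : 'I_n) : plane := ((i : nat)%:R, p i * (i : nat)%:R + q i).

Lemma top_edge_x i z : oseg top_hub (top_leaf i) z -> 0 <= z.1 /\ z.1 <= N - 1.
Proof.
move=> /osegP[t [t0 t1 ->]]; have [i0 i1] := ord_bound i; rewrite /= add0r subr0.
by split; nra.
Qed.

Lemma top_off_lt i j : off (p j) (q j) (top_leaf i) < off (p j) (q j) top_hub.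
Proof.
have [p1 p2] := p_bound j; have [q1 q2] := q_bound j.
have [p3 p4] := p_bound i; have [q3 q4] := q_bound i.
have [i0 i1] := ord_bound i; have N1 := N_ge1.
have NN : 1 <= N ^+ 2 by nra.
rewrite /off /= mulr0 subr0.
have a1 : p i * (i : nat)%:R <= 2 * N ^+ 2 by nra.
have a2 : 0 <= p j * (i : nat)%:R by rewrite mulr_ge0.
lra.
Qed.

Lemma top_star_ok :
    (forall i j, i != j -> 1 <= `|off (p j) (q j) (top_leaf i)|) ->
    (forall i j, i != j -> crossp (top_leaf i - top_hub) (top_leaf j - top_hub) != 0) ->
  star_ok N 8^-1 (N + 2) (100 * N ^+ 2) p q top_hub top_leaf.
Proof.
move=> gap det; have N1 := N_ge1; have NN : 1 <= N ^+ 2 by nra.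
have xN i : `|(top_leaf i).1| <= N - 1.
  by have [i0 i1] := ord_bound i; rewrite /= ger0_norm.
split=> //.
- move=> i; split; first by have := xN i; lra.
  have -> : off (p i) (q i) (top_leaf i) = 0 by rewrite /off /=; ring.
  by rewrite normr0; lra.
- by move=> i j ji [_]; have := gap i j; rewrite eq_sym ji => /(_ isT); lra.
- move=> j [_]; have [q1 q2] := q_bound j; rewrite /off /= mulr0 subr0 ler_norml => /andP[_]; lra.
- by rewrite /= normr0; split; [lra|rewrite ger0_norm; lra].
- move=> i; split; first by have := xN i; lra.
  have [p3 p4] := p_bound i; have [q3 q4] := q_bound i; have [i0 i1] := ord_bound i.
  have a1 : p i * (i : nat)%:R <= 2 * N ^+ 2 by nra.
  have a2 : 0 <= p i * (i : nat)%:R by rewrite mulr_ge0.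
  by rewrite /= ltr_norml; apply/andP; split; lra.
- move=> i j z zs /(para_frontier _ _ N_gt0 eighth_gt0)[zN zd zz]; right; have [z0 z1] := top_edge_x zs.
  have zl : `|z.1| < N by rewrite ger0_norm //; lra.
  split=> //; first by case: zz => // e; rewrite e ltxx in zl.
  by rewrite lt_eqF // top_off_lt.
Qed.

Lemma region_in_root i z : para N (p i) (q i) 8^-1 z -> `|z.1| < N + 2 /\ `|z.2| < 100 * N ^+ 2.
Proof.
have [p1 p2] := p_bound i; have [q1 q2] := q_bound i; have N1 := N_ge1.
have NN : 1 <= N ^+ 2 by nra.
move=> [z1]; rewrite /off !ler_norml => /andP[o1 o2]; split; first lra.
move: z1; rewrite ler_norml ltr_norml => /andP[z1 z2].
have a1 : p i * z.1 <= 2 * N ^+ 2 by nra.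
have a2 : - (2 * N ^+ 2) <= p i * z.1 by nra.
by apply/andP; split; lra.
Qed.

End Fans.

Section Layouts.
Variables (R : realType) (n : nat).
Notation plane := (R * R)%type.
Notation N := (n%:R : R).
Hypothesis n0 : (0 < n)%N.

Definition tri (T : Type) (a b c : T) (s : 'I_3) : T :=
  if val s is k.+1 then (if k is _.+1 then c else b) else a.

Lemma ord3_ind (P : 'I_3 -> Prop) :
  P ord0 -> P (@Ordinal 3 1 isT) -> P (@Ordinal 3 2 isT) -> forall s, P s.
Proof.
move=> P0 P1 P2 [[|[|[|//]]] s3].
- by have -> : Ordinal s3 = ord0 by exact: val_inj.
- by have -> : Ordinal s3 = @Ordinal 3 1 isT by exact: val_inj.
- by have -> : Ordinal s3 = @Ordinal 3 2 isT by exact: val_inj.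
Qed.

Let sgN : (-1 = 1 :> R \/ -1 = -1 :> R). Proof. by right. Qed.
Let sg1 : (1 = 1 :> R \/ 1 = -1 :> R). Proof. by left. Qed.
Let w0a : -2^-1 <= 0 :> R. Proof. lra. Qed.
Let w0b : 0 <= 2^-1 :> R. Proof. lra. Qed.
Let o0a : -16^-1 <= 0 :> R. Proof. lra. Qed.
Let o0b : 0 <= 16^-1 :> R. Proof. lra. Qed.

Section TopLayout.
Variables (p q : 'I_n -> R).
Hypothesis p_bound : forall i, 0 <= p i /\ p i <= 2 * N.
Hypothesis q_bound : forall i, - N ^+ 2 <= q i /\ q i <= N ^+ 2.
Hypothesis gapN : gap_at p q (-1).
Hypothesis gap1 : gap_at p q 1.
Hypothesis top_gap : forall i j, i != j -> 1 <= `|off (p j) (q j) (top_leaf p q i)|.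
Hypothesis top_det : forall i j, i != j ->
  crossp (top_leaf p q i - top_hub R n) (top_leaf p q j - top_hub R n) != 0.

Definition thub := tri (side_hub n (-1) 0) (side_hub n 1 0) (top_hub R n).
Definition tleaf s i := tri (side_leaf p q (-1) 0 i) (side_leaf p q 1 0 i) (top_leaf p q i) s.

Lemma top_layout_ok s : star_ok N 8^-1 (N + 2) (100 * N ^+ 2) p q (thub s) (tleaf s).
Proof.
elim/ord3_ind: s; [apply: side_star_ok|apply: side_star_ok|apply: top_star_ok] => //.
Qed.

(** Disjoint vertical strips, one for each star, which keep edges of different stars apart. *)
Definition zone (s : 'I_3) : plane -> Prop :=
  @tri (plane -> Prop) (fun z => z.1 < 0) (fun z => N - 1 < z.1) (fun z => 0 <= z.1 /\ z.1 <= N - 1) s.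

Lemma zone_disjoint s s' z : s != s' -> zone s z -> zone s' z -> False.
Proof.
have N1 := N_ge1 R n0.
by elim/ord3_ind: s; elim/ord3_ind: s' => //= _; rewrite /zone /tri /=;
  [move=> h1 h2|move=> h1 [h2 h3]|move=> h1 h2|move=> h1 [h2 h3]|move=> [h2 h3] h1|move=> [h2 h3]
    h1]; lra.
Qed.

Lemma zone_hub s : zone s (thub s).
Proof.
have N1 := N_ge1 R n0.
by elim/ord3_ind: s; rewrite /zone /thub /tleaf /tri /=; [lra|lra|split; lra].
Qed.

Lemma zone_leaf s i : zone s (tleaf s i).
Proof.
have N1 := N_ge1 R n0; have e1 := inset_le R n0; have e0 := inset_gt0 R n0.
by elim/ord3_ind: s; rewrite /zone /thub /tleaf /tri /=; [lra|lra|exact: ord_bound].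
Qed.

Lemma zone_edge s i z : oseg (thub s) (tleaf s i) z -> zone s z.
Proof.
have N1 := N_ge1 R n0; have e1 := inset_le R n0; have e0 := inset_gt0 R n0.
elim/ord3_ind: s.
- by move=> /(side_edge_x n0 sgN)[]; rewrite /zone /tri /=; lra.
- by move=> /(side_edge_x n0 sg1)[]; rewrite /zone /tri /=; lra.
- exact: top_edge_x.
Qed.

Lemma top_layout_straight :
    (forall i j z, i != j -> frontier (para N (p i) (q i) 8^-1) z ->
      frontier (para N (p j) (q j) 8^-1) z ->
      [/\ `|z.1| < N, `|off (p i) (q i) z| = 8^-1, `|off (p j) (q j) z| = 8^-1 & p i != p j]) ->
    (forall s i j k z, j != k -> oseg (thub s) (tleaf s i) z ->
      frontier (para N (p j) (q j) 8^-1) z -> frontier (para N (p k) (q k) 8^-1) z -> False) ->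
    (forall i j k z, i != j -> j != k -> i != k -> frontier (para N (p i) (q i) 8^-1) z ->
      frontier (para N (p j) (q j) 8^-1) z -> frontier (para N (p k) (q k) 8^-1) z -> False) ->
  straight_hyp thub tleaf N 8^-1 (N + 2) (100 * N ^+ 2) p q.
Proof.
move=> rr err rrr; have N1 := N_ge1 R n0.
have zd s s' z : s != s' -> zone s z -> zone s' z -> False := @zone_disjoint s s' z.
have [M0 d0] := (N_gt0 R n0, eighth_gt0 R).
have Mr0 : 0 < N + 2 by lra.
have Dr0 : 0 < 100 * N ^+ 2 by rewrite mulr_gt0 // exprn_gt0.
apply: (star_layout_straight M0 d0 Mr0 Dr0) => //.
- exact: top_layout_ok.
- by move=> i z; exact: region_in_root.
- move=> s s' e; apply/eqP/negPn/negP => ne; apply: (zd _ _ (thub s) ne); first exact: zone_hub.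
  by rewrite e; exact: zone_hub.
- move=> s s' i ne e; apply: (zd _ _ (tleaf s i) ne); first exact: zone_leaf.
  by rewrite e; exact: zone_leaf.
- by move=> s s' i ne /zone_edge z1; apply: (zd _ _ _ ne z1); exact: zone_hub.
- by move=> s s' i j ne /zone_edge z1; apply: (zd _ _ _ ne z1); exact: zone_leaf.
- by move=> s s' i j z ne /zone_edge z1 /zone_edge z2; case: (zd _ _ _ ne z1 z2).
- by move=> s i s' i' s'' i'' z ne _ _ /zone_edge z1 /zone_edge z2; case: (zd _ _ _ ne z1 z2).
- by move=> s i s' i' j z ne /zone_edge z1 /zone_edge z2; case: (zd _ _ _ ne z1 z2).
Qed.

Lemma top_layout_edge_edge : edge_edge_crossings
  (sdraw thub tleaf N 8^-1 (N + 2) (100 * N ^+ 2) p q) 0.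
Proof.
apply: edge_edge_none => _ _ z /edgesP[s [i ->]] /edgesP[s' [j ->]] ne; rewrite /= !securveE.
move=> z1 z2; have [e|ss] := eqVneq s s'; last exact: (zone_disjoint ss (zone_edge z1) (zone_edge z2)).
subst s'; have [e|ij] := eqVneq i j; first by rewrite e eqxx in ne.
exact: (oseg_same_hub (so_same (top_layout_ok s) ij) z1 z2).
Qed.

End TopLayout.

Section Rows.

Definition row_p (i : 'I_n) : R := 0.
Definition row_q (i : 'I_n) : R := (i : nat)%:R.

Lemma row_p_bound i : 0 <= row_p i /\ row_p i <= 2 * N.
Proof. by rewrite /row_p; have := N_ge1 R n0; split; lra. Qed.

Lemma row_q_bound i : - N ^+ 2 <= row_q i /\ row_q i <= N ^+ 2.
Proof. by have [i0 i1] := ord_bound R i; have N1 := N_ge1 R n0; rewrite /row_q; split; nra. Qed.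

Lemma row_gap sg : gap_at row_p row_q sg.
Proof.
move=> i j /(ord_gap R) g; rewrite /off /side_leaf /row_p /row_q /= !mul0r.
by case: g => g; [left|right]; lra.
Qed.

Lemma row_disjoint i j z : i != j -> para N (row_p i) (row_q i) 8^-1 z ->
  para N (row_p j) (row_q j) 8^-1 z -> False.
Proof.
move=> /(ord_gap R) g [_ +] [_]; rewrite /off /row_p /row_q !mul0r !ler_norml => /andP[? ?] /andP[? ?].
by case: g; lra.
Qed.

Lemma row_frontier_disjoint i j z : i != j -> frontier (para N (row_p i) (row_q i) 8^-1) z ->
  frontier (para N (row_p j) (row_q j) 8^-1) z -> False.
Proof.
move=> ij /(para_frontier _ _ (N_gt0 R n0) (eighth_gt0 R))[a1 a2 _].
move=> /(para_frontier _ _ (N_gt0 R n0) (eighth_gt0 R))[b1 b2 _].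
exact: (row_disjoint ij (conj a1 a2) (conj b1 b2)).
Qed.

Lemma seg_le_aff (a b c k : R) (x y z : plane) : seg x y z ->
  aff a b c x <= k -> aff a b c y <= k -> aff a b c z <= k.
Proof.
move=> [t /=]; rewrite in_itv /= => /andP[t0 t1] <- h1 h2.
have -> : aff a b c (segpt x y t) = (1 - t) * aff a b c x + t * aff a b c y.
  by rewrite /aff /segpt /=; ring.
by nra.
Qed.

Lemma para_seg (p q M d : R) (x y : plane) : para M p q d x -> para M p q d y -> seg x y `<=`
  para M p q d.
Proof.
have fstE (w : plane) : w.1 = aff 1 0 0 w by rewrite /aff; ring.
have fstN (w : plane) : - w.1 = aff (-1) 0 0 w by rewrite /aff; ring.
have offE (w : plane) : off p q w = aff (- p) 1 (- q) w by rewrite /off /aff; ring.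
have offN (w : plane) : - off p q w = aff p (-1) q w by rewrite /off /aff; ring.
move=> [x1 x2] [y1 y2] z xyz; move: x1 x2 y1 y2; rewrite !ler_norml.
move=> /andP[x1 x2] /andP[x3 x4] /andP[y1 y2] /andP[y3 y4].
rewrite lerNl fstN in x1; rewrite lerNl fstN in y1; rewrite fstE in x2; rewrite fstE in y2.
rewrite lerNl offN in x3; rewrite lerNl offN in y3; rewrite offE in x4; rewrite offE in y4.
split; rewrite ler_norml lerNl ?fstN ?offN ?fstE ?offE; apply/andP; split.
- exact: seg_le_aff xyz x1 y1.
- exact: seg_le_aff xyz x2 y2.
- exact: seg_le_aff xyz x3 y3.
- exact: seg_le_aff xyz x4 y4.
Qed.

Lemma row_region_region hubp leafp Mr Dr :
  region_region_crossings (sdraw hubp leafp N 8^-1 Mr Dr row_p row_q) 0.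
Proof.
apply: region_region_none => -[i|] [j|]; rewrite stars_incomparable //= => /andP[ne _].
have {}ne : i != j by apply: contra ne => /eqP->.
apply: components_connected1.
have -> : para N (row_p i) (row_q i) 8^-1 `\` para N (row_p j) (row_q j) 8^-1 = para N (row_p i)
  (row_q i) 8^-1.
  by apply/seteqP; split=> [z []//|z zi]; split=> // zj; exact: row_disjoint ne zi zj.
by apply: convex_connected => x y; exact: para_seg.
Qed.

(** The rows are disjoint and the stars lie in disjoint zones, so only the edges from the top hub
    down through the rows are left to be counted. *)
Lemma admits_edge_region : exists b, admits_drawing R (clustered_stars n) 0 b 0.
Proof.
have N1 := N_ge1 R n0.
have top_gap i j : i != j -> 1 <= `|off (row_p j) (row_q j) (top_leaf row_p row_q i)|.
  move=> /(ord_gap R) g; rewrite /off /top_leaf /row_p /row_q /= !mul0r ler_normr.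
  by apply/orP; case: g => g; [left|right]; lra.
have top_det i j : i != j -> crossp (top_leaf row_p row_q i - top_hub R n)
    (top_leaf row_p row_q j - top_hub R n) != 0.
  move=> /(ord_gap R) g; rewrite /crossp /top_leaf /row_p /row_q /=.
  have -> : ((i : nat)%:R - 0) * (0 * (j : nat)%:R + (j : nat)%:R - 10 * N ^+ 2) -
     (0 * (i : nat)%:R + (i : nat)%:R - 10 * N ^+ 2) * ((j : nat)%:R - 0) =
     10 * N ^+ 2 * ((j : nat)%:R - (i : nat)%:R) by ring.
  rewrite mulf_neq0 //; first by rewrite lt0r_neq0 // mulr_gt0 // exprn_gt0 // N_gt0.
  by apply/eqP; case: g; lra.
have H : straight_hyp thub (tleaf row_p row_q) N 8^-1 (N + 2) (100 * N ^+ 2) row_p row_q.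
  apply: (top_layout_straight row_p_bound row_q_bound (@row_gap _) (@row_gap _) top_gap top_det).
  - by move=> i j z ij z1 z2; case: (row_frontier_disjoint ij z1 z2).
  - by move=> s i j k z jk _; exact: row_frontier_disjoint.
  - by move=> i j k z ij _ _ z1 z2; case: (row_frontier_disjoint ij z1 z2).
have [b bE] := straight_edge_region_finite H.
exists b, (sdraw thub (tleaf row_p row_q) N 8^-1 (N + 2) (100 * N ^+ 2) row_p row_q); split=> //.
- exact: straight_clustered_drawing.
- exact: (top_layout_edge_edge row_p_bound row_q_bound (@row_gap _) (@row_gap _) top_gap top_det).
- exact: row_region_region.
Qed.

(** The third star shares the left side with the first: its hub is lower by 1 / 2 and its leaves are
    higher by 1 / 16, so edges of the two stars may cross outside the regions. *)
Let w1 : R := - 2^-1.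
Let o1 : R := 16^-1.
Let w1a : -2^-1 <= w1. Proof. by []. Qed.
Let w1b : w1 <= 2^-1. Proof. by rewrite /w1; lra. Qed.
Let o1a : -16^-1 <= o1. Proof. by rewrite /o1; lra. Qed.
Let o1b : o1 <= 16^-1. Proof. by []. Qed.

Definition fhub := tri (side_hub n (-1) 0) (side_hub n 1 0) (side_hub n (-1) w1).
Definition fleaf s i := tri (side_leaf row_p row_q (-1) 0 i) (side_leaf row_p row_q 1 0 i)
  (side_leaf row_p row_q (-1) o1 i) s.

Lemma fan_ok s : star_ok N 8^-1 (N + 2) (100 * N ^+ 2) row_p row_q (fhub s) (fleaf s).
Proof.
have rp := row_p_bound; have rq := row_q_bound.
by elim/ord3_ind: s; apply: side_star_ok => //; exact: row_gap.
Qed.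

Lemma fan_frontier s i j z : oseg (fhub s) (fleaf s i) z -> frontier (para N (row_p j) (row_q j)
  8^-1) z ->
  [/\ i = j, `|z.1| = N & `|off (row_p j) (row_q j) z| < 8^-1].
Proof.
have rp := row_p_bound; have rq := row_q_bound; have g := row_gap.
elim/ord3_ind: s => z1 z2.
- exact: (side_edge_frontier n0 rp rq sgN w0a w0b o0a o0b (g _) z1 z2).
- exact: (side_edge_frontier n0 rp rq sg1 w0a w0b o0a o0b (g _) z1 z2).
- exact: (side_edge_frontier n0 rp rq sgN w1a w1b o1a o1b (g _) z1 z2).
Qed.

Definition fsign : 'I_3 -> R := tri (-1) 1 (-1).

Lemma fan_x s i z : oseg (fhub s) (fleaf s i) z -> N - inset R n < fsign s * z.1 /\ fsign s * z.1
  < N + 1.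
Proof.
by elim/ord3_ind: s; [exact: (side_edge_x n0 sgN)|exact: (side_edge_x n0 sg1)|exact: (side_edge_x
  n0 sgN)].
Qed.

Lemma fan_hub_x s : (fhub s).1 = fsign s * (N + 1). Proof. by elim/ord3_ind: s. Qed.
Lemma fan_leaf_x s i : (fleaf s i).1 = fsign s * (N - inset R n). Proof. by elim/ord3_ind: s. Qed.

Lemma fsignE s : fsign s = 1 \/ fsign s = -1.
Proof. by elim/ord3_ind: s; rewrite /fsign /tri /=; [right|left|right]. Qed.

Lemma fan_straight : straight_hyp fhub fleaf N 8^-1 (N + 2) (100 * N ^+ 2) row_p row_q.
Proof.
have N1 := N_ge1 R n0; have e0 := inset_gt0 R n0; have e1 := inset_le R n0.
have [M0 d0] := (N_gt0 R n0, eighth_gt0 R).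
have Mr0 : 0 < N + 2 by lra.
have Dr0 : 0 < 100 * N ^+ 2 by rewrite mulr_gt0 // exprn_gt0.
have opp s s' z i : fsign s <> fsign s' -> oseg (fhub s) (fleaf s i) z -> fsign s' * z.1 < 0.
  by move=> ne /fan_x[]; case: (fsignE s) ne => ->; case: (fsignE s') => -> //; lra.
have nopp s s' z i i' : fsign s <> fsign s' -> oseg (fhub s) (fleaf s i) z ->
    oseg (fhub s') (fleaf s' i') z -> False.
  by move=> ne /(opp _ _ _ _ ne) z1 /fan_x[z2 z3]; lra.
have sgs s : fsign s * fsign s = 1 by case: (fsignE s) => ->; rewrite ?mulrNN mulr1.
have two i i' z : oseg (fhub ord0) (fleaf ord0 i) z ->
    crossp (fleaf ord0 i - fhub ord0) (fleaf (@Ordinal 3 2 isT) i' - fhub (@Ordinal 3 2 isT)) != 0.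
  move=> _; rewrite /crossp /fleaf /fhub /tri /side_leaf /side_hub /row_p /row_q /w1 /o1 /=.
  set a := (i : nat)%:R; set b := (i' : nat)%:R.
  have -> : (-1 * (N - inset R n) - -1 * (N + 1)) * (0 * (-1 * (N - inset R n)) + b + 16^-1 - - 2^-1) -
     (0 * (-1 * (N - inset R n)) + a + 0 - 0) * (-1 * (N - inset R n) - -1 * (N + 1)) =
     (1 + inset R n) * (b - a + 9 / 16) by field.
  rewrite mulf_neq0 //; first by rewrite lt0r_neq0 //; lra.
  (* The rises of the two edges differ by b - a + 1 / 2 + 1 / 16, which is nonzero because b - a is
     an integer. *)
  rewrite /a /b; have [->|ne] := eqVneq i i'; first by rewrite subrr add0r lt0r_neq0 //; lra.
  by apply/eqP; case: (ord_gap R ne); lra.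
have crossC (x y : plane) : crossp x y != 0 -> crossp y x != 0 by rewrite crosspC oppr_eq0.
apply: (star_layout_straight M0 d0 Mr0 Dr0) => //.
- exact: fan_ok.
- by move=> i z; apply: (region_in_root n0 row_p_bound row_q_bound).
- move=> s s'; elim/ord3_ind: s; elim/ord3_ind: s' => //; rewrite /fhub /tri /side_hub /w1 /=;
  by move=> /pair_equal_spec[h1 h2]; exfalso; lra.
- move=> s s' i; elim/ord3_ind: s; elim/ord3_ind: s' => // _;
  rewrite /fleaf /tri /side_leaf /row_p /row_q /o1 /=;
  by move=> /pair_equal_spec[h1 h2]; lra.
- move=> s s' i ne zs; have [ss|ss] := pselect (fsign s = fsign s').
    by have [] := fan_x zs; rewrite fan_hub_x ss mulrA sgs mul1r; lra.
  by have := opp _ _ _ _ ss zs; rewrite fan_hub_x mulrA sgs mul1r; lra.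
- move=> s s' i j ne zs; have [ss|ss] := pselect (fsign s = fsign s').
    by have [] := fan_x zs; rewrite fan_leaf_x ss mulrA sgs mul1r; lra.
  by have := opp _ _ _ _ ss zs; rewrite fan_leaf_x mulrA sgs mul1r; lra.
- move=> s s' i j z ne z1 z2; have [ss|ss] := pselect (fsign s = fsign s'); last by case: (nopp _
  _ _ _ _ ss z1 z2).
  move: s s' ne ss z1 z2; elim/ord3_ind; elim/ord3_ind => //= _; rewrite /fsign /tri /= => ss z1
    z2; try (exfalso; lra).
    exact: two z1.
  by apply: crossC; exact: two z2.
- by move=> i j z ij z1 z2; case: (row_frontier_disjoint ij z1 z2).
- move=> s i s' i' s'' i'' z n1 n2 n3 z1 z2 z3.
  have [ss|ss] := pselect (fsign s = fsign s'); last exact: (nopp _ _ _ _ _ ss z1 z2).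
  have [ss'|ss'] := pselect (fsign s = fsign s''); last exact: (nopp _ _ _ _ _ ss' z1 z3).
  move: ss ss' n1 n2 n3 {z1 z2 z3}; elim/ord3_ind: s; elim/ord3_ind: s'; elim/ord3_ind: s'' => //;
  by rewrite /fsign /tri /=; lra.
- move=> s i s' i' j z ne z1 z2 zf.
  have [ss|ss] := pselect (fsign s = fsign s'); last exact: (nopp _ _ _ _ _ ss z1 z2).
  (* On a region boundary both edges belong to the same region. Their heights are within 1 / 32 of
     the heights of their leaves, which differ by 1 / 16, so they cannot coincide. *)
  have two' k k' : oseg (fhub ord0) (fleaf ord0 k) z ->
      oseg (fhub (@Ordinal 3 2 isT)) (fleaf (@Ordinal 3 2 isT) k') z -> False.
    move=> y1 y2; have [k1 kN _] := fan_frontier y1 zf; have [k2 _ _] := fan_frontier y2 zf; subst k k'.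
    have zN : `|z.1| <= N by rewrite kN.
    have := side_edge_off n0 row_p_bound row_q_bound j sgN w0a w0b o0a o0b y1 zN.
    have := side_edge_off n0 row_p_bound row_q_bound j sgN w1a w1b o1a o1b y2 zN.
    rewrite /side_leaf /row_p /row_q /off /o1 /= !mul0r !ltr_norml => /andP[? ?] /andP[? ?]; lra.
  move: s s' ne ss z1 z2; elim/ord3_ind; elim/ord3_ind => //= _; rewrite /fsign /tri /= => ss z1
    z2; try lra.
    exact: two' z1 z2.
  exact: two' z2 z1.
- by move=> s i j k z jk _; exact: row_frontier_disjoint.
- by move=> i j k z ij _ _ z1 z2; case: (row_frontier_disjoint ij z1 z2).
Qed.

(** Every edge enters only its own row, through the short side and once, so half the number of
    boundary crossings rounds down to 0. *)
Lemma admits_edge_edge : exists a, admits_drawing R (clustered_stars n) a 0 0.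
Proof.
have H := fan_straight; have [a aE] := straight_edge_edge_finite H.
exists a, (sdraw fhub fleaf N 8^-1 (N + 2) (100 * N ^+ 2) row_p row_q); split=> //.
- exact: straight_clustered_drawing.
- apply: edge_region_none => e mu /edgesP[s [i ->]]; rewrite /= securveE.
  case: mu => [j|]; last by move=> x y [x1 x2]; case: (scurve_root H x1 x2).
  move=> x y [x1 x2] [y1 y2].
  have xN : `|x.1| = N by case: (fan_frontier x1 x2).
  have yN : `|y.1| = N by case: (fan_frontier y1 y2).
  have XN (z : plane) : [set z : plane | `|z.1| = N] z -> `|z.1| = N by [].
  move: s x1 y1 {x2 y2}; elim/ord3_ind => x1 y1.
  + exact: (side_edge_subset1 n0 sgN XN (conj x1 xN) (conj y1 yN)).
  + exact: (side_edge_subset1 n0 sg1 XN (conj x1 xN) (conj y1 yN)).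
  + exact: (side_edge_subset1 n0 sgN XN (conj x1 xN) (conj y1 yN)).
- exact: row_region_region.
Qed.

End Rows.
End Layouts.

(** * Regions around tangents of a parabola *)

Section Tangents.
Variables (R : realType) (n : nat).
Notation plane := (R * R)%type.
Notation N := (n%:R : R).
Hypothesis n0 : (0 < n)%N.

(* The line y = 2 i x - i^2 is tangent to the parabola y = x^2 at x = i, and two
   tangents meet halfway between their points of contact. *)
Definition tan_p (i : 'I_n) : R := 2 * (i : nat)%:R.
Definition tan_q (i : 'I_n) : R := - (i : nat)%:R ^+ 2.

Lemma tan_p_bound i : 0 <= tan_p i /\ tan_p i <= 2 * N.
Proof. by have [i0 i1] := ord_bound R i; rewrite /tan_p; split; lra. Qed.

Lemma tan_q_bound i : - N ^+ 2 <= tan_q i /\ tan_q i <= N ^+ 2.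
Proof.
have [i0 i1] := ord_bound R i; have N1 := N_ge1 R n0; rewrite /tan_q.
by have ii : (i : nat)%:R ^+ 2 <= N ^+ 2 :> R by [nra|]; split; nra.
Qed.

Lemma tan_diff (i j : 'I_n) (z : plane) : off (tan_p j) (tan_q j) z - off (tan_p i) (tan_q i) z =
  ((i : nat)%:R - (j : nat)%:R) * (2 * z.1 - ((i : nat)%:R + (j : nat)%:R)).
Proof. by rewrite /off /tan_p /tan_q; ring. Qed.

(** By [tan_diff] the axes meet only at abscissa (i + j) / 2, at most N - 1, and the leaves at
    distance N - [inset] from 0 are far from it on either side. *)
Lemma tan_gap sg : (sg = 1 \/ sg = -1) -> gap_at tan_p tan_q sg.
Proof.
move=> sgE i j ij; have N1 := N_ge1 R n0; have e0 := inset_gt0 R n0; have e1 := inset_le R n0.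
have := tan_diff i j (side_leaf tan_p tan_q sg 0 i).
have -> : off (tan_p i) (tan_q i) (side_leaf tan_p tan_q sg 0 i) = 0 by rewrite /off /side_leaf
  /=; ring.
rewrite subr0 => ->; rewrite /=.
have [i0 i1] := ord_bound R i; have [j0 j1] := ord_bound R j.
move: ((i : nat)%:R : R) ((j : nat)%:R : R) i0 i1 j0 j1 (ord_gap R ij) => a b a0 a1 b0 b1 g.
case: sgE => ->; case: g => g.
- by left; nra.
- by right; nra.
- by right; nra.
- by left; nra.
Qed.

(** The top leaf is the point of contact (i, i^2), which lies above all other tangents. *)
Lemma tan_top_off i j : off (tan_p j) (tan_q j) (top_leaf tan_p tan_q i) = ((i : nat)%:R - (j :
  nat)%:R) ^+ 2.
Proof. by rewrite /off /top_leaf /tan_p /tan_q /=; ring. Qed.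

Lemma tan_top_ge1 i j : i != j -> 1 <= off (tan_p j) (tan_q j) (top_leaf tan_p tan_q i).
Proof. by move=> /(ord_gap R) g; rewrite tan_top_off; case: g => g; nra. Qed.

Lemma tan_top_gap i j : i != j -> 1 <= `|off (tan_p j) (tan_q j) (top_leaf tan_p tan_q i)|.
Proof. by move=> /tan_top_ge1 h; rewrite ger0_norm; lra. Qed.

Lemma tan_top_det i j : i != j ->
  crossp (top_leaf tan_p tan_q i - top_hub R n) (top_leaf tan_p tan_q j - top_hub R n) != 0.
Proof.
move=> /(ord_gap R) g; rewrite /crossp /top_leaf /tan_p /tan_q /=; have N0 := N_gt0 R n0.
have [i0 i1] := ord_bound R i; have [j0 j1] := ord_bound R j.
move: ((i : nat)%:R : R) ((j : nat)%:R : R) i0 i1 j0 j1 g => a b a0 a1 b0 b1 g.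
have -> : (a - 0) * (2 * b * b + - b ^+ 2 - 10 * N ^+ 2) - (2 * a * a + - a ^+ 2 - 10 * N ^+ 2) *
  (b - 0) =
   (10 * N ^+ 2 + a * b) * (b - a) by ring.
rewrite mulf_neq0 //; last by apply/eqP; case: g; lra.
by rewrite lt0r_neq0 // ltr_pwDl // ?mulr_ge0 // mulr_gt0 // exprn_gt0.
Qed.

(** At a common point of two regions the offsets differ by at most 1 / 4, while [tan_diff] has a
    factor of absolute value at least 1. The point is thus within 1 / 8 of the midpoint (i + j) / 2
    horizontally. *)
Lemma tan_close i j (z : plane) : i != j -> `|off (tan_p i) (tan_q i) z| <= 8^-1 ->
  `|off (tan_p j) (tan_q j) z| <= 8^-1 ->
  - 4^-1 <= 2 * z.1 - ((i : nat)%:R + (j : nat)%:R) /\ 2 * z.1 - ((i : nat)%:R + (j : nat)%:R) <= 4^-1.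
Proof.
move=> /(ord_gap R) g; rewrite !ler_norml => /andP[h1 h2] /andP[h3 h4].
have := tan_diff i j z; set D := 2 * z.1 - _.
move: ((i : nat)%:R : R) ((j : nat)%:R : R) g => a b g e.
have k1 : - 4^-1 <= (a - b) * D by lra.
have k2 : (a - b) * D <= 4^-1 by lra.
by case: g => g; split; nra.
Qed.

Lemma tan_region_region i j z : i != j -> frontier (para N (tan_p i) (tan_q i) 8^-1) z ->
  frontier (para N (tan_p j) (tan_q j) 8^-1) z ->
  [/\ `|z.1| < N, `|off (tan_p i) (tan_q i) z| = 8^-1, `|off (tan_p j) (tan_q j) z| = 8^-1
    & tan_p i != tan_p j].
Proof.
move=> ij /(para_frontier _ _ (N_gt0 R n0) (eighth_gt0 R))[a1 a2 a3].
move=> /(para_frontier _ _ (N_gt0 R n0) (eighth_gt0 R))[b1 b2 b3].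
have [h1 h2] := tan_close ij a2 b2; have N1 := N_ge1 R n0.
have [i0 i1] := ord_bound R i; have [j0 j1] := ord_bound R j.
have zN : `|z.1| < N by rewrite ltr_norml; apply/andP; split; lra.
split=> //.
- by case: a3 => // e; rewrite e ltxx in zN.
- by case: b3 => // e; rewrite e ltxx in zN.
- by apply/eqP; rewrite /tan_p; case: (ord_gap R ij); lra.
Qed.

Lemma top_edge_param i j (z : plane) : oseg (top_hub R n) (top_leaf tan_p tan_q i) z ->
  exists t, [/\ 0 < t, t < 1, z = segpt (top_hub R n) (top_leaf tan_p tan_q i) t &
    off (tan_p j) (tan_q j) z = off (tan_p j) (tan_q j) (top_leaf tan_p tan_q i) +
      (1 - t) * (off (tan_p j) (tan_q j) (top_hub R n) - off (tan_p j) (tan_q j) (top_leaf tan_p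
        tan_q i))].
Proof.
move=> /osegP[t [t0 t1 zE]]; exists t; split=> //.
by rewrite zE /off /segpt /=; ring.
Qed.

(** Going up from the leaf, the offset from tangent j starts at (i - j)^2 and increases. For j
    different from i it stays above 1; for j = i it grows from 0 and passes 1 / 8 at the upper flat
    side. *)
Lemma top_edge_frontier i j (z : plane) : oseg (top_hub R n) (top_leaf tan_p tan_q i) z ->
  frontier (para N (tan_p j) (tan_q j) 8^-1) z -> i = j /\ off (tan_p j) (tan_q j) z = 8^-1.
Proof.
move=> zs /(para_frontier _ _ (N_gt0 R n0) (eighth_gt0 R))[a1 a2 a3].
have [t [t0 t1 zE oE]] := top_edge_param j zs.
have lt := top_off_lt n0 tan_p_bound tan_q_bound i j.
have pos : 0 < (1 - t) * (off (tan_p j) (tan_q j) (top_hub R n) - off (tan_p j) (tan_q j)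
  (top_leaf tan_p tan_q i)).
  by rewrite mulr_gt0 // subr_gt0.
move: a2; rewrite ler_norml => /andP[h1 h2].
have ij : i = j.
  by apply/eqP/negPn/negP => /tan_top_ge1; lra.
subst j; split=> //.
have o0 : off (tan_p i) (tan_q i) (top_leaf tan_p tan_q i) = 0 by rewrite tan_top_off subrr expr0n.
have op : 0 < off (tan_p i) (tan_q i) z by rewrite oE o0 add0r -[X in _ * (_ - X)]o0.
have [z0 z1] := top_edge_x zs; have N1 := N_ge1 R n0.
case: a3 => [e|]; last by rewrite gtr0_norm.
by move: e; rewrite ger0_norm //; lra.
Qed.

Let sgN : (-1 = 1 :> R \/ -1 = -1 :> R). Proof. by right. Qed.
Let sg1 : (1 = 1 :> R \/ 1 = -1 :> R). Proof. by left. Qed.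
Let w0a : -2^-1 <= 0 :> R. Proof. lra. Qed.
Let w0b : 0 <= 2^-1 :> R. Proof. lra. Qed.
Let o0a : -16^-1 <= 0 :> R. Proof. lra. Qed.
Let o0b : 0 <= 16^-1 :> R. Proof. lra. Qed.

Lemma tan_edge_frontier s i j z : oseg (thub R n s) (tleaf tan_p tan_q s i) z ->
  frontier (para N (tan_p j) (tan_q j) 8^-1) z -> i = j.
Proof.
have pb := tan_p_bound; have qb := tan_q_bound.
elim/ord3_ind: s => z1 z2.
- by case: (side_edge_frontier n0 pb qb sgN w0a w0b o0a o0b (tan_gap sgN) z1 z2).
- by case: (side_edge_frontier n0 pb qb sg1 w0a w0b o0a o0b (tan_gap sg1) z1 z2).
- by case: (top_edge_frontier z1 z2).
Qed.

Lemma tan_straight :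
  straight_hyp (thub R n) (tleaf tan_p tan_q) N 8^-1 (N + 2) (100 * N ^+ 2) tan_p tan_q.
Proof.
apply: (top_layout_straight n0 tan_p_bound tan_q_bound (tan_gap sgN) (tan_gap sg1) tan_top_gap
  tan_top_det).
- exact: tan_region_region.
- move=> s i j k z jk zs z1 z2; case/eqP: jk.
  by rewrite -(tan_edge_frontier zs z1) -(tan_edge_frontier zs z2).
- move=> i j k z ij jk ik.
  move=> /(para_frontier _ _ (N_gt0 R n0) (eighth_gt0 R))[_ a2 _].
  move=> /(para_frontier _ _ (N_gt0 R n0) (eighth_gt0 R))[_ b2 _].
  move=> /(para_frontier _ _ (N_gt0 R n0) (eighth_gt0 R))[_ c2 _].
  have [h1 h2] := tan_close ij a2 b2; have [h3 h4] := tan_close jk b2 c2.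
  (* A common point of three regions would be within 1 / 8 of both (i + j) / 2 and (j + k) / 2, but
     these are at least 1 / 2 apart. *)
  by case: (ord_gap R ik); lra.
Qed.

Lemma admits_region_region : exists c, admits_drawing R (clustered_stars n) 0 0 c.
Proof.
have H := tan_straight; pose D := sdraw (thub R n) (tleaf tan_p tan_q) N 8^-1 (N + 2) (100 * N ^+
  2) tan_p tan_q.
have [c cE] : exists c, region_region_crossings D c.
  apply: region_region_finite => -[i|] [j|]; rewrite stars_incomparable //= => /andP[ne _].
  set X := para _ _ _ _; set Y := para _ _ _ _; pose o := off (tan_p j) (tan_q j).
  have oE (w : plane) : o w = aff (- tan_p j) 1 (- tan_q j) w by rewrite /o /off /aff; ring.
  have cvx (P : plane -> Prop) : (forall x y z, seg x y z -> P x -> P y -> P z) -> connected (X `&` P).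
    move=> Pc; apply: convex_connected => x y [Xx Px] [Xy Py] z xyz; split; first exact: para_seg
      Xx Xy _ xyz.
    exact: Pc xyz Px Py.
  (* What remains of one parallelogram is the convex part above the other strip and the convex part
     below it. The side bounds of the other one cut nothing off, as both have the same horizontal
     range. *)
  apply: (@components_cover2 _ _ (X `&` [set z | 8^-1 < o z]) (X `&` [set z | o z < - 8^-1])).
  + apply/seteqP; split=> [z [Xz nY]|z].
      have [h|h] := ltP 8^-1 (o z); first by left.
      have [h'|h'] := ltP (o z) (- 8^-1); first by right.
      by case: nY; split; [case: Xz|rewrite ler_norml h' h].
    case=> -[Xz /= h]; split=> // -[_]; rewrite ler_norml => /andP[? ?]; move: h; rewrite /o; lra.
  + apply: cvx => x y z xyz /=; rewrite !oE.
    move: xyz => [t /=]; rewrite in_itv /= => /andP[t0 t1] <-.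
    have -> : aff (- tan_p j) 1 (- tan_q j) (segpt x y t) =
        (1 - t) * aff (- tan_p j) 1 (- tan_q j) x + t * aff (- tan_p j) 1 (- tan_q j) y.
      by rewrite /aff /segpt /=; ring.
    by move: (aff _ _ _ x) (aff _ _ _ y) => a b ha hb; have [->|?] := eqVneq t 1; [lra|nra].
  + apply: cvx => x y z xyz /=; rewrite !oE.
    move: xyz => [t /=]; rewrite in_itv /= => /andP[t0 t1] <-.
    have -> : aff (- tan_p j) 1 (- tan_q j) (segpt x y t) =
        (1 - t) * aff (- tan_p j) 1 (- tan_q j) x + t * aff (- tan_p j) 1 (- tan_q j) y.
      by rewrite /aff /segpt /=; ring.
    by move: (aff _ _ _ x) (aff _ _ _ y) => a b ha hb; have [->|?] := eqVneq t 1; [lra|nra].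
exists c, D; split=> //.
- exact: straight_clustered_drawing.
- exact: (top_layout_edge_edge n0 tan_p_bound tan_q_bound (tan_gap sgN) (tan_gap sg1) tan_top_gap
  tan_top_det).
- apply: edge_region_none => e mu /edgesP[s [i ->]]; rewrite /= securveE.
  case: mu => [j|]; last by move=> x y [x1 x2]; case: (scurve_root H x1 x2).
  have pb := tan_p_bound; have qb := tan_q_bound.
  have XN (z : plane) : [set z : plane | `|z.1| = N] z -> `|z.1| = N by [].
  elim/ord3_ind: s => x y [x1 x2] [y1 y2].
  + have [_ xN _] := side_edge_frontier n0 pb qb sgN w0a w0b o0a o0b (tan_gap sgN) x1 x2.
    have [_ yN _] := side_edge_frontier n0 pb qb sgN w0a w0b o0a o0b (tan_gap sgN) y1 y2.
    exact: (side_edge_subset1 n0 sgN XN (conj x1 xN) (conj y1 yN)).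
  + have [_ xN _] := side_edge_frontier n0 pb qb sg1 w0a w0b o0a o0b (tan_gap sg1) x1 x2.
    have [_ yN _] := side_edge_frontier n0 pb qb sg1 w0a w0b o0a o0b (tan_gap sg1) y1 y2.
    exact: (side_edge_subset1 n0 sg1 XN (conj x1 xN) (conj y1 yN)).
  + have [_ xo] := top_edge_frontier x1 x2; have [_ yo] := top_edge_frontier y1 y2.
    have [t [_ _ xE xo']] := top_edge_param j x1; have [u [_ _ yE yo']] := top_edge_param j y1.
    have lt := top_off_lt n0 pb qb i j.
    rewrite xE yE; suff -> : t = u by [].
    have k0 : off (tan_p j) (tan_q j) (top_hub R n) - off (tan_p j) (tan_q j) (top_leaf tan_p
      tan_q i) != 0.
      by rewrite lt0r_neq0 // subr_gt0.
    have : 1 - t = 1 - u by apply: (mulIf k0); lra.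
    lra.
Qed.

End Tangents.

Theorem theorem6 (R : realType) :
  exists F : clustered_graph -> Prop,
    [/\ forall N : nat, exists2 C, F C & (N <= #|ugraph C|)%N,
        forall C, F C -> [/\ ~ c_connected C, flat C & planar R (ugraph C)],
        forall C, F C ->
          [/\ exists alpha : nat, admits_drawing R C alpha 0 0,
              exists beta : nat, admits_drawing R C 0 beta 0
            & exists gamma : nat, admits_drawing R C 0 0 gamma]
      & exists2 c : R, 0 < c & exists n0 : nat,
          forall C, F C -> (n0 <= #|ugraph C|)%N ->
          forall alpha beta gamma : nat, admits_drawing R C alpha beta gamma ->
            c * #|ugraph C|%:R ^+ 2 <= (alpha + beta + gamma)%:R].
Proof.
exists (fun C => exists2 n, (0 < n)%N & C = clustered_stars n); split.
- move=> N; exists (clustered_stars N.+1); first by exists N.+1.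
  by rewrite card_stars; lia.
- move=> _ [n n0 ->]; split.
  + exact: (@stars_not_c_connected n (Ordinal n0)).
  + exact: stars_flat.
  (* A drawing without edge-edge crossings shows planarity. *)
  + have [b [D [[drawD _ _ _ _] ee _ _]]] := admits_edge_region R n0.
    exists (pos D), (ecurve D); split=> // e f eE fE ef.
    apply/seteqP; split=> // z [ez fz].
    have /card_eq_inj[g [g0 _]] := ee.
    have : (g z < 0)%N by apply: g0; exists e, f.
    by [].
- by move=> _ [n n0 ->]; split; [exact: admits_edge_edge|exact: admits_edge_region|exact:
  admits_region_region].
(* For n >= 6 the bound n^2 <= 6 t + 3 n gives t >= n^2 / 12, while 3 (n + 1) <= 4 n. *)
- exists (192%:R^-1); first by rewrite invr_gt0.
  exists 21%N => _ [n n0 ->]; rewrite card_stars => n21 a b c [D /stars_lower_bound H].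
  rewrite mulrC ler_pdivrMr // -natrX -natrM ler_nat.
  by move: n21 H; nia.
Qed.
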